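(* Assume $\lambda_B>C_1$. For every $x\in V$ and $\epsilon>0$ the random dynamical system $\phi^{\epsilon,x}$ generated by the mild form of $$dY^{\epsilon,x}(t)=\tfrac1\epsilon BY^{\epsilon,x}(t)\,dt+\tfrac1\epsilon g(x,Y^{\epsilon,x}(t))\,dt+d\omega_{2,\epsilon}(t)$$ has a random fixed point $Y_F^\epsilon(\omega_2,x)$ which is tempered and pullback and forward exponentially attracting. The exponential rate of the forward and pullback convergence to the random fixed point is $\frac{\lambda_B-C_1}{\epsilon}$.
   Context: $V$ is a separable Hilbert space with norm $\|\cdot\|$. $H_1\in(1/2,1)$, $H_2\in(1-H_1,1)$, $0<\gamma'<H_2$. $-B$ is a closed positive symmetric operator on $V$ with compact inverse, $S_B$ is the analytic semigroup generated by $B$, with $\|S_B(t)\|\le e^{-\lambda_Bt}$, $t\ge0$, $\lambda_B>0$; $S_{B/\epsilon}(t)=S_B(t/\epsilon)$. $g:V\times V\to V$ satisfies $\|g(x_1,y_1)-g(x_2,y_2)\|\le C_1(\|x_1-x_2\|+\|y_1-y_2\|)$, $C_1>0$, and $C_2=\|g(0,0)\|$. $\Omega_2=C_0(\mathbb R;V)\cap C^{\gamma'}(\mathbb R;V)$ (paths vanishing at $0$, Hölder on compact intervals), with the measure $\mathbb P_{H_2}$ making the canonical process $\omega_2$ a centered two-sided fractional Brownian motion with covariance $Q_2(|t|^{2H_2}+|s|^{2H_2}-|t-s|^{2H_2})$, $Q_2$ positive symmetric trace class and diagonal in the eigenbasis of $-B$. $\theta_t\omega_2(\cdot)=\omega_2(\cdot+t)-\omega_2(t)$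 is the (ergodic) shift flow. $\omega_{2,\epsilon}(t)=\omega_2(t/\epsilon)$. The shift of the scaled path satisfies $\theta_t\omega_{2,\epsilon}=(\theta_{t/\epsilon}\omega_2)_{2,\epsilon}$; accordingly the equation with parameter $\epsilon$ is viewed over the flow $\vartheta^\epsilon_t:=\theta_{t/\epsilon}$ (the shift by $t$ of the driving path $\omega_{2,\epsilon}$; in the paper simply written $\theta_t$). $\phi^{\epsilon,x}(t,\omega_2,y)$ is the solution at time $t\ge 0$ of $Y(t)=S_{B/\epsilon}(t)y+\frac1\epsilon\int_0^tS_{B/\epsilon}(t-r)g(x,Y(r))dr+\omega_{2,\epsilon}(t)+\frac1\epsilon B\int_0^tS_{B/\epsilon}(t-r)\omega_{2,\epsilon}(r)dr$; it satisfies $\phi^{\epsilon,x}(t+\tau,\omega_2,\cdot)=\phi^{\epsilon,x}(t,\vartheta^\epsilon_\tau\omega_2,\cdot)\circ\phi^{\epsilon,x}(\tau,\omega_2,\cdot)$. A random variable $R\ge0$ is tempered if $\lim_{t\to\pm\infty}\log^+R(\vartheta^\epsilon_t\omega_2)/|t|=0$ on an invariant set of full measure. A random fixed point is a $V$-valued random variable $Y$ with $\phi^{\epsilon,x}(t,\omega_2,Y(\omega_2))=Y(\vartheta_t^\epsilon\omega_2)$ for all $t\ge0$ on a $(\theta_t)_{t\in\mathbb R}$-invariant set of full measure; it is tempered if $\|Y\|$ is tempered. Attraction. Let $Z^\epsilon(\omega_2)=\frac1\epsilon B\int_{-\infty}^0S_{B/\epsilon}(-q)\omega_{2,\epsilon}(q)dq$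 (defined on the full-measure invariant set of $\omega_2$ with $\|\omega_2(t)\|e^{-|t|/m}\to0$ as $t\to\pm\infty$ for every $m\in\mathbb N$), $\tilde R^{\epsilon,x}(\omega_2)=2\int_{-\infty}^0e^{(\lambda_B-C_1)r/\epsilon}\frac1\epsilon\big(C_1(\|Z^\epsilon(\vartheta^\epsilon_r\omega_2)\|+\|x\|)+C_2\big)dr$, and let $C^{\epsilon,x}(\omega_2)$ be the closed ball with center $Z^\epsilon(\omega_2)$ and radius $\tilde R^{\epsilon,x}(\omega_2)$. The fixed point $Y$ is pullback and forward attracting if for every measurable selector $y(\omega_2)\in C^{\epsilon,x}(\omega_2)$, $\lim_{t\to\infty}\|\phi^{\epsilon,x}(t,\vartheta^\epsilon_{-t}\omega_2,y(\vartheta^\epsilon_{-t}\omega_2))-Y(\omega_2)\|=0$ and $\lim_{t\to\infty}\|\phi^{\epsilon,x}(t,\omega_2,y(\omega_2))-Y(\vartheta^\epsilon_t\omega_2)\|=0$ on an invariant set of full measure. It is exponentially attracting with rate $k$ if for every $\kappa<k$ both expressions multiplied by $e^{\kappa t}$ tend to $0$. *)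

(* Defs.v *)
From HB Require Import structures.
From mathcomp Require Import all_boot all_order all_algebra.
From mathcomp Require Import sesquilinear.
From mathcomp Require Import all_classical all_reals all_analysis.

Set Implicit Arguments.
Unset Strict Implicit.
Unset Printing Implicit Defensive.

Import Order.TTheory GRing.Theory Num.Theory.
Import numFieldNormedType.Exports.

Local Open Scope classical_set_scope.
Local Open Scope ring_scope.

Section Hilbert.
Context {R : realType} {V : completeNormedModType R}.

Definition separable : Prop := exists2 A : set V, countable A & dense A.

(* The norm of V is the Hilbert norm of the inner product ip. *)
Definition hilbert_norm (ip : {dot V for idfun}) : Prop :=
  forall v, ip v v = `|v| ^+ 2.

(* Maximal orthonormal family; I is finite when V is finite dimensional. *)
Definition orthonormal_basis (ip : {dot V for idfun}) (I : countType)
    (e : I -> V) : Prop :=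
  (forall i j, ip (e i) (e j) = (i == j)%:R) /\
  (forall v, (forall i, ip v (e i) = 0) -> v = 0).

(* An unbounded operator is a pair of a domain D and a map A : V -> V whose
   values outside D are irrelevant. *)

Definition linear_op (D : set V) (A : V -> V) : Prop :=
  D 0 /\ forall a u v, D u -> D v ->
    D (a *: u + v) /\ A (a *: u + v) = a *: A u + A v.

Definition closed_op (D : set V) (A : V -> V) : Prop :=
  closed [set p : V * V | D p.1 /\ p.2 = A p.1].

Definition symmetric_op (ip : {dot V for idfun}) (D : set V) (A : V -> V) :
    Prop :=
  dense D /\ forall u v, D u -> D v -> ip (A u) v = ip u (A v).

Definition positive_op (ip : {dot V for idfun}) (D : set V) (A : V -> V) :
    Prop :=
  forall u, D u -> 0 <= ip (A u) u.

Definition compact_inverse (D : set V) (A : V -> V) : Prop :=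
  exists K : {linear V -> V},
    [/\ precompact (K @` closed_ball 0 1),
        forall v, D (K v) /\ A (K v) = v &
        forall u, D u -> K (A u) = u].

Definition C0_semigroup (S : R -> {linear V -> V}) : Prop :=
  [/\ forall u, S 0 u = u,
      forall (s t : R) u, 0 <= s -> 0 <= t -> S (s + t) u = S s (S t u),
      forall t : R, 0 <= t -> continuous (S t) &
      forall u, S t u @[t --> 0^'+] --> u].

Definition generator (S : R -> {linear V -> V}) (D : set V) (A : V -> V) :
    Prop :=
  forall u v, (D u /\ A u = v) <-> h^-1 *: (S h u - u) @[h --> 0^'+] --> v.

(* Multiplication by the complex number z.1 + i z.2 on the complexification
   V + iV, represented by V * V. *)
Definition cscale (z : R * R) (p : V * V) : V * V :=
  (z.1 *: p.1 - z.2 *: p.2, z.1 *: p.2 + z.2 *: p.1).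

Definition sector (delta : R) : set (R * R) :=
  [set z | 0 < z.1 /\ `|z.2| < delta * z.1].

(* S extends to a holomorphic semigroup of bounded complex linear operators on
   V + iV over a complex sector around the half-line t > 0, strongly continuous
   at 0; T z u is the value at the vector u of V, and a complex linear operator
   is determined by its values on V. *)
Definition analytic_semigroup (S : R -> {linear V -> V}) : Prop :=
  C0_semigroup S /\
  exists2 delta : R, 0 < delta &
  exists T : R * R -> {linear V -> (V * V)%type},
    [/\ forall z, sector delta z -> continuous (T z),
        forall (t : R) u, 0 < t -> T (t, 0) u = (S t u, 0),
        forall z w u, sector delta z -> sector delta w ->
          T (z + w) u = T z (T w u).1 + cscale (0, 1) (T z (T w u).2),
        forall z u, sector delta z -> exists d : V * V,
          `|h|^-1 *: (T (z + h) u - T z u - cscale h d)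
            @[h --> (0 : R * R)^'] --> (0 : V * V) &
        forall u, T z u @[z --> within (sector delta) (nbhs (0 : R * R))]
                    --> (u, 0 : V)].

(* Bochner integral with respect to the Lebesgue measure on R. *)

Definition simple_on (D : set R) (s : R -> V) : Prop :=
  finite_set (s @` D) /\
  forall v : V, v != 0 -> measurable (D `&` s @^-1` [set v]) /\
    (lebesgue_measure (D `&` s @^-1` [set v]) < +oo)%E.

Definition simple_integral (D : set R) (s : R -> V) : V :=
  \sum_(v \in s @` D) fine (lebesgue_measure (D `&` s @^-1` [set v])) *: v.

Definition is_bochner (D : set R) (f : R -> V) (J : V) : Prop :=
  exists s : nat -> R -> V,
    [/\ forall n, simple_on D (s n),
        forall r, D r -> s n r @[n --> \oo] --> f r,
        (\int[lebesgue_measure]_(r in D) (`|f r - s n r|)%:E)%E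
          @[n --> \oo] --> 0%E &
        simple_integral D (s n) @[n --> \oo] --> J].

(* Arbitrary when f is not Bochner integrable over D. *)
Definition bochner (D : set R) (f : R -> V) : V := get (is_bochner D f).

End Hilbert.
Arguments separable {R} V.

Definition borel (T : ptopologicalType) := g_sigma_algebraType (@open T).

(* Omega_2: paths vanishing at 0 and gamma-Hoelder on compact intervals. *)

Definition locally_holder {R : realType} {V : normedModType R} (gamma : R)
    (w : R -> V) : Prop :=
  forall a b, exists C, forall s t, s \in `[a, b] -> t \in `[a, b] ->
    `|w t - w s| <= C * `|t - s| `^ gamma.

Record hpath {R : realType} (V : normedModType R) (gamma : R) := Path {
  path_fun :> R -> V;
  path_fun0 : path_fun 0 = 0;
  path_holder : locally_holder gamma path_fun }.

Section PathSpace.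
Context {R : realType} {V : normedModType R} {gamma : R}.
Implicit Types w : hpath V gamma.

Lemma zero_path_holder : locally_holder gamma (fun _ : R => 0 : V).
Proof.
by move=> a b; exists 0 => s t _ _; rewrite subrr normr0 mul0r.
Qed.

Definition zero_path : hpath V gamma := Path erefl zero_path_holder.

HB.instance Definition _ := gen_eqMixin (hpath V gamma).
HB.instance Definition _ := gen_choiceMixin (hpath V gamma).
HB.instance Definition _ := isPointed.Build (hpath V gamma) zero_path.

Definition cylinders : set (set (hpath V gamma)) :=
  [set A | exists t : R, exists2 U : set V,
     open U & A = [set w : hpath V gamma | U (w t)]].

(* The sigma-algebra generated by the canonical process; for separable V it is
   the trace of the Borel sigma-algebra of C_0(R; V). *)
HB.instance Definition _ := @isMeasurable.Build (sigma_display cylinders)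
  (hpath V gamma) <<s cylinders >> (@sigma_algebra0 _ setT cylinders)
  (@sigma_algebraC _ cylinders) (@sigma_algebra_bigcup _ setT cylinders).

Lemma shift_path0 w (t : R) : w (0 + t) - w t = 0.
Proof. by rewrite add0r subrr. Qed.

Lemma shift_path_holder w (t : R) :
  locally_holder gamma (fun s => w (s + t) - w t).
Proof.
move=> a b; have [C HC] := path_holder w (a + t) (b + t).
exists C => s r; rewrite !in_itv /= => /andP[as_ sb] /andP[ar rb].
have := HC (s + t) (r + t); rewrite !in_itv /= !lerD2r as_ sb ar rb.
have -> : r + t - (s + t) = r - s by rewrite opprD addrACA subrr addr0.
have -> : w (r + t) - w t - (w (s + t) - w t) = w (r + t) - w (s + t).
  by rewrite opprB addrA subrK.
by apply.
Qed.

Definition theta (t : R) w : hpath V gamma :=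
  Path (shift_path0 w t) (shift_path_holder w t).

(* The shift by t of the scaled path r |-> w (r / eps). *)
Definition vtheta (eps t : R) w : hpath V gamma := theta (t / eps) w.

End PathSpace.

Section Noise.
Context {R : realType} {V : completeNormedModType R} {gamma : R}.
Local Notation Omega := (hpath V gamma).
Variable P : probability Omega R.

(* The Dirac mass at 0 is a centered Gaussian law. *)
Definition centered_gaussian (X : Omega -> R) : Prop :=
  exists2 s : R, 0 <= s &
    forall A : set (measurableTypeR R), measurable A ->
      P (X @^-1` A) =
      if s == 0 then \d_(0 : measurableTypeR R) A else normal_prob 0 s A.

(* Covariance Q (|t|^2H + |s|^2H - |t - s|^2H), without a factor 1/2. *)
Definition fbm_law (ip : {dot V for idfun}) (H : R) (Q : V -> V) : Prop :=
  (forall n (t : 'I_n -> R) (v : 'I_n -> V),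
     centered_gaussian (fun w => \sum_(i < n) ip (w (t i)) (v i))) /\
  (forall s t u v,
     covariance P (fun w => ip (w t) u) (fun w => ip (w s) v) =
     ((`|t| `^ (2 * H) + `|s| `^ (2 * H) - `|t - s| `^ (2 * H))
        * ip (Q u) v)%:E).

Definition ergodic_shift : Prop :=
  (forall t (A : set Omega), measurable A -> P (theta t @^-1` A) = P A) /\
  (forall A : set Omega, measurable A -> (forall t, theta t @^-1` A = A) ->
     P A = 0%E \/ P A = 1%E).

Definition full_invariant (A : set Omega) : Prop :=
  [/\ measurable A, P A = 1%E & forall t, theta t @^-1` A = A].

Definition log_plus (r : R) : R := Num.max 0 (ln r).

Definition tempered (eps : R) (X : Omega -> R) : Prop :=
  exists2 A, full_invariant A & forall w, A w ->
    (log_plus (X (vtheta eps t w)) / `|t|) @[t --> +oo] --> 0 /\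
    (log_plus (X (vtheta eps t w)) / `|t|) @[t --> -oo] --> 0.

Definition random_variable (Y : Omega -> V) : Prop :=
  measurable_fun setT (Y : Omega -> borel V).

End Noise.

Section Equation.
Context {R : realType} {V : completeNormedModType R} {gamma : R}.
Local Notation Omega := (hpath V gamma).
Variables (D : set V) (B : V -> V) (S : R -> {linear V -> V}).
Variables (g : V -> V -> V) (eps : R) (x : V).

Definition mild_solution (w : Omega) (y : V) (Y : R -> V) : Prop :=
  {within `[0, +oo[, continuous Y} /\
  forall t : R, 0 <= t -> exists I1 I2 : V,
    [/\ is_bochner `[0, t] (fun r => S ((t - r) / eps) (g x (Y r))) I1,
        is_bochner `[0, t] (fun r => S ((t - r) / eps) (w (r / eps))) I2,
        D I2 &
        Y t = S (t / eps) y + eps^-1 *: I1 + w (t / eps) + eps^-1 *: B I2].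

(* Measurable cocycle over the flow vtheta eps. *)
Definition is_rds (phi : R -> Omega -> V -> V) : Prop :=
  [/\ measurable_fun [set p : measurableTypeR R * Omega * borel V | 0 <= p.1.1]
        (fun p => phi p.1.1 p.1.2 p.2 : borel V),
      forall w y, phi 0 w y = y &
      forall (t s : R) w y, 0 <= t -> 0 <= s ->
        phi (t + s) w y = phi t (vtheta eps s w) (phi s w y)].

(* The integral exists and lies in the domain of B for almost every path; on
   the other paths the value is irrelevant. *)
Definition Zst (w : Omega) : V :=
  eps^-1 *: B (bochner `]-oo, 0] (fun q => S (- q / eps) (w (q / eps)))).

Definition radius (lB C1 C2 : R) (w : Omega) : \bar R :=
  (2%:E * \int[lebesgue_measure]_(r in `]-oo, 0%R])
    (expR ((lB - C1) * r / eps) *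
     (eps^-1 * (C1 * (`|Zst (vtheta eps r w)| + `|x|) + C2)))%:E)%E.

Definition attracting_ball (lB C1 C2 : R) (w : Omega) : set V :=
  [set y | (`|y - Zst w|%:E <= radius lB C1 C2 w)%E].

Variable P : probability Omega R.

Definition random_fixed_point (phi : R -> Omega -> V -> V) (Y : Omega -> V) :
    Prop :=
  random_variable Y /\
  exists2 A, full_invariant P A & forall w, A w -> forall t : R, 0 <= t ->
    phi t w (Y w) = Y (vtheta eps t w).

Definition selector (C : Omega -> set V) (y : Omega -> V) : Prop :=
  random_variable y /\
  exists2 A, full_invariant P A & forall w, A w -> C w (y w).

Definition attracting (phi : R -> Omega -> V -> V) (C : Omega -> set V)
    (Y : Omega -> V) : Prop :=
  forall y, selector C y ->
  exists2 A, full_invariant P A & forall w, A w ->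
    `|phi t (vtheta eps (- t) w) (y (vtheta eps (- t) w)) - Y w|
      @[t --> +oo] --> 0 /\
    `|phi t w (y w) - Y (vtheta eps t w)| @[t --> +oo] --> 0.

Definition exp_attracting (phi : R -> Omega -> V -> V) (C : Omega -> set V)
    (Y : Omega -> V) (k : R) : Prop :=
  forall y, selector C y ->
  exists2 A, full_invariant P A & forall w, A w -> forall kappa, kappa < k ->
    (expR (kappa * t) *
      `|phi t (vtheta eps (- t) w) (y (vtheta eps (- t) w)) - Y w|)
      @[t --> +oo] --> 0 /\
    (expR (kappa * t) * `|phi t w (y w) - Y (vtheta eps t w)|)
      @[t --> +oo] --> 0.

End Equation.

(* Main.v *)
(* Two solutions contract at the rate k = (lB - C1) / eps: compare the mild
   forms at the time where exp (k t) |Y1 t - Y2 t| is maximal. The fixed point is the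
   pullback limit of phi n (vtheta eps (- n) w) 0, which converges
   exponentially as soon as phi t w 0 grows at most polynomially in t, with a
   constant that grows at most linearly along the shift. Both hold on the
   invariant set of paths with
     |w (s + u) - w s| <= C (1 + |s|) (1 + |u|)^2 |u|^al  for some C,
   where al = H2 / 2. There the noise w + B (S * w) is estimated coordinatewise
   in the eigenbasis: subtracting w t under the integral leaves
     lam exp (- lam r) |w (t - r) - w t|,
   and lam exp (- lam r) <= (2 / r) exp (- lB r / 2) makes the singularity
   integrable, uniformly in lam. Hilbert-valued integrals are only ever
   compared with scalar ones by pairing with vectors.
   That almost every path lies in the set is Kolmogorov's chaining argument:
   the increments are Gaussian with square-exponential tails, stationary by
   invariance of the measure, and Borel-Cantelli over the dyadic grid is
   replaced by an explicit union bound with the weights (1 + |l|)^-2. *)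

Require Import Defs.
From HB Require Import structures.
From mathcomp Require Import finmap.
From mathcomp Require Import all_boot all_order all_algebra.
From mathcomp Require Import sesquilinear.
From mathcomp Require Import all_classical all_reals all_analysis.
From mathcomp Require Import measurable_realfun zify ring lra.

Set Implicit Arguments.
Unset Strict Implicit.
Unset Printing Implicit Defensive.

Import Order.TTheory GRing.Theory Num.Theory.
Import numFieldNormedType.Exports.

Local Open Scope classical_set_scope.
Local Open Scope ring_scope.

(** * Hilbert space and Parseval *)

(** Halving the exponent, [al = H2 / 2], is what lets the union bound converge: an increment over a
    time h has size of order h^H2, the threshold is of order h^al, and their ratio blows up as h
    tends to 0, so the Gaussian tails are summable over all scales. The weight 1 + |s| has two
    roles: it raises the thresholds with the position, so that the bound also converges over the
    whole line, and, as 1 + |s + t| <= (1 + |s|) (1 + |t|), it makes the set of paths shift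
    invariant with constants that exp (- k n) still sums. The contraction is deterministic and holds
    on every path, since [phi] solves the mild equation on every path; only the orbit of 0 and the
    size of the attracting ball call for the good set. Integrals are never constructed: a mild
    solution supplies its own as witnesses, with the noise integral in the domain of [B], while the
    integral inside [Zst] may be a default value, and it suffices to bound [Zst] in that case
    too. *)

Lemma cvg_le_cst {R : realType} (T : Type) (F : set_system T)
    {FF : ProperFilter F} (f : T -> R) l K :
  f @ F --> l -> (forall x, f x <= K) -> l <= K.
Proof.
move=> fl fK; have fc : cvg (f @ F) by apply/cvg_ex; exists l.
rewrite -(cvg_lim _ fl)//; apply: limr_le => //; exact: nearW.
Qed.

Section InnerProduct.
Context {R : realType} {V : completeNormedModType R} (ip : {dot V for idfun}).
Implicit Types u v w : V.

Lemma ipC u v : ip u v = ip v u.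
Proof. by rewrite (@hermC _ _ _ _ ip) expr0 mul1r. Qed.

Lemma ipDl u v w : ip (u + v) w = ip u w + ip v w. Proof. exact: linearDl. Qed.
Lemma ipBl u v w : ip (u - v) w = ip u w - ip v w. Proof. exact: linearBl. Qed.
Lemma ipNl u v : ip (- u) v = - ip u v. Proof. exact: linearNl. Qed.
Lemma ip0l u : ip 0 u = 0. Proof. exact: linear0l. Qed.
Lemma ipZl a u w : ip (a *: u) w = a * ip u w. Proof. exact: linearZl_LR. Qed.
Lemma ipBr u v w : ip w (u - v) = ip w u - ip w v.
Proof. by rewrite ipC ipBl !(ipC w). Qed.
Lemma ip0r u : ip u 0 = 0. Proof. by rewrite ipC ip0l. Qed.
Lemma ipZr a u w : ip w (a *: u) = a * ip w u.
Proof. by rewrite ipC ipZl (ipC w). Qed.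
Lemma ip_suml I (r : seq I) (F : I -> V) v :
  ip (\sum_(i <- r) F i) v = \sum_(i <- r) ip (F i) v.
Proof.
elim: r => [|i r IH]; first by rewrite !big_nil ip0l.
by rewrite !big_cons ipDl IH.
Qed.

Hypothesis hip : hilbert_norm ip.

Lemma Cauchy_Schwarz u v : `|ip u v| <= `|u| * `|v|.
Proof.
have [->|v0] := eqVneq v 0; first by rewrite ip0r !normr0 mulr0.
have nv : 0 < `|v| ^+ 2 by rewrite exprn_gt0// normr_gt0.
have := sqr_ge0 `|u - (ip u v / `|v| ^+ 2) *: v|.
rewrite -hip !(ipBl, ipBr, ipZl, ipZr) !hip (ipC v u) => h.
have -> : `|u| * `|v| = Num.sqrt (`|u| ^+ 2 * `|v| ^+ 2).
  by rewrite -exprMn sqrtr_sqr ger0_norm// mulr_ge0.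
rewrite -sqrtr_sqr ler_wsqrtr//.
have := mulr_ge0 (ltW nv) h.
move: nv; set a := ip u v; set b := `|v| ^+ 2; set c := `|u| ^+ 2 => nv.
have -> : b * (c - a / b * a - (a / b * a - a / b * (a / b * b))) =
  c * b - a ^+ 2 by field; rewrite gt_eqF.
by rewrite subr_ge0.
Qed.

Lemma ip_le u v : ip u v <= `|u| * `|v|.
Proof. exact: le_trans (ler_norm _) (Cauchy_Schwarz u v). Qed.

Lemma cvg_ipl (T : Type) (F : set_system T) {FF : Filter F} (f : T -> V) u v :
  f @ F --> u -> ip (f x) v @[x --> F] --> ip u v.
Proof.
move=> fu; apply/cvgrPdist_le => e e0.
have e1 : 0 < e / (`|v| + 1) by rewrite divr_gt0// ltr_wpDl.
have := (@cvgrPdist_le _ _ _ F FF f u).1 fu _ e1.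
apply: filterS => x xe; rewrite -ipBl; apply: le_trans (Cauchy_Schwarz _ _) _.
apply: le_trans (ler_wpM2r (normr_ge0 v) xe) _.
by rewrite -mulrA ler_piMr ?(ltW e0)// mulrC ler_pdivrMr ?mul1r ?lerDl// ltr_wpDl.
Qed.

Lemma ip_eq u v : (forall w, ip u w = ip v w) -> u = v.
Proof.
move=> h; apply/eqP; rewrite -subr_eq0 -normr_eq0 -sqrf_eq0 -hip.
by rewrite ipBl h subrr.
Qed.

Lemma norm_dual v M : 0 <= M -> ip v v <= M * `|v| -> `|v| <= M.
Proof.
move=> M0; rewrite hip expr2; have [->|v0] := eqVneq v 0; first by rewrite normr0.
by rewrite ler_pM2r// normr_gt0.
Qed.

End InnerProduct.

Section Parseval.
Context {R : realType} {V : completeNormedModType R} (ip : {dot V for idfun}).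
Hypothesis hip : hilbert_norm ip.
(* A basis listed along nat, padded with zero vectors. *)
Variable e : nat -> V.
Hypothesis eorth : forall n m, n != m -> ip (e n) (e m) = 0.
Hypothesis enorm : forall n, ip (e n) (e n) = 1 \/ e n = 0.
Hypothesis emax : forall v, (forall n, ip v (e n) = 0) -> v = 0.

Definition partial (c : nat -> R) N := \sum_(0 <= n < N) c n *: e n.

(** The factor [ip (e n) (e n)] is 1 on basis vectors and 0 on the padding; it is carried along
    until [ee_coord] or [ee_le1] removes it. *)
Lemma partial_coord c N n :
  ip (partial c N) (e n) = (n < N)%:R * c n * ip (e n) (e n).
Proof.
rewrite /partial ip_suml; elim: N => [|N IH].
  by rewrite big_geq// ltn0 mul0r mul0r.
rewrite big_nat_recr//= IH ipZl [in RHS]ltnS [in RHS]leq_eqVlt.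
have [->|nN] := eqVneq n N; first by rewrite ltnn !mul0r add0r orTb mul1r.
by rewrite (@eorth N n) 1?eq_sym// mulr0 addr0.
Qed.

Lemma ip_partial u c N :
  ip u (partial c N) = \sum_(0 <= n < N) c n * ip u (e n).
Proof. by rewrite ipC ip_suml; apply: eq_bigr => i _; rewrite ipZl ipC. Qed.

Lemma sqr_partial c N :
  `|partial c N| ^+ 2 = \sum_(0 <= n < N) c n ^+ 2 * ip (e n) (e n).
Proof.
rewrite -hip ip_partial; apply: eq_big_nat => n /andP[_ nN].
by rewrite partial_coord nN mul1r expr2 mulrA.
Qed.

Lemma sqr_partialB c N M : (N <= M)%N ->
  `|partial c M - partial c N| ^+ 2 = \sum_(N <= n < M) c n ^+ 2 * ip (e n) (e n).
Proof.
move=> NM; rewrite -hip !(ipBl, ipBr) (ipC _ (partial c N)).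
rewrite !hip !sqr_partial ip_partial (big_cat_nat _ NM)//=.
have -> : \sum_(0 <= i < N) c i * ip (partial c M) (e i) =
   \sum_(0 <= i < N) c i ^+ 2 * ip (e i) (e i).
  apply: eq_big_nat => n /andP[_ nN].
  by rewrite partial_coord (leq_trans nN NM) mul1r expr2 mulrA.
by rewrite opprB subrr addr0 addrAC subrr add0r.
Qed.

Lemma ee_ge0 n : 0 <= ip (e n) (e n). Proof. by rewrite hip sqr_ge0. Qed.
Lemma ee_le1 n : ip (e n) (e n) <= 1.
Proof. by case: (enorm n) => ->//; rewrite ip0l. Qed.

Lemma ee_coord v n : ip v (e n) * ip (e n) (e n) = ip v (e n).
Proof. by case: (enorm n) => ->; rewrite ?mulr1// ip0r mul0r. Qed.

Lemma Bessel v N : \sum_(0 <= n < N) ip v (e n) ^+ 2 <= `|v| ^+ 2.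
Proof.
set c := fun n => ip v (e n).
have := sqr_ge0 `|v - partial c N|.
rewrite -(hip (v - _)) !(ipBl, ipBr) (ipC _ (partial c N)) !hip sqr_partial ip_partial.
have -> : \sum_(0 <= n < N) c n ^+ 2 * ip (e n) (e n) =
  \sum_(0 <= n < N) c n ^+ 2.
  by apply: eq_bigr => n _; rewrite expr2 -mulrA ee_coord.
have -> : \sum_(0 <= n < N) c n * ip v (e n) = \sum_(0 <= n < N) c n ^+ 2.
  by apply: eq_bigr => n _; rewrite expr2.
by rewrite subrr subr0 subr_ge0.
Qed.

(* Riesz-Fischer *)
Lemma partial_cvg c K : (forall N, \sum_(0 <= n < N) c n ^+ 2 <= K) ->
  exists2 v, partial c N @[N --> \oo] --> v & `|v| ^+ 2 <= K.
Proof.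
(* [s N] is the square norm of the partial sum. It is monotone and bounded, hence convergent, and
   its increments are the squared distances between partial sums, which are therefore Cauchy. *)
move=> cK; pose s N := \sum_(0 <= n < N) c n ^+ 2 * ip (e n) (e n).
have snd : nondecreasing_seq s.
  apply/nondecreasing_seqP => N; rewrite /s big_nat_recr//= lerDl.
  by rewrite mulr_ge0 ?sqr_ge0 ?ee_ge0.
have sK N : s N <= K.
  apply: le_trans (cK N); apply: ler_sum => n _.
  by rewrite ler_piMr ?sqr_ge0 ?ee_le1.
have sc : cvgn s.
  apply: nondecreasing_is_cvgn => //; exists K => _ [N _ <-]; exact: sK.
have pc : cvg (partial c N @[N --> \oo]).
  apply/cauchy_cvgP/cauchy_exP => e0 e00.
  have e2 : 0 < e0 ^+ 2 by rewrite exprn_gt0.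
  have [N _ hN] := (@cvgrPdist_lt _ _ _ _ _ s (limn s)).1 sc _ e2.
  exists (partial c N); exists N => // M /= NM.
  rewrite -ball_normE /= -(@ltr_pXn2r _ 2)// ?nnegrE ?normr_ge0 ?ltW//.
  rewrite distrC sqr_partialB//.
  have -> : \sum_(N <= n < M) c n ^+ 2 * ip (e n) (e n) = s M - s N.
    by rewrite /s [in RHS](big_cat_nat _ NM)//= addrAC subrr add0r.
  apply: le_lt_trans (hN N (leqnn N)); rewrite ger0_norm.
    by rewrite lerB// nondecreasing_cvgn_le.
  by rewrite subr_ge0 nondecreasing_cvgn_le.
case/cvg_ex: pc => v pv; exists v => //.
have pn : `|partial c N| ^+ 2 @[N --> \oo] --> `|v| ^+ 2.
  by rewrite expr2; apply: cvgM; exact: cvg_norm.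
apply: (cvg_le_cst pn) => N /=; rewrite sqr_partial; exact: sK.
Qed.

(** Bessel lets Riesz-Fischer produce some limit [u]; it has the same coordinates as [v], and
    maximality of the family forbids a nonzero difference. *)
Lemma Parseval v : partial (fun n => ip v (e n)) N @[N --> \oo] --> v.
Proof.
have [u pu _] := partial_cvg (Bessel v).
suff vu : v = u by move: pu; rewrite -vu.
apply/eqP; rewrite -subr_eq0; apply/eqP; apply: emax => n; rewrite ipBl.
have /(_ (e n)) h w : ip (partial (fun n => ip v (e n)) N) w @[N --> \oo] --> ip u w by exact: cvg_ipl.
apply/eqP; rewrite subr_eq0; apply/eqP.
rewrite -(cvg_lim _ h)//; apply/esym/cvg_lim => //; apply: cvg_near_cst.
exists n.+1 => // N /= nN; rewrite partial_coord nN mul1r; exact: ee_coord.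
Qed.

Lemma norm_le_coords v K : 0 <= K ->
  (forall N, \sum_(0 <= n < N) ip v (e n) ^+ 2 <= K ^+ 2) -> `|v| <= K.
Proof.
move=> K0 /partial_cvg[u pu uK].
have -> : v = u by rewrite -(cvg_lim _ pu)//; apply/esym/cvg_lim => //; exact: Parseval.
by rewrite -(@ler_pXn2r _ 2)// nnegrE.
Qed.

End Parseval.

(** * Bochner integrals tested against vectors *)

Lemma cvge0_lt {R : realType} (T : Type) (F : set_system T) {FF : Filter F}
    (f : T -> \bar R) c :
  f @ F --> 0%E -> 0 < c -> \forall x \near F, (f x < c%:E)%E.
Proof.
move=> /fine_cvgP[ffin f0] c0; have := cvgr_lt 0 f0 c c0.
move=> fc; near=> x; have xf : f x \is a fin_num by near: x.
by rewrite -(fineK xf) lte_fin; near: x; exact: fc.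
Unshelve. all: by end_near. Qed.

Section LowerIntegral.
Context {R : realType} d (T : measurableType d) (mu : {measure set T -> \bar R}).
Local Open Scope ereal_scope.
Import HBNNSimple.

(* The integral of a nonnegative function is a supremum over simple functions,
   so no measurability is needed here. *)
Lemma ge0_le_integral_nomeas (D : set T) (f g : T -> \bar R) :
  (forall x, D x -> 0 <= f x) -> (forall x, D x -> f x <= g x) ->
  \int[mu]_(x in D) f x <= \int[mu]_(x in D) g x.
Proof.
move=> f0 fg; have g0 x : D x -> 0 <= g x.
  by move=> Dx; apply: le_trans (fg _ Dx); exact: f0.
rewrite !ge0_integralE//; apply: ereal_sup_le => _ [h hf <-].
exists h => // x; apply: le_trans (hf x) _.
by rewrite /patch; case: ifPn => // /[!inE]; exact: fg.
Qed.

(** The constant is first moved to the side of [f], whose measurability allows taking it out of the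
    integral; [g] is then only compared pointwise. This spares measurability proofs for dominating
    functions. *)
Lemma ge0_le_integralZl_nomeas (D : set T) (mD : measurable D) (f g : T -> R) c :
  (0 < c)%R -> measurable_fun D f ->
  (forall x, D x -> (0 <= f x <= c * g x)%R) ->
  \int[mu]_(x in D) (f x)%:E <= c%:E * \int[mu]_(x in D) (g x)%:E.
Proof.
move=> c0 mf fg; have ci : (0 <= c^-1)%R by rewrite invr_ge0 ltW.
rewrite -lee_pdivrMl// -ge0_integralZl_EFin//.
- apply: ge0_le_integral_nomeas => x Dx; have /andP[f0 fc] := fg _ Dx.
    by rewrite -EFinM lee_fin mulr_ge0// invr_ge0 ltW.
  by rewrite -EFinM lee_fin ler_pdivrMl.
- by move=> x Dx; rewrite lee_fin; have /andP[] := fg _ Dx.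
- exact/measurable_EFinP.
Qed.
End LowerIntegral.

Section BochnerPairing.
Context {R : realType} {V : completeNormedModType R} (ip : {dot V for idfun}).
Hypothesis hip : hilbert_norm ip.
Local Notation mu := (@lebesgue_measure R).
Variables (D : set (measurableTypeR R)) (mD : measurable D).

(** [simple_on] only controls the nonzero values; the level set of 0 is what the finitely many other
    level sets leave over. *)
Lemma simple_level (s : R -> V) v : simple_on D s ->
  measurable (D `&` s @^-1` [set v]).
Proof.
move=> [fs sm]; have [->|v0] := eqVneq v 0; last by have [] := sm _ v0.
have -> : D `&` s @^-1` [set 0] =
    D `\` \bigcup_(u in s @` D `\ 0) (D `&` s @^-1` [set u]).
  apply/seteqP; split=> r /=.
    by move=> [Dr sr]; split => // -[u [_ /= u0] [_ /= su]]; apply: u0; rewrite -su.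
  move=> [Dr h]; split => //; apply: contrapT => sr; apply: h.
  by exists (s r) => //; split => //; exists r.
apply: measurableD => //; apply: fin_bigcup_measurable.
  exact: finite_setD.
by move=> u [_ /= u0]; have [|//] := sm u; exact/eqP.
Qed.

Lemma simple_measurable (s : R -> V) (phi : V -> R) : simple_on D s ->
  measurable_fun D (fun r => phi (s r)).
Proof.
move=> ss _ Y mY; have -> : D `&` (fun r => phi (s r)) @^-1` Y =
   \bigcup_(v in s @` D `&` phi @^-1` Y) (D `&` s @^-1` [set v]).
  apply/seteqP; split=> r /=.
    by move=> [Dr Yr]; exists (s r) => //; split => //; exists r.
  by move=> [v [_ /= Yv] [Dr /= srv]]; split => //; rewrite srv.
apply: fin_bigcup_measurable; first by apply: finite_setIl; case: ss.
by move=> v _; exact: simple_level.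
Qed.

Lemma simple_pairing (s : R -> V) u : simple_on D s ->
  mu.-integrable D (fun r => (ip (s r) u)%:E) /\
  (\int[mu]_(r in D) (ip (s r) u)%:E)%E = (ip (simple_integral D s) u)%:E.
Proof.
move=> ss; have [fs sm] := ss.
pose X : seq V := fset_set (s @` D).
pose L v := D `&` s @^-1` [set v].
pose h v r : \bar R := (ip v u * \1_(L v) r)%:E.
have dec r : r \in D -> (\sum_(v <- X) h v r)%E = (ip (s r) u)%:E.
  rewrite inE => Dr; rewrite sumEFin; congr EFin.
  rewrite (bigD1_seq (s r)) ?fset_uniq//=; last first.
    by rewrite in_fset_set// inE; exists r.
  rewrite big1 ?addr0.
    by rewrite indicE mem_set ?mulr1.
  move=> v vs; rewrite indicE memNset ?mulr0// => -[_ /= srv].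
  by rewrite srv eqxx in vs.
have ih v : mu.-integrable D (h v) /\
    (\int[mu]_(r in D) h v r)%E = (fine (mu (L v)) * ip v u)%:E.
  (* The level set of 0 may have infinite measure, but its term vanishes with the pairing. *)
  have [->|v0] := eqVneq v 0.
    have -> : h 0 = cst 0%E by apply/funext => r; rewrite /h ip0l mul0r.
    by rewrite integral0 ip0l mulr0; split => //; exact: integrable0.
  have [mL Lfin] := sm _ v0.
  have i1 : mu.-integrable D (fun r => (\1_(L v) r)%:E).
    apply/integrableP; split; first exact/measurable_EFinP.
    rewrite (eq_integral (fun x => (\1_(L v) x)%:E)); last first.
      by move=> t _; rewrite gee0_abs// lee_fin.
    by rewrite integral_indic// setIAC setIid.
  have -> : h v = (fun r => (ip v u)%:E * (\1_(L v) r)%:E)%E by [].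
  split; first exact: integrableZl.
  rewrite integralZl// integral_indic// setIAC setIid mulrC EFinM fineK//.
  by rewrite ge0_fin_numE.
split.
  apply: (eq_integrable mD (fun r => (\sum_(v <- X) h v r)%E)) => //.
    by apply: integrable_sum => // v _; case: (ih v).
rewrite (eq_integral (fun r => (\sum_(v <- X) h v r)%E)); last first.
  by move=> r /dec.
rewrite integral_sum// => [|v]; last by case: (ih v).
rewrite /simple_integral fsbig_finite// ip_suml -sumEFin.
by apply: eq_bigr => v _; rewrite ipZl; case: (ih v).
Qed.

(** Pairing with [u] is Lipschitz, so L1 approximation of [f] by simple functions becomes L1
    approximation of its scalar pairing, and the identity passes to the limit. Every later fact on
    Bochner integrals, uniqueness included, is read off from this one. *)
Lemma bochner_pairing (f : R -> V) J u : is_bochner D f J ->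
  mu.-integrable D (fun r => (ip (f r) u)%:E) /\
  (\int[mu]_(r in D) (ip (f r) u)%:E)%E = (ip J u)%:E.
Proof.
move=> [s [ss sf sL1 sJ]].
have mf : measurable_fun D (fun r => ip (f r) u).
  apply: (@measurable_fun_cvg _ _ _ _ (fun n r => ip (s n r) u)).
    by move=> n; apply: (@simple_measurable _ (ip^~ u)).
  by move=> r Dr; apply: cvg_ipl => //; exact: sf.
have ms n : measurable_fun D (fun r => ip (s n r) u).
  exact: (@simple_measurable _ (ip^~ u)).
pose e n := (\int[mu]_(r in D) (`|f r - s n r|)%:E)%E.
(* The summand 1 keeps the constant positive when [u = 0]. *)
have key n : (\int[mu]_(r in D) `|(ip (f r) u - ip (s n r) u)%:E| <=
    (`|u| + 1)%:E * e n)%E.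
  have u1 : 0 < `|u| + 1 by rewrite ltr_wpDl.
  apply: ge0_le_integralZl_nomeas => //.
    by apply: measurableT_comp => //; exact: measurable_funB.
  move=> r _; rewrite normr_ge0/= -ipBl.
  apply: le_trans (Cauchy_Schwarz hip _ _) _.
  by rewrite mulrC ler_wpM2r// lerDl.
have key0 : ((`|u| + 1)%:E * e n)%E @[n --> \oo] --> 0%E.
  rewrite -(mule0 (`|u| + 1)%:E); apply: cvgeMl => //.
have fi : mu.-integrable D (fun r => (ip (f r) u)%:E).
  (* A single index with error below 1 suffices: the pairing is then an integrable error plus the
     pairing of a simple function. *)
  have [n en] : exists n, ((`|u| + 1)%:E * e n < 1)%E.
    have [N _ hN] : \forall n \near \oo, ((`|u| + 1)%:E * e n < 1)%E.
      exact: (cvge0_lt key0).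
    by exists N; apply: hN => /=.
  have -> : (fun r => (ip (f r) u)%:E) =
    (fun r => (ip (f r) u - ip (s n r) u)%:E) \+ (fun r => (ip (s n r) u)%:E).
    by apply/funext => r; rewrite /= -EFinD subrK.
  apply: integrableD => //; last by have [] := simple_pairing u (ss n).
  apply/integrableP; split; first by apply/measurable_EFinP; exact: measurable_funB.
  by apply: le_lt_trans (key n) _; apply: lt_trans en _; rewrite ltry.
split => //.
have dif n : (`|\int[mu]_(r in D) (ip (f r) u)%:E - (ip (simple_integral D (s n)) u)%:E|
   <= (`|u| + 1)%:E * e n)%E.
  have [si <-] := simple_pairing u (ss n).
  rewrite -integralB//; apply: le_trans (key n).
  apply: le_abse_integral => //.
  by apply/measurable_EFinP; exact: measurable_funB.
have fin : (\int[mu]_(r in D) (ip (f r) u)%:E)%E \is a fin_num.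
  exact: integrable_fin_num.
rewrite -(fineK fin); congr EFin; set a := fine _.
have Jc : ip (simple_integral D (s n)) u @[n --> \oo] --> ip J u by exact: cvg_ipl.
rewrite -(cvg_lim _ Jc)//; apply/esym/cvg_lim => //.
apply/cvgrPdist_le => eps eps0.
have : \forall n \near \oo, ((`|u| + 1)%:E * e n < eps%:E)%E.
  exact: (cvge0_lt key0).
apply: filterS => n /ltW hn; rewrite -lee_fin; apply: le_trans hn.
by apply: le_trans (dif n); rewrite -(fineK fin) -/a.
Qed.

Lemma bochner_unique (f : R -> V) J1 J2 :
  is_bochner D f J1 -> is_bochner D f J2 -> J1 = J2.
Proof.
move=> h1 h2; apply: (ip_eq hip) => w; apply: EFin_inj.
by have [_ <-] := bochner_pairing w h1; have [_ <-] := bochner_pairing w h2.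
Qed.

(** Pairing [J1 - J2] with itself turns its square norm into a scalar integral, where Cauchy-Schwarz
    applies under the integral sign; [norm_dual] then cancels one factor of the norm. *)
Lemma bochner_dist_le (f1 f2 : R -> V) (m : R -> R) J1 J2 (M : R) :
  is_bochner D f1 J1 -> is_bochner D f2 J2 ->
  (forall r, D r -> `|f1 r - f2 r| <= m r) ->
  (\int[mu]_(r in D) (m r)%:E <= M%:E)%E -> `|J1 - J2| <= M.
Proof.
move=> h1 h2 fm mM; set w := J1 - J2.
have M0 : 0 <= M.
  rewrite -lee_fin; apply: le_trans mM; apply: integral_ge0 => r Dr.
  by rewrite lee_fin; apply: le_trans (fm _ Dr).
have [w0|w0] := eqVneq w 0; first by rewrite w0 normr0.
have nw : 0 < `|w| by rewrite normr_gt0.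
apply: (norm_dual hip M0).
have [i1 e1] := bochner_pairing w h1; have [i2 e2] := bochner_pairing w h2.
rewrite {1}/w ipBl -lee_fin EFinB -e1 -e2 -integralB// EFinM muleC.
have mf : measurable_fun D (fun r => ip (f1 r) w - ip (f2 r) w).
  by apply: measurable_funB; apply/measurable_EFinP; [exact: measurable_int i1|exact: measurable_int i2].
apply: le_trans (lee_abs _) _; apply: le_trans (le_abse_integral _ _ _) _ => //.
  exact/measurable_EFinP.
apply: (@le_trans _ _ (`|w|%:E * \int[mu]_(r in D) (m r)%:E)%E); last first.
  by rewrite lee_pmul2l.
apply: ge0_le_integralZl_nomeas => //.
  exact: measurableT_comp.
move=> r Dr; rewrite normr_ge0/= -ipBl; apply: le_trans (Cauchy_Schwarz hip _ _) _.
by rewrite mulrC ler_wpM2l// fm.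
Qed.
End BochnerPairing.

(** * Exponential and gamma kernels *)

Section ScalarIntegrals.
Context {R : realType}.
Local Notation mu := (@lebesgue_measure R).
Implicit Types a t : R.

Lemma measurable_sub t : measurable_fun setT
  ((fun r => t - r) : measurableTypeR R -> measurableTypeR R).
Proof. exact: measurable_funB. Qed.

(** Reflection preserves the length of half-open intervals, and these determine Lebesgue measure. *)
Lemma lebesgue_measure_reflect t (A : set R) : measurable A ->
  pushforward mu (fun r => t - r : measurableTypeR R) A = mu A.
Proof.
move=> mA; apply/esym.
pose phi : measurableTypeR R -> measurableTypeR R := fun r => t - r.
pose mphi := isMeasurableFun.Build _ _ _ _ phi (measurable_sub t).
pose phiP : {mfun measurableTypeR R >-> measurableTypeR R} := HB.pack phi mphi.
apply: (@lebesgue_measure_unique _ (pushforward mu phiP)) => //= _ [[a b]] _ <-.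
rewrite /pushforward.
have -> : phi @^-1` `]a, b] = `[t - b, t - a[%classic.
  by apply/seteqP; split=> r /=; rewrite !in_itv/= lerBlDl ltrBrDl ltrBrDl lerBlDl
    ![_ + r]addrC andbC.
rewrite !lebesgue_measure_itv/= !lte_fin ltrD2l ltrN2.
by case: ifP => // _; congr EFin; ring.
Qed.

Lemma ge0_integral_reflect t (f : R -> \bar R) :
  measurable_fun [set: R] f -> (forall r, 0 <= f r)%E ->
  (\int[mu]_(r in `]-oo, t]) f (t - r)%R = \int[mu]_(s in `[0%R, +oo[) f s)%E.
Proof.
move=> mf f0; have -> : `]-oo, t]%classic =
    (fun r => t - r : measurableTypeR R) @^-1` `[0%R, +oo[.
  by apply/seteqP; split => r /=; rewrite !in_itv/= andbT subr_ge0.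
pose phi : measurableTypeR R -> measurableTypeR R := fun r => t - r.
rewrite -(@ge0_integral_pushforward _ _ _ _ _ phi (measurable_sub t))//=.
  apply: eq_measure_integral => //= [|_ A mA _]; first exact: measurable_sub.
  exact: lebesgue_measure_reflect.
exact: measurable_funS mf.
Qed.

Lemma is_derive_expRM a (r : R) : is_derive r 1 (fun x => expR (a * x)) (a * expR (a * r)).
Proof.
apply: is_derive_eq; rewrite /GRing.scale/=; ring.
Qed.

Lemma continuous_expRM a : continuous (fun x : R => expR (a * x)).
Proof.
move=> x; apply: differentiable_continuous; apply/derivable1_diffP.
by have [] := is_derive_expRM a x.
Qed.

Lemma integral_expR_itvcc a t : a != 0 -> 0 <= t ->
  (\int[mu]_(r in `[0%R, t]) (expR (- a * (t - r)))%:E =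
     ((1 - expR (- a * t)) / a)%:E)%E.
Proof.
move=> a0; rewrite le_eqVlt => /predU1P[<-|t0].
  by rewrite set_itv1 integral_set1 mulr0 expR0 subrr mul0r.
have E r : expR (- a * (t - r)) = expR (- a * t) * expR (a * r).
  by rewrite -expRD mulrBr !mulNr opprK.
pose F r := expR (- a * t) * a^-1 * expR (a * r).
have dF (r : R) : is_derive r 1 F (expR (- a * t) * expR (a * r)).
  by apply: is_derive_eq; rewrite /GRing.scale/= mulr1; field.
have cF : continuous F.
  by move=> x; apply: differentiable_continuous; apply/derivable1_diffP; case: (dF x).
rewrite (@continuous_FTC2 _ _ F)//.
- rewrite -EFinB /F mulr0 expR0 mulr1 mulrAC -expRD mulNr addNr expR0.
  by rewrite -mulrBl.
- apply: continuous_subspaceT => x; rewrite /continuous_at.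
  have -> : (fun r => expR (- a * (t - r))) = (fun r => expR (- a * t) * expR (a * r)).
    exact/funext.
  by rewrite E; apply: cvgM; [exact: cvg_cst|exact: continuous_expRM].
- split.
  + by move=> x _; case: (dF x).
  + by apply: cvg_at_right_filter; exact: cF.
  + by apply: cvg_at_left_filter; exact: cF.
- by move=> x _; rewrite derive1E E; case: (dF x).
Qed.

Lemma integral_expR_itvcy a : 0 < a ->
  (\int[mu]_(s in `[0%R, +oo[) (expR (- a * s))%:E = (a^-1)%:E)%E.
Proof.
move=> a0; pose F r := - a^-1 * expR (- a * r).
have dF (r : R) : is_derive r 1 F (expR (- a * r)).
  by apply: is_derive_eq; rewrite /GRing.scale/= mulr1; field; rewrite gt_eqF.
have cF : continuous F.
  by move=> x; apply: differentiable_continuous; apply/derivable1_diffP; case: (dF x).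
rewrite (@ge0_continuous_FTC2y _ _ F _ 0)//.
- by rewrite -EFinB /F mulr0 expR0 mulr1 sub0r opprK.
- by apply: continuous_subspaceT; exact: continuous_expRM.
- rewrite -(mulr0 (- a^-1)); apply: cvgM; first exact: cvg_cst.
  have -> : (fun r => expR (- a * r)) = (fun r => expR (- r)) \o (fun r => a * r).
    by apply/funext => r /=; rewrite mulNr.
  apply: (cvg_comp (fun r => a * r) (fun r => expR (- r))).
  + by apply: gt0_cvgMry => //; exact: cvg_id.
  + exact: cvgr_expR.
- by apply: cvg_at_right_filter; exact: cF.
- by move=> x _; rewrite derive1E; case: (dF x).
Qed.

(** The integrand of Euler's integral, with value Gamma(al) / c^al over the half-line. It arises as
    the singularity 1 / s of the smoothing estimate times the Hoelder factor s^al. *)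
Definition gamma_kernel (al c s : R) : R := s `^ (al - 1) * expR (- c * s).

Lemma gamma_kernel_ge0 al c s : 0 <= gamma_kernel al c s.
Proof. by rewrite mulr_ge0 ?powR_ge0 ?expR_ge0. Qed.

Lemma measurable_gamma_kernel al c : measurable_fun setT (gamma_kernel al c).
Proof.
apply: measurable_funM; first exact: measurable_powR.
by apply: measurableT_comp => //; exact: measurable_funM.
Qed.

(** The antiderivative s^al / al stays bounded near 0, so exhausting the interval by [1/(n+1), 1]
    gives a bound uniform in n. *)
Lemma integral_powR_oc01 al : 0 < al ->
  (\int[mu]_(s in `]0%R, 1%R]) (s `^ (al - 1))%:E <= (al^-1)%:E)%E.
Proof.
move=> al0; pose A (n : nat) : set (measurableTypeR R) := `[n.+1%:R^-1, 1]%classic.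
have mp D : measurable_fun D (fun s : R => (s `^ (al - 1))%:E).
  by apply/measurable_EFinP; apply: measurable_funS (measurable_powR _).
have -> : `]0%R, 1%R]%classic = \bigcup_n A n.
  by rewrite itv_open_bnd_bigcup; apply: eq_bigcupr => n _; rewrite add0r.
have cA : (\int[mu]_(s in A n) (s `^ (al - 1))%:E)%E @[n --> \oo] -->
    (\int[mu]_(s in \bigcup_n A n) (s `^ (al - 1))%:E)%E.
  apply: (@ge0_nondecreasing_set_cvg_integral _ (measurableTypeR R) _ A) => //.
  - apply/nondecreasing_seqP => n; apply/subsetPset => s.
    rewrite /A /= !in_itv/= => /andP[h ->]; rewrite andbT; apply: le_trans h.
    by rewrite lef_pV2 ?posrE// ler_nat.
  - by move=> n; exact: measurable_itv.
  - by move=> n; exact: mp.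
  - by move=> n s _; rewrite lee_fin powR_ge0.
rewrite -(cvg_lim _ cA)//; apply: lime_le.
  by apply/cvg_ex; eexists; exact: cA.
apply: nearW => n; pose F (s : R) := al^-1 * s `^ al.
have n0 : 0 < n.+1%:R^-1 :> R by rewrite invr_gt0.
have dF (s : R) : 0 < s -> is_derive s 1 F (s `^ (al - 1)).
  move=> s0; have h := is_derive1_powR al s0.
  by apply: is_derive_eq; rewrite /GRing.scale/= mulrA mulVf ?mul1r// gt_eqF.
have cF (s : R) : 0 < s -> {for s, continuous F}.
  by move=> s0; apply: differentiable_continuous; apply/derivable1_diffP; case: (dF s s0).
(* For n = 0 the interval is the point 1 and is treated apart: the fundamental theorem is applied on
   nondegenerate intervals. *)
have [->|nn] := eqVneq n 0%N.
  by rewrite /A invr1 set_itv1 integral_set1 lee_fin invr_ge0 ltW.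
have n1 : n.+1%:R^-1 < 1 :> R by rewrite invf_lt1// ltr1n ltnS lt0n.
rewrite /A (@continuous_FTC2 _ _ F)//.
- rewrite -EFinB lee_fin /F powR1 mulr1 lerBlDr lerDl.
  by rewrite mulr_ge0 ?powR_ge0// invr_ge0 ltW.
- apply: continuous_in_subspaceT => s; rewrite inE/= in_itv/= => /andP[ns _].
  have s0 : 0 < s := lt_le_trans n0 ns.
  apply: differentiable_continuous; apply/derivable1_diffP.
  by have [] := is_derive1_powR (al - 1) s0.
- split.
  + by move=> s; rewrite in_itv/= => /andP[ns _]; case: (dF s (lt_trans n0 ns)).
  + by apply: cvg_at_right_filter; exact: cF.
  + by apply: cvg_at_left_filter; exact: cF.
- move=> s; rewrite in_itv/= => /andP[ns _].
  by rewrite derive1E; case: (dF s (lt_trans n0 ns)).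
Qed.

(** Up to 1 the exponential is dropped; beyond 1 the power is dropped, its exponent being negative.
    These are the two terms of [al^-1 + c^-1]. *)
Lemma integral_gamma_kernel al c : 0 < al < 1 -> 0 < c -> exists2 G : R, 0 < G &
  (\int[mu]_(s in `[0%R, +oo[) (gamma_kernel al c s)%:E <= G%:E)%E.
Proof.
move=> /andP[al0 al1] c0; exists (al^-1 + c^-1); first by rewrite addr_gt0 ?invr_gt0.
have mk D : measurable_fun D (fun s : R => (gamma_kernel al c s)%:E).
  by apply/measurable_EFinP; apply: measurable_funS (measurable_gamma_kernel _ _).
have m1 D : measurable_fun D (fun s : R => (expR (- c * s))%:E).
  apply/measurable_EFinP; apply: measurable_funS (_ : measurable_fun setT _) => //.
  by apply: measurableT_comp => //; exact: measurable_funM.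
have mp D : measurable_fun D (fun s : R => (s `^ (al - 1))%:E).
  by apply/measurable_EFinP; apply: measurable_funS (measurable_powR _).
have -> : `[0%R, +oo[%classic = [set 0] `|` (`]0%R, 1%R] `|` `]1%R, +oo[) :> set R.
  apply/seteqP; split => s /=; rewrite !in_itv/= !andbT.
    by case: (ltgtP s 0) => // [s0 _|->]; [right; case: (lerP s 1); [left|right]|left].
  by move=> [->|[/andP[/ltW]|/ltW]]//; apply: le_trans.
have k0 D : (0 <= \int[mu]_(s in D) (gamma_kernel al c s)%:E)%E.
  by apply: integral_ge0 => s _; rewrite lee_fin gamma_kernel_ge0.
rewrite ge0_integral_setU//=; last 4 first.
- by apply: measurableU; exact: measurable_itv.
- exact: mk.
- by move=> s _; rewrite lee_fin gamma_kernel_ge0.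
- by apply/disj_setPS => s /= [->]; rewrite !in_itv/= ltxx ltr10; case.
rewrite integral_set1 add0e ge0_integral_setU//=; last 3 first.
- exact: mk.
- by move=> s _; rewrite lee_fin gamma_kernel_ge0.
- apply/disj_setPS => s /= []; rewrite !in_itv/= andbT => /andP[_ s1].
  by rewrite ltNge s1.
rewrite EFinD; apply: leeD.
  apply: le_trans (integral_powR_oc01 al0); apply: ge0_le_integral => //=.
  - by move=> s _; rewrite lee_fin gamma_kernel_ge0.
  - exact: mk.
  - exact: mp.
  - move=> s; rewrite in_itv/= => /andP[s0 _].
    rewrite lee_fin /gamma_kernel ler_piMr ?powR_ge0// -expR0 ler_expR mulNr.
    by rewrite oppr_le0 mulr_ge0// ltW.
rewrite -integral_expR_itvcy//.
apply: (@le_trans _ _ (\int[mu]_(s in `]1%R, +oo[) (expR (- c * s))%:E)%E).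
  apply: ge0_le_integral => //=.
  - by move=> s _; rewrite lee_fin gamma_kernel_ge0.
  - exact: mk.
  - exact: m1.
  - move=> s; rewrite in_itv/= andbT => s1.
    rewrite lee_fin /gamma_kernel ler_piMl ?expR_ge0//.
    by rewrite -[leRHS](powRr0 s); apply: ler_powR; [exact: ltW|rewrite subr_le0 ltW].
apply: ge0_subset_integral => //=.
- exact: m1.
- by move=> s /=; rewrite !in_itv/= !andbT => /ltW; apply: le_trans.
Qed.
End ScalarIntegrals.

(** * The semigroup in the eigenbasis *)

Section Spectral.
Context {R : realType} {V : completeNormedModType R} (ip : {dot V for idfun}).
Hypothesis hip : hilbert_norm ip.
Variables (D : set V) (B : V -> V) (S : R -> {linear V -> V}) (lB : R).
Hypothesis (lB0 : 0 < lB) (S0 : C0_semigroup S) (SB : generator S D B).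
Hypothesis Sexp : forall (t : R) (u : V), 0 <= t -> `|S t u| <= expR (- lB * t) * `|u|.
Hypothesis Bsym : symmetric_op ip D (fun u => - B u).

Lemma semigroup_le t u : 0 <= t -> `|S t u| <= `|u|.
Proof.
move=> t0; apply: le_trans (Sexp _ t0) _; rewrite ler_piMl// -expR0 ler_expR.
by rewrite mulNr oppr_le0 mulr_ge0// ltW.
Qed.

Lemma cvg_semigroup (T : Type) (F : set_system T) {FF : Filter F} (f : T -> V) u t :
  0 <= t -> f @ F --> u -> S t (f x) @[x --> F] --> S t u.
Proof.
move=> t0 fu; apply/cvgrPdist_le => eps eps0.
move/cvgrPdist_le : fu => /(_ _ eps0); apply: filterS => x.
by rewrite -linearB; apply: le_trans (semigroup_le _ t0).
Qed.

Lemma generator_semigroup t u : 0 <= t -> D u -> D (S t u) /\ B (S t u) = S t (B u).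
Proof.
move=> t0 Du; have [_ Sadd _ _] := S0; apply/SB.
have /(cvg_semigroup t0) : h^-1 *: (S h u - u) @[h --> 0^'+] --> B u by apply/SB.
apply: cvg_trans; apply: near_eq_cvg; near=> h.
have h0 : 0 <= h by near: h; exact: nbhs_right_ge.
by rewrite linearZ linearB/= -(Sadd t h)// [t + h]addrC Sadd.
Unshelve. all: by end_near. Qed.

(** By [1 + x <= expR x] the quantity is at most 1 / (1 + x) - 1 + x = x^2 / (1 + x). *)
Lemma expRN_bound (x : R) : 0 <= x -> `|expR (- x) - 1 + x| <= x ^+ 2.
Proof.
move=> x0; have h : 0 <= expR (- x) - 1 + x.
  by have := expR_ge1Dx (- x); rewrite -subr_ge0; congr (0 <= _); ring.
rewrite ger0_norm// expRN; have x1 : 0 < 1 + x by rewrite ltr_wpDr.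
have e1 : (expR x)^-1 <= (1 + x)^-1 by rewrite lef_pV2 ?posrE ?expR_gt0// expR_ge1Dx.
apply: (@le_trans _ _ ((1 + x)^-1 - 1 + x)); first by rewrite lerD2r lerB.
rewrite -subr_ge0.
have -> : x ^+ 2 - ((1 + x)^-1 - 1 + x) = x ^+ 3 / (1 + x) by field; rewrite gt_eqF.
by rewrite divr_ge0 ?exprn_ge0// ltW.
Qed.

Variables (v : V) (l : R).
Hypothesis (Dv : D v) (Bv : - B v = l *: v) (l0 : 0 <= l).

Lemma ip_generator u : D u -> ip (B u) v = - l * ip u v.
Proof.
move=> Du; have [_ sym] := Bsym; have := sym _ _ Du Dv.
by rewrite Bv ipZr ipNl => /(congr1 -%R); rewrite opprK mulNr.
Qed.

(** The coordinate f(t) = ip (S t u) v should solve f' = - l f. The equation is put as a one-step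
    error of order o(h), uniform in t because S t is a contraction, so that steps can simply be
    added up. *)
Lemma semigroup_step u (eps : R) : D u -> 0 < eps ->
  \forall h \near 0^'+, forall t, 0 <= t ->
    `|ip (S (h + t) u) v - expR (- l * h) * ip (S t u) v| <= eps * h.
Proof.
move=> Du eps0; have [_ Sadd _ _] := S0.
have dS : h^-1 *: (S h u - u) @[h --> 0^'+] --> B u by apply/SB.
have v1 : 0 < `|v| + 1 by rewrite ltr_wpDl.
have u1 : 0 < `|u| + 1 by rewrite ltr_wpDl.
have e2 : 0 < eps / 2 / (`|v| + 1) by rewrite !divr_gt0.
pose c := (l ^+ 2 + 1) * (`|u| + 1) * (`|v| + 1).
have c0 : 0 < c by rewrite !mulr_gt0// ltr_wpDl ?sqr_ge0.
move/cvgrPdist_le : dS => /(_ _ e2) near1.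
near=> h => t t0.
have h0 : 0 < h by near: h; exact: nbhs_right_gt.
have hle : h <= eps / 2 / c by near: h; apply: nbhs_right_le; rewrite !divr_gt0.
have [DSu BSu] := generator_semigroup t0 Du.
have -> : ip (S (h + t) u) v - expR (- l * h) * ip (S t u) v =
    - ip (S t (h *: (B u - h^-1 *: (S h u - u)))) v
    - (expR (- (l * h)) - 1 + l * h) * ip (S t u) v.
  have -> : S t (h *: (B u - h^-1 *: (S h u - u))) =
      h *: B (S t u) - (S (h + t) u - S t u).
    rewrite [h + t]addrC Sadd ?(ltW h0)// BSu scalerBr scalerA mulfV ?gt_eqF//.
    by rewrite scale1r !linearB linearZ.
  rewrite !ipBl ipZl ip_generator// mulNr; ring.
apply: le_trans (ler_normB _ _) _; rewrite normrN normrM.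
rewrite [leRHS](_ : _ = eps / 2 * h + eps / 2 * h); last by field.
apply: lerD.
  apply: le_trans (Cauchy_Schwarz hip _ _) _.
  apply: (@le_trans _ _ (h * (eps / 2 / (`|v| + 1)) * (`|v| + 1))).
    apply: ler_pM => //; last by rewrite lerDl.
    apply: le_trans (semigroup_le _ t0) _; rewrite normrZ gtr0_norm// ler_pM2l//.
    by near: h.
  by rewrite -mulrA divfK ?gt_eqF// mulrC.
apply: (@le_trans _ _ ((l * h) ^+ 2 * (`|u| * `|v|))).
  apply: ler_pM => //; first by apply: expRN_bound; rewrite mulr_ge0// ltW.
  apply: le_trans (Cauchy_Schwarz hip _ _) _; rewrite ler_wpM2r//.
  exact: semigroup_le.
apply: (@le_trans _ _ (h * (h * c))); last first.
  by rewrite mulrC ler_wpM2r ?(ltW h0)// -ler_pdivlMr.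
rewrite exprMn mulrC (expr2 h) [leRHS]mulrA mulrA [leRHS]mulrC.
rewrite ler_wpM2r ?mulr_ge0 ?(ltW h0)// /c mulrC -mulrA.
apply: ler_pM; rewrite ?sqr_ge0 ?mulr_ge0// ?lerDl//.
by apply: ler_pM => //; rewrite lerDl.
Unshelve. all: by end_near. Qed.

(** For a vector of [D], the time is cut into n equal steps of error (eps / t) h each; since exp (-
    l h) <= 1 earlier errors are not amplified, and the total is eps. Density of [D] and the
    contraction property do the rest. *)
Lemma semigroup_coord t u : 0 <= t -> ip (S t u) v = expR (- l * t) * ip u v.
Proof.
rewrite le_eqVlt => /predU1P[<-|t0].
  by have [-> _ _ _] := S0; rewrite mulr0 expR0 mul1r.
have onD w : D w -> ip (S t w) v = expR (- l * t) * ip w v.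
  move=> Dw; apply/eqP; rewrite -subr_eq0 -normr_le0; apply/ler_addgt0Pl => eps eps0.
  rewrite addr0; have et : 0 < eps / t by rewrite divr_gt0.
  have [h0' /= h00 near_h] := semigroup_step Dw et.
  pose n := (Num.truncn (t / h0')).+1; pose h := t / n%:R.
  have n0 : 0 < n%:R :> R by rewrite ltr0n.
  have hh0 : 0 < h by rewrite divr_gt0.
  have hlt : h < h0'.
    rewrite /h ltr_pdivrMr// mulrC -ltr_pdivrMr//; apply: truncnS_gt.
  have step m : `|ip (S (m%:R * h) w) v - expR (- l * (m%:R * h)) * ip w v| <=
      m%:R * (eps / t * h).
    elim: m => [|m IH].
      rewrite mulr0n !mul0r mulr0 expR0 mul1r.
      by have [-> _ _ _] := S0; rewrite subrr normr0.
    have mh0 : 0 <= m%:R * h by rewrite mulr_ge0 ?ler0n// ltW.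
    have := near_h h _ hh0 _ mh0; rewrite /ball/= sub0r normrN gtr0_norm// => /(_ hlt) st.
    have -> : m.+1%:R * h = h + m%:R * h by rewrite -natr1 mulrDl mul1r addrC.
    rewrite mulrDr expRD.
    rewrite [X in `|X|](_ : _ = (ip (S (h + m%:R * h) w) v
      - expR (- l * h) * ip (S (m%:R * h) w) v)
      + expR (- l * h) * (ip (S (m%:R * h) w) v - expR (- l * (m%:R * h)) * ip w v));
      last by ring.
    apply: le_trans (ler_normD _ _) _.
    rewrite -natr1 mulrDl mul1r [leRHS]addrC; apply: lerD => //.
    apply: le_trans IH; rewrite normrM ger0_norm ?expR_ge0// ler_piMl//.
    by rewrite -expR0 ler_expR mulNr oppr_le0 mulr_ge0// ltW.
  have := step n; have -> : n%:R * h = t by rewrite /h mulrC divfK// gt_eqF.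
  by rewrite mulrCA -/h (_ : n%:R * h = t) ?divfK ?gt_eqF//; rewrite /h mulrC divfK// gt_eqF.
apply/eqP; rewrite -subr_eq0 -normr_le0; apply/ler_addgt0Pl => eps eps0; rewrite addr0.
have [dD _] := Bsym; have v1 : 0 < `|v| + 1 by rewrite ltr_wpDl.
have e1 : 0 < eps / 2 / (`|v| + 1) by rewrite !divr_gt0.
have [w [/= uw Dw]] : ball u (eps / 2 / (`|v| + 1)) `&` D !=set0.
  by apply: dD; [exists u; exact: ballxx|exact: ball_open].
move: uw; rewrite -ball_normE /= => uw.
have -> : ip (S t u) v - expR (- l * t) * ip u v =
   ip (S t (u - w)) v - expR (- l * t) * ip (u - w) v.
  by rewrite (linearB (S t) u w) !ipBl (onD w Dw); ring.
have b1 : `|ip (u - w) v| <= eps / 2.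
  apply: le_trans (Cauchy_Schwarz hip _ _) _.
  rewrite -[leRHS](divfK (lt0r_neq0 v1)); apply: ler_pM => //; first exact: ltW.
  by rewrite lerDl.
apply: le_trans (ler_normB _ _) _; rewrite [leRHS]splitr; apply: lerD.
  apply: le_trans (Cauchy_Schwarz hip _ _) _.
  rewrite -[leRHS](divfK (lt0r_neq0 v1)); apply: ler_pM => //; last by rewrite lerDl.
  by apply: le_trans (semigroup_le _ (ltW t0)) _; exact: ltW.
rewrite normrM ger0_norm ?expR_ge0//; apply: le_trans b1; rewrite ler_piMl//.
by rewrite -expR0 ler_expR mulNr oppr_le0 mulr_ge0// ltW.
Qed.

Lemma eigenvalue_ge : ip v v = 1 -> lB <= l.
Proof.
move=> vv; have := semigroup_coord v ler01; rewrite vv mulr1 mulr1 => h.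
have v1 : `|v| = 1 by apply/eqP; rewrite -(@eqrXn2 _ 2)// expr1n -hip vv.
have := le_trans (ip_le hip (S 1 v) v) (ler_wpM2r (normr_ge0 v) (Sexp v ler01)).
by rewrite h v1 !mulr1 ler_expR lerN2.
Qed.
End Spectral.

(** * Estimates for operators diagonal in the eigenbasis *)

Section Diagonal.
Context {R : realType} {V : completeNormedModType R} (ip : {dot V for idfun}).
Hypothesis hip : hilbert_norm ip.
Variables (e : nat -> V) (lam : nat -> R).
Hypothesis eorth : forall n m, n != m -> ip (e n) (e m) = 0.
Hypothesis enorm : forall n, ip (e n) (e n) = 1 \/ e n = 0.
Hypothesis emax : forall v, (forall n, ip v (e n) = 0) -> v = 0.
Variables (D : set V) (B : V -> V) (lB : R).
Hypothesis (lB0 : 0 < lB) (lamB : forall n, lB <= lam n).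
Hypothesis Be : forall n, D (e n) /\ - B (e n) = lam n *: e n.
Hypothesis Binv : compact_inverse D (fun u => - B u).

Lemma compact_inverse_bounded (K : {linear V -> V}) :
  precompact (K @` closed_ball 0 1) -> continuous K.
Proof.
rewrite precompactE => /compact_bounded[M [_ hM]].
apply/linear_bounded_continuous; rewrite /bounded_near.
near=> N; apply/nbhs_ballP; exists 1 => //= x; rewrite -ball_normE /= => x1.
apply: (hM N); first by near: N; apply: nbhs_pinfty_gt; exact: num_real.
apply: subset_closure; exists x => //; rewrite closed_ballE//.
by rewrite /closed_ball_/=; exact: ltW.
Unshelve. all: by end_near. Qed.

(** Riesz-Fischer gives a vector v with coordinates lam n * ip J (e n). The bounded inverse A of - B
    maps its partial sums to those of J, so J = A v lies in [D] and - B J = v. *)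
Lemma diagonal_domain J K : 0 <= K ->
  (forall N, \sum_(0 <= n < N) (lam n * ip J (e n)) ^+ 2 <= K ^+ 2) ->
  D J /\ `|B J| <= K.
Proof.
move=> K0 /(partial_cvg hip eorth enorm)[v pv vK].
have [A [Acpt AD BA]] := Binv.
have cA := compact_inverse_bounded Acpt.
have JA : J = A v.
  have h : A (partial e (fun n => lam n * ip J (e n)) N) @[N --> \oo] --> A v.
    exact: cvg_comp pv (cA v).
  rewrite -(cvg_lim _ h)//; apply/esym/cvg_lim => //.
  have -> : (fun N => A (partial e (fun n => lam n * ip J (e n)) N)) =
      partial e (fun n => ip J (e n)).
    apply/funext => N; rewrite /partial linear_sum; apply: eq_bigr => n _.
    have [Dn Bn] := Be n.
    by rewrite mulrC -scalerA -Bn linearZ BA.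
  exact: Parseval.
have [DAv BAv] := AD v; rewrite JA; split => //.
by rewrite -normrN BAv -(@ler_pXn2r _ 2)// nnegrE.
Qed.

(** Half of the exponential absorbs the factor [mu] through x <= exp x at x = mu s / 2; the other
    half decays at least at the rate mu0 / 2. *)
Lemma kernel_bound (s mu mu0 : R) : 0 < mu0 -> mu0 <= mu -> 0 < s ->
  mu * expR (- mu * s) <= 2 / s * expR (- (mu0 / 2) * s).
Proof.
move=> m0 mm s0; have mu1 : 0 < mu := lt_le_trans m0 mm.
have -> : expR (- mu * s) = expR (- (mu / 2 * s)) * expR (- (mu / 2) * s).
  by rewrite -expRD; congr expR; field.
rewrite mulrA; apply: ler_pM; rewrite ?mulr_ge0 ?expR_ge0 ?(ltW mu1)//; last first.
  by rewrite ler_expR ler_wpM2r ?(ltW s0)// lerN2 ler_pM2r.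
rewrite expRN ler_pdivrMr ?expR_gt0//.
have h : mu / 2 * s <= expR (mu / 2 * s).
  by apply: le_trans (expR_ge1Dx _); rewrite lerDr.
have -> : mu = 2 / s * (mu / 2 * s) by field; rewrite gt_eqF.
rewrite {1}(_ : 2 / s * (mu / 2 * s) / 2 * s = mu / 2 * s); last by field; rewrite gt_eqF.
by rewrite ler_pM2l// divr_gt0.
Qed.

Local Notation mu := (@lebesgue_measure R).

(* Minkowski's integral inequality for the coordinates, obtained by pairing
   the integrand with the coordinates of the integral. *)
Lemma diagonal_convolution (E : set (measurableTypeR R)) (t eps M : R)
    (h : R -> V) (k : R -> R) (c : nat -> R) :
  measurable E -> E `<=` `]-oo, t]%classic -> 0 < eps -> 0 <= M ->
  (forall n, mu.-integrable E (fun r =>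
      (lam n / eps * expR (- (lam n / eps) * (t - r)) * ip (h r) (e n))%:E) /\
    (\int[mu]_(r in E)
      (lam n / eps * expR (- (lam n / eps) * (t - r)) * ip (h r) (e n))%:E)%E
     = (c n)%:E) ->
  (forall r, E r -> r < t ->
     2 / (t - r) * expR (- (lB / eps / 2) * (t - r)) * `|h r| <= k r) ->
  h t = 0 -> (forall r, E r -> 0 <= k r) ->
  (\int[mu]_(r in E) (k r)%:E <= M%:E)%E ->
  forall N, \sum_(0 <= n < N) c n ^+ 2 <= M ^+ 2.
Proof.
move=> mE Et eps0 M0 hc hk ht k0 kM N; set A := \sum_(0 <= n < N) _.
have A0 : 0 <= A by apply: sumr_ge0 => n _; exact: sqr_ge0.
have [->|A00] := eqVneq A 0; first exact: sqr_ge0.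
have sA : 0 < Num.sqrt A by rewrite sqrtr_gt0 lt_neqAle eq_sym A00.
suff sAM : Num.sqrt A <= M.
  by rewrite -(sqr_sqrtr A0); apply: lerXn2r; rewrite ?nnegrE ?sqrtr_ge0.
rewrite -(ler_pM2r sA) -expr2 sqr_sqrtr// mulrC.
(* [w r] carries the weights that make the integral of [ip (h r) (w r)] equal to the sum of squares
   [A]. Its norm is at most the kernel times sqrt A, which gives A <= M sqrt A. *)
pose w r := partial e (fun n => c n * (lam n / eps * expR (- (lam n / eps) * (t - r)))) N.
have hw r : ip (h r) (w r) = \sum_(0 <= n < N) c n *
    (lam n / eps * expR (- (lam n / eps) * (t - r)) * ip (h r) (e n)).
  by rewrite ip_partial; apply: eq_bigr => n _; rewrite -!mulrA.
have wle r : r < t -> `|w r| <=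
    2 / (t - r) * expR (- (lB / eps / 2) * (t - r)) * Num.sqrt A.
  move=> rt; have s0 : 0 < t - r by rewrite subr_gt0.
  set kk := 2 / (t - r) * _; have kk0 : 0 <= kk.
    by rewrite mulr_ge0 ?expR_ge0// divr_ge0// ltW.
  rewrite -(@ler_pXn2r _ 2) ?nnegrE ?(mulr_ge0 kk0) ?sqrtr_ge0 ?normr_ge0//.
  rewrite exprMn sqr_sqrtr// (sqr_partial hip eorth) mulr_sumr; apply: ler_sum => n _.
  apply: (@le_trans _ _ ((c n * (lam n / eps * expR (- (lam n / eps) * (t - r)))) ^+ 2)).
    by rewrite ler_piMr ?sqr_ge0// (ee_le1 enorm).
  rewrite exprMn mulrC ler_wpM2r ?sqr_ge0//.
  have ln : lB / eps <= lam n / eps by rewrite ler_pM2r// invr_gt0.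
  have l0 : 0 < lB / eps by rewrite divr_gt0.
  apply: lerXn2r; last exact: kernel_bound.
    by rewrite nnegrE mulr_ge0 ?expR_ge0// (le_trans _ ln)// ltW.
  by rewrite nnegrE.
have iw n : mu.-integrable E (fun r => (c n * (lam n / eps *
    expR (- (lam n / eps) * (t - r)) * ip (h r) (e n)))%:E).
  have -> : (fun r => (c n * (lam n / eps *
    expR (- (lam n / eps) * (t - r)) * ip (h r) (e n)))%:E) =
   (fun r => (c n)%:E * (lam n / eps *
    expR (- (lam n / eps) * (t - r)) * ip (h r) (e n))%:E)%E by apply/funext.
  by apply: integrableZl => //; case: (hc n).
have AE : (A%:E = \int[mu]_(r in E) (ip (h r) (w r))%:E)%E.
  under eq_integral do rewrite hw -sumEFin.
  rewrite integral_sum// /A -sumEFin; apply: eq_bigr => n _.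
  under eq_integral do rewrite EFinM.
  by have [i1 i2] := hc n; rewrite integralZl// i2 -EFinM expr2.
rewrite -lee_fin AE.
have mf : measurable_fun E (fun r => ip (h r) (w r)).
  have -> : (fun r => ip (h r) (w r)) = (fun r => \sum_(0 <= n < N) c n *
    (lam n / eps * expR (- (lam n / eps) * (t - r)) * ip (h r) (e n))).
    exact/funext.
  by apply: measurable_sum => n; apply/measurable_EFinP; exact: measurable_int (iw n).
apply: le_trans (lee_abs _) _; apply: le_trans (le_abse_integral _ _ _) _ => //.
  exact/measurable_EFinP.
apply: (@le_trans _ _ ((Num.sqrt A)%:E * \int[mu]_(r in E) (k r)%:E)%E); last first.
  by rewrite EFinM lee_pmul2l.
apply: ge0_le_integralZl_nomeas => //; first exact: measurableT_comp.
move=> r Er; rewrite normr_ge0/=; have := Et _ Er; rewrite /= in_itv/=.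
(* The kernel bound is singular at r = t, where the integrand vanishes because [h t = 0]. *)
rewrite le_eqVlt => /predU1P[rt|rt].
  by rewrite rt ht ip0l normr0 mulr_ge0 ?sqrtr_ge0// k0// -rt.
apply: le_trans (Cauchy_Schwarz hip _ _) _.
apply: le_trans (ler_wpM2l (normr_ge0 _) (wle _ rt)) _.
rewrite mulrA mulrC ler_wpM2l ?sqrtr_ge0// mulrC; exact: hk.
Qed.

End Diagonal.

(** * Hoelder paths of polynomial growth *)

Section Growth.
Context {R : realType} {V : completeNormedModType R}.

Definition holder_growth (al C : R) (w : R -> V) : Prop :=
  forall s u, `|w (s + u) - w s| <=
    C * (1 + `|s|) * (1 + `|u|) ^+ 2 * `|u| `^ al.

Lemma holder_growth_theta gam al C (w : hpath V gam) t : 0 <= C ->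
  holder_growth al C w -> holder_growth al (C * (1 + `|t|)) (theta t w).
Proof.
move=> C0 hw s u; rewrite /theta/= opprB addrA subrK.
have -> : s + u + t = (s + t) + u by rewrite addrAC.
apply: le_trans (hw _ _) _; apply: ler_wpM2r; first exact: powR_ge0.
apply: ler_wpM2r; first exact: sqr_ge0.
rewrite -mulrA ler_wpM2l//.
apply: (@le_trans _ _ (1 + (`|s| + `|t|))); first by rewrite lerD2l ler_normD.
have : 0 <= `|t| * `|s| by rewrite mulr_ge0.
by rewrite -subr_ge0 => h; rewrite -subr_ge0; move: h; congr (0 <= _); ring.
Qed.

Lemma holder_growth0 al C (w : R -> V) s : 0 < al <= 1 -> 0 <= C -> w 0 = 0 ->
  holder_growth al C w -> `|w s| <= C * (1 + `|s|) ^+ 3.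
Proof.
move=> /andP[al0 al1] C0 w0 hw; have := hw 0 s.
rewrite add0r w0 subr0 normr0 addr0 mulr1 => h; apply: le_trans h _.
rewrite (exprSr _ 2) [leRHS]mulrA; apply: ler_wpM2l; first by rewrite mulr_ge0// sqr_ge0.
apply: (@le_trans _ _ ((1 + `|s|) `^ al)).
  by apply: ge0_ler_powR; rewrite ?nnegrE ?(ltW al0)// ?addr_ge0// lerDr.
by apply: ler1_powR => //; rewrite lerDl.
Qed.
End Growth.

(** * Pathwise bounds on the noise terms *)

Section Noise.
Context {R : realType} {V : completeNormedModType R} (ip : {dot V for idfun}).
Hypothesis hip : hilbert_norm ip.
Variables (e : nat -> V) (lam : nat -> R).
Hypothesis eorth : forall n m, n != m -> ip (e n) (e m) = 0.
Hypothesis enorm : forall n, ip (e n) (e n) = 1 \/ e n = 0.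
Hypothesis emax : forall v, (forall n, ip v (e n) = 0) -> v = 0.
Variables (D : set V) (B : V -> V) (lB : R) (S : R -> {linear V -> V}).
Hypothesis (lB0 : 0 < lB) (lamB : forall n, lB <= lam n).
Hypothesis Be : forall n, D (e n) /\ - B (e n) = lam n *: e n.
Hypothesis Binv : compact_inverse D (fun u => - B u).
Hypothesis Scoord : forall n t u, 0 <= t ->
  ip (S t u) (e n) = expR (- lam n * t) * ip u (e n).
Hypothesis Bsym : symmetric_op ip D (fun u => - B u).
Hypothesis Sle : forall t u, 0 <= t -> `|S t u| <= `|u|.
Variables (eps al : R).
Hypothesis (eps0 : 0 < eps) (al01 : 0 < al < 1).
Local Notation mu := (@lebesgue_measure R).

(** The quadratic growth of the increments costs half of the decay left by [kernel_bound], and (2 /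
    s) s^al leaves the integrable power s^(al - 1). As [G] depends neither on the time nor on the
    path, it serves finite intervals and the half-line alike. *)
Lemma singular_convolution : exists2 G : R, 0 < G &
  forall (E : set (measurableTypeR R)) t (h : R -> V) (c : nat -> R) K,
  measurable E -> E `<=` `]-oo, t]%classic -> 0 <= K ->
  (forall n, mu.-integrable E (fun r =>
      (lam n / eps * expR (- (lam n / eps) * (t - r)) * ip (h r) (e n))%:E) /\
    (\int[mu]_(r in E)
      (lam n / eps * expR (- (lam n / eps) * (t - r)) * ip (h r) (e n))%:E)%E
     = (c n)%:E) ->
  (forall r, E r -> r <= t ->
     `|h r| <= K * (1 + (t - r) / eps) ^+ 2 * (t - r) `^ al) ->
  h t = 0 ->
  forall N, \sum_(0 <= n < N) c n ^+ 2 <= (G * K) ^+ 2.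
Proof.
have c0 : 0 < lB / eps / 4 by rewrite !divr_gt0.
have /andP[al0 al1] := al01.
have [G0 G00 hG] := integral_gamma_kernel al01 c0.
(* Chosen so that 1 + s / eps <= be exp (lB s / (8 eps)); the square of this consumes the rate lB /
   (4 eps). *)
pose be := 1 + 8 / lB; have be0 : 0 < be by rewrite addr_gt0// divr_gt0.
exists (2 * be ^+ 2 * G0); first by rewrite !mulr_gt0// exprn_gt0.
move=> E t h c K mE Et K0 hc hK ht.
pose k r := 2 * be ^+ 2 * K * gamma_kernel al (lB / eps / 4) (t - r).
have cK : 0 <= 2 * be ^+ 2 * K by rewrite !mulr_ge0 ?(ltW be0).
have k0 r : 0 <= k r by rewrite mulr_ge0// gamma_kernel_ge0.
apply: (@diagonal_convolution _ _ _ hip e lam eorth enorm lB lB0 lamB E t eps _ h k c) => //.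
- by rewrite !mulr_ge0 ?(ltW be0) ?(ltW G00).
- move=> r Er rt; have s0 : 0 < t - r by rewrite subr_gt0.
  apply: (@le_trans _ _ (2 / (t - r) * expR (- (lB / eps / 2) * (t - r)) *
      (K * (be * expR (lB / eps / 8 * (t - r))) ^+ 2 * (t - r) `^ al))).
    apply: ler_wpM2l; first by rewrite mulr_ge0 ?expR_ge0// divr_ge0// ltW.
    apply: le_trans (hK r Er (ltW rt)) _; apply: ler_wpM2r; first exact: powR_ge0.
    apply: ler_wpM2l => //; apply: lerXn2r.
    + by rewrite nnegrE addr_ge0// divr_ge0// ltW.
    + by rewrite nnegrE mulr_ge0 ?expR_ge0// ltW.
    + set x := lB / eps / 8 * (t - r).
      have x0 : 0 <= x by rewrite mulr_ge0// ltW// !divr_gt0.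
      apply: (@le_trans _ _ (be * (1 + x))); last first.
        by rewrite ler_pM2l// expR_ge1Dx.
      rewrite -subr_ge0 /be [X in 0 <= X](_ : _ = 8 / lB + x); last first.
        by rewrite /x; field; rewrite !gt_eqF.
      by rewrite addr_ge0// divr_ge0// ltW.
  rewrite /k /gamma_kernel exprMn (expr2 (expR _)) -expRD -(@mulr_powRB1 _ (t - r) al)// ?(ltW s0)//.
  have -> : expR (- (lB / eps / 4) * (t - r)) =
    expR (- (lB / eps / 2) * (t - r)) *
    expR (lB / eps / 8 * (t - r) + lB / eps / 8 * (t - r)).
    by rewrite -expRD; congr expR; field; rewrite gt_eqF.
  rewrite le_eqVlt; apply/orP; left; apply/eqP; field; exact: lt0r_neq0.
have mk : measurable_fun setT k.
  apply: measurable_funM => //.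
  apply: (measurableT_comp (measurable_gamma_kernel al (lB / eps / 4))).
  exact: measurable_sub.
apply: (@le_trans _ _ (\int[mu]_(r in `]-oo, t]) (k r)%:E)%E).
  apply: ge0_subset_integral => //.
    by apply/measurable_EFinP; apply: measurable_funS mk.
  by move=> r _; rewrite lee_fin.
rewrite (@ge0_integral_reflect _ t
  (fun s => (2 * be ^+ 2 * K * gamma_kernel al (lB / eps / 4) s)%:E)); last 2 first.
- apply/measurable_EFinP/measurable_funM => //.
  exact: measurable_gamma_kernel.
- by move=> s; rewrite lee_fin mulr_ge0// gamma_kernel_ge0.
under eq_integral do rewrite EFinM.
rewrite ge0_integralZl_EFin//; last 2 first.
- by move=> s _; rewrite lee_fin gamma_kernel_ge0.
- apply/measurable_EFinP; apply: measurable_funS (measurable_gamma_kernel _ _) => //.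
rewrite (_ : 2 * be ^+ 2 * G0 * K = 2 * be ^+ 2 * K * G0); last by ring.
by rewrite [in leRHS]EFinM; apply: lee_wpmul2l.
Qed.

(** On constants, eps^-1 B of the integrated semigroup is S (t / eps) - 1. Writing w = W - h, with W
    the value at the end point, turns the noise term into S (t / eps) W minus eps^-1 B of the
    convolution of h, which vanishes at the singularity. The identity is checked in each coordinate,
    by scalar integrals. *)
Lemma noise_bound : exists2 G : R, 0 < G &
  forall (w : R -> V) C t I2, 0 <= C -> w 0 = 0 -> holder_growth al C w -> 0 <= t ->
  is_bochner `[0, t]%classic (fun r => S ((t - r) / eps) (w (r / eps))) I2 -> D I2 ->
  `|w (t / eps) + eps^-1 *: B I2| <= G * C * (1 + t / eps) ^+ 3.
Proof.
have [G G0 hG] := singular_convolution; have /andP[al0 al1] := al01.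
(* [K0] accounts for the time change: (s / eps)^al = K0 s^al. *)
pose K0 := (eps^-1) `^ al; have K00 : 0 <= K0 by exact: powR_ge0.
exists (1 + G * K0); first by rewrite ltr_pwDl// mulr_ge0// ltW.
move=> w C t I2 C0 w0 hw t0 hI DI2; set W := w (t / eps).
have te0 : 0 <= t / eps by rewrite divr_ge0// ltW.
have mE : measurable (`[0, t]%classic : set (measurableTypeR R)) by exact: measurable_itv.
pose h (r : R) := W - w (r / eps).
pose c n := ip (W + eps^-1 *: B I2 - S (t / eps) W) (e n).
pose ll n := lam n / eps.
have ll0 n : 0 < ll n by rewrite divr_gt0// (lt_le_trans lB0).
have cE n : mu.-integrable `[0, t]%classic (fun r =>
      (ll n * expR (- ll n * (t - r)) * ip (h r) (e n))%:E) /\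
    (\int[mu]_(r in `[0%R, t]) (ll n * expR (- ll n * (t - r)) * ip (h r) (e n))%:E)%E
     = (c n)%:E.
  have [i1 e1] := bochner_pairing hip mE (e n) hI.
  have E1 : {in `[0, t]%classic, forall r : R,
     (ip (S ((t - r) / eps) (w (r / eps))) (e n))%:E =
     (expR (- ll n * (t - r)) * ip (w (r / eps)) (e n))%:E}.
    move=> r; rewrite inE/= in_itv/= => /andP[_ rt].
    rewrite Scoord ?divr_ge0 ?subr_ge0 ?(ltW eps0)//; congr (expR _ * _)%:E.
    by rewrite /ll; field; rewrite gt_eqF.
  have i2 : mu.-integrable `[0, t]%classic
      (fun r => (expR (- ll n * (t - r)) * ip (w (r / eps)) (e n))%:E).
    exact: (eq_integrable mE _ _ E1 i1).
  have e2 : (\int[mu]_(r in `[0%R, t])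
      (expR (- ll n * (t - r)) * ip (w (r / eps)) (e n))%:E)%E = (ip I2 (e n))%:E.
    by rewrite -e1; apply/esym/eq_integral => r rt; exact: E1.
  have e3 := integral_expR_itvcc (lt0r_neq0 (ll0 n)) t0.
  have mexp : measurable_fun `[0, t]%classic (fun r : R => expR (- ll n * (t - r))).
    apply: measurable_funS (_ : measurable_fun setT _) => //.
    apply: measurableT_comp => //; apply: measurable_funM => //; exact: measurable_sub.
  have i3 : mu.-integrable `[0, t]%classic (fun r => (expR (- ll n * (t - r)))%:E).
    apply/integrableP; split; first exact/measurable_EFinP.
    under eq_integral do rewrite gee0_abs ?lee_fin ?expR_ge0//.
    by rewrite e3 ltry.
  pose a := ll n * ip W (e n).
  have fE : (fun r => (ll n * expR (- ll n * (t - r)) * ip (h r) (e n))%:E) =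
    (fun r => a%:E * (expR (- ll n * (t - r)))%:E -
       (ll n)%:E * (expR (- ll n * (t - r)) * ip (w (r / eps)) (e n))%:E)%E.
    by apply/funext => r; rewrite -!EFinM -EFinB /h ipBl /a; congr EFin; ring.
  have i4 : mu.-integrable `[0, t]%classic (fun r => (a%:E * (expR (- ll n * (t - r)))%:E)%E).
    exact: integrableZl.
  have i5 : mu.-integrable `[0, t]%classic (fun r =>
     ((ll n)%:E * (expR (- ll n * (t - r)) * ip (w (r / eps)) (e n))%:E)%E).
    exact: integrableZl.
  rewrite fE; split; first exact: integrableB.
  rewrite integralB// !integralZl// e2 e3 -!EFinM -EFinB; congr EFin.
  rewrite /c ipBl ipDl ipZl Scoord//.
  have [De Bn] := Be n; rewrite (ip_generator Bsym De Bn DI2).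
  have -> : expR (- lam n * (t / eps)) = expR (- ll n * t).
    by congr expR; rewrite /ll; field; rewrite gt_eqF.
  rewrite /a /ll; field; rewrite !gt_eqF// (lt_le_trans lB0)//.
have cB := hG `[0, t]%classic t h c (C * (1 + t / eps) * K0) mE.
have {cB} : `|W + eps^-1 *: B I2 - S (t / eps) W| <= G * (C * (1 + t / eps) * K0).
  apply: (norm_le_coords hip eorth enorm emax).
    by rewrite !mulr_ge0// ?addr_ge0// ltW.
  apply: cB => //.
  - by move=> r /=; rewrite !in_itv/= => /andP[].
  - by rewrite !mulr_ge0// addr_ge0.
  - move=> r _ rt; rewrite /h /W -normrN opprB.
    have := hw (t / eps) ((r - t) / eps); rewrite -mulrDl [t + _]addrC subrK.
    have -> : `|(r - t) / eps| = (t - r) / eps.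
      by rewrite normrM normfV (gtr0_norm eps0) distrC ger0_norm// subr_ge0.
    rewrite (ger0_norm te0) powRM ?subr_ge0 ?invr_ge0 ?(ltW eps0)// -/K0 => hh.
    apply: le_trans hh _; rewrite le_eqVlt; apply/orP; left; apply/eqP; ring.
  - by rewrite /h subrr.
move=> h1; rewrite -[X in `|X|](subrK (S (t / eps) W)).
apply: le_trans (ler_normD _ _) _.
have -> : (1 + G * K0) * C * (1 + t / eps) ^+ 3 =
  G * (C * (1 + t / eps) ^+ 3 * K0) + C * (1 + t / eps) ^+ 3 by ring.
have t1 : 1 <= 1 + t / eps by rewrite lerDl.
apply: lerD.
  apply: le_trans h1 _; rewrite ler_pM2l// ler_wpM2r// ler_wpM2l//.
  by apply: ler_eXnr.
apply: le_trans (Sle _ te0) _.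
have := @holder_growth0 _ _ al C w (t / eps) _ C0 w0 hw.
by rewrite (ger0_norm te0); apply; rewrite al0 ltW.
Qed.

Hypothesis Blin : linear_op D B.

Lemma linear_op0 : B 0 = 0.
Proof.
have [D0 lin] := Blin; have [_] := lin 1 0 0 D0 D0; rewrite !scale1r addr0.
by move/eqP; rewrite -subr_eq0 opprD addrA subrr sub0r oppr_eq0 => /eqP.
Qed.

Lemma linear_opZ a u : D u -> D (a *: u) /\ B (a *: u) = a *: B u.
Proof.
move=> Du; have [D0 lin] := Blin; have := lin a u 0 Du D0.
by rewrite linear_op0 !addr0.
Qed.

(** The end point is 0, where the path vanishes, so nothing has to be subtracted before the
    convolution estimate applies. [diagonal_domain] then yields the domain and the bound
    together. *)
Lemma Zst_bound gam : exists2 G : R, 0 < G &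
  forall (w : hpath V gam) C, 0 <= C -> holder_growth al C w ->
  `|Zst B S eps w| <= G * (1 + C).
Proof.
have [G G0 hG] := singular_convolution; have /andP[al0 al1] := al01.
pose K0 := (eps^-1) `^ al; have K00 : 0 <= K0 by exact: powR_ge0.
(* When there is no integral, [bochner] returns [point]; the size of the resulting vector is built
   into the constant. *)
pose junk := `|eps^-1 *: B point|.
have GK : 0 <= G * K0 by rewrite mulr_ge0// ltW.
exists (1 + junk + G * K0).
  by apply: ltr_wpDr => //; apply: ltr_wpDr => //; exact: normr_ge0.
move=> w C C0 hw; rewrite /Zst.
have [[J hJ]|noJ] := pselect (exists J, is_bochner (V := V) `]-oo, 0]%classic
    (fun q => S (- q / eps) (w (q / eps))) J); last first.
  rewrite /bochner getPN; last by move=> J hJ; apply: noJ; exists J.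
  rewrite -/junk; apply: (@le_trans _ _ ((1 + junk + G * K0) * 1)).
    by rewrite mulr1 -addrA addrCA lerDl addr_ge0.
  by rewrite ler_wpM2l ?lerDl// !addr_ge0// normr_ge0.
have {J hJ}hJ : is_bochner `]-oo, 0]%classic
    (fun q => S (- q / eps) (w (q / eps)))
    (bochner `]-oo, 0]%classic (fun q => S (- q / eps) (w (q / eps)))).
  by apply: getPex; exists J.
set J := bochner _ _ in hJ *.
have mE : measurable (`]-oo, 0]%classic : set (measurableTypeR R)) by exact: measurable_itv.
pose ll n := lam n / eps.
have ll0 n : 0 < ll n by rewrite divr_gt0// (lt_le_trans lB0).
have cE n : mu.-integrable `]-oo, 0]%classic (fun r =>
      (ll n * expR (- ll n * (0 - r)) * ip (w (r / eps)) (e n))%:E) /\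
    (\int[mu]_(r in `]-oo, 0%R]) (ll n * expR (- ll n * (0 - r)) * ip (w (r / eps)) (e n))%:E)%E
     = (ll n * ip J (e n))%:E.
  have [i1 e1] := bochner_pairing hip mE (e n) hJ.
  have E1 : {in `]-oo, 0]%classic, forall r : R,
     ((ll n)%:E * (ip (S (- r / eps) (w (r / eps))) (e n))%:E)%E =
     (ll n * expR (- ll n * (0 - r)) * ip (w (r / eps)) (e n))%:E}.
    move=> r; rewrite inE/= in_itv/= => r0.
    rewrite Scoord ?divr_ge0 ?oppr_ge0 ?(ltW eps0)// -EFinM; congr EFin.
    have -> : - lam n * (- r / eps) = - ll n * (0 - r).
      by rewrite /ll; field; exact: lt0r_neq0.
    by rewrite mulrA.
  have i2 : mu.-integrable `]-oo, 0]%classic (fun r =>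
    ((ll n)%:E * (ip (S (- r / eps) (w (r / eps))) (e n))%:E)%E) by exact: integrableZl.
  split; first exact: (eq_integrable mE _ _ E1 i2).
  by rewrite EFinM -e1 -integralZl//; apply/esym/eq_integral => r rt; exact: E1.
have [] := @diagonal_domain _ _ _ hip e lam eorth enorm emax D B Be Binv
    (eps^-1 *: J) (G * (C * K0)).
- by rewrite !mulr_ge0// ltW.
- move=> N; rewrite (eq_bigr (fun n => (ll n * ip J (e n)) ^+ 2)); last first.
    by move=> n _; rewrite ipZl mulrA.
  apply: (hG _ _ _ _ _ mE _ _ cE) => //.
  + by rewrite mulr_ge0.
  + move=> r; rewrite /= in_itv/= => r0 _; have := hw 0 (r / eps).
    rewrite add0r path_fun0 subr0 normr0 addr0 mulr1.
    have -> : `|r / eps| = (0 - r) / eps.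
      by rewrite normrM normfV (gtr0_norm eps0) sub0r ler0_norm.
    rewrite powRM ?sub0r ?invr_ge0 ?oppr_ge0 ?(ltW eps0)// -/K0 => hh.
    apply: le_trans hh _; rewrite le_eqVlt; apply/orP; left; apply/eqP; ring.
  + by rewrite mul0r path_fun0.
move=> DJ BJ; have [_] := linear_opZ eps DJ.
rewrite scalerA mulfV ?gt_eqF// scale1r => ->.
rewrite scalerA mulVf ?gt_eqF// scale1r; apply: le_trans BJ _.
rewrite -subr_ge0 (_ : _ - _ = (1 + junk) * (1 + C) + G * K0); last by ring.
by rewrite addr_ge0// mulr_ge0// addr_ge0// normr_ge0.
Qed.

End Noise.

(** * Contraction and growth of mild solutions *)

Section Solutions.
Context {R : realType} {V : completeNormedModType R} (ip : {dot V for idfun}).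
Hypothesis hip : hilbert_norm ip.
Variables (D : set V) (B : V -> V) (lB : R) (S : R -> {linear V -> V}).
Hypothesis lB0 : 0 < lB.
Hypothesis Sexp : forall (t : R) (u : V), 0 <= t -> `|S t u| <= expR (- lB * t) * `|u|.
Variables (g : V -> V -> V) (C1 C2 eps : R) (x : V).
Hypothesis (eps0 : 0 < eps) (C10 : 0 < C1) (C1B : C1 < lB).
Hypothesis hg : forall x1 y1 x2 y2 : V,
  `|g x1 y1 - g x2 y2| <= C1 * (`|x1 - x2| + `|y1 - y2|).
Hypothesis hC2 : C2 = `|g 0 0|.
Variable gam : R.
Implicit Types (w : hpath V gam) (Y : R -> V).
Local Notation mu := (@lebesgue_measure R).
Local Notation k := ((lB - C1) / eps).

Lemma rate_gt0 : 0 < k. Proof. by rewrite divr_gt0// subr_gt0. Qed.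

(** Comparison with the zero integral lets [bochner_dist_le] bound a single integral. *)
Lemma is_bochner0 (E : set R) : is_bochner E (fun _ => 0 : V) 0.
Proof.
have s0 : simple_on E (fun _ => 0 : V).
  split.
    apply: (sub_finite_set _ (finite_set1 (0 : V))) => _ [r _ <-] //.
  move=> v v0; have -> : E `&` (fun _ => 0 : V) @^-1` [set v] = set0.
    by apply/seteqP; split => // r [_ /= v00]; move: v0; rewrite -v00 eqxx.
  by rewrite measure0.
exists (fun _ _ => 0); split => //.
- by move=> r _; exact: cvg_cst.
- under eq_fun do under eq_integral do rewrite subrr normr0.
  rewrite (_ : (fun _ => _) = cst 0%E); first exact: cvg_cst.
  by apply/funext => n; rewrite integral0.
- rewrite (_ : (fun _ => _) = cst 0); first exact: cvg_cst.
  apply/funext => n; rewrite /simple_integral fsbig1// => v [r _ <-].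
  exact: scaler0.
Qed.

Lemma itv0_measurable (t : R) : measurable (`[0, t]%classic : set (measurableTypeR R)).
Proof. exact: measurable_itv. Qed.

Lemma within_itv (Y : R -> V) T : {within `[0, +oo[, continuous Y} ->
  {within `[0, T], continuous Y}.
Proof.
by apply: continuous_subspaceW => r /=; rewrite !in_itv/= => /andP[->].
Qed.

(** The noise integrals agree by uniqueness and cancel. At a maximum point c of f, with value M, the
    nonlinear term contributes at most M (1 - exp (- b c)); hence M <= exp (- b c) |y1 - y2| + M (1
    - exp (- b c)), that is M <= |y1 - y2|, in place of a Gronwall inequality. *)
Lemma mild_contraction w y1 y2 Y1 Y2 t :
  mild_solution D B S g eps x w y1 Y1 -> mild_solution D B S g eps x w y2 Y2 ->
  0 <= t -> `|Y1 t - Y2 t| <= expR (- k * t) * `|y1 - y2|.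
Proof.
move=> [c1 s1] [c2 s2] t0.
pose f r := expR (k * r) * `|Y1 r - Y2 r|.
have cf : {within `[0, t], continuous f}.
  move=> r; apply: cvgM.
    by apply: continuous_subspaceT; exact: continuous_expRM.
  by apply: cvg_norm; apply: cvgB; [exact: (within_itv c1)|exact: (within_itv c2)].
have [c] := EVT_max t0 cf; rewrite in_itv/= => /andP[cge0 ct] fmax.
suff fc : f c <= `|y1 - y2|.
  have := fmax t; rewrite in_itv/= lexx t0 => /(_ isT) ftc.
  have : f t <= `|y1 - y2| := le_trans ftc fc.
  by rewrite /f -ler_pdivlMl ?expR_gt0// -expRN mulNr.
have [I1 [I2 [h1 h2 _ e1]]] := s1 c cge0.
have [J1 [J2 [h1' h2' _ e2]]] := s2 c cge0.
have I12 : I2 = J2 := bochner_unique hip (itv0_measurable c) h2 h2'.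
set M := f c; pose b := C1 / eps; have b0 : 0 < b by rewrite divr_gt0.
have M0 : 0 <= M by rewrite mulr_ge0 ?expR_ge0.
have dI : `|I1 - J1| <= C1 * M * expR (- k * c) * ((1 - expR (- b * c)) / b).
  apply: (bochner_dist_le hip (itv0_measurable c) (m := fun r =>
    C1 * M * expR (- k * c) * expR (- b * (c - r))) h1 h1').
    move=> r; rewrite /= in_itv/= => /andP[r0 rc].
    have cr : 0 <= (c - r) / eps by rewrite divr_ge0 ?subr_ge0// ltW.
    rewrite -linearB; apply: le_trans (Sexp _ cr) _.
    have fr : `|Y1 r - Y2 r| <= expR (- k * r) * M.
      have := fmax r; rewrite in_itv/= r0 (le_trans rc ct) => /(_ isT).
      by rewrite {1}/f mulrC -ler_pdivlMr ?expR_gt0// -expRN mulNr mulrC.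
    have gr : `|g x (Y1 r) - g x (Y2 r)| <= C1 * (expR (- k * r) * M).
      by apply: le_trans (hg _ _ _ _) _; rewrite subrr normr0 add0r ler_pM2l.
    apply: le_trans (ler_wpM2l (expR_ge0 _) gr) _.
    (* As lB / eps = k + b, the decay of the semigroup splits into the rate to be proved and a
       factor of rate b, which is integrated. *)
    have E : expR (- lB * ((c - r) / eps)) * expR (- k * r) =
        expR (- k * c) * expR (- b * (c - r)).
      by rewrite -!expRD; congr expR; rewrite /b; field; rewrite gt_eqF.
    rewrite [leLHS](_ : _ = C1 * M * (expR (- lB * ((c - r) / eps)) * expR (- k * r))).
      by rewrite E mulrA.
    by ring.
  under eq_integral do rewrite EFinM.
  rewrite ge0_integralZl_EFin//.
  - by rewrite (integral_expR_itvcc (lt0r_neq0 b0) cge0).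
  - apply/measurable_EFinP; apply: measurable_funS (_ : measurable_fun setT _) => //.
    by apply: measurableT_comp => //; apply: measurable_funM => //; exact: measurable_sub.
  - by rewrite !mulr_ge0 ?expR_ge0// ltW.
have dc : `|Y1 c - Y2 c| <= expR (- lB * (c / eps)) * `|y1 - y2| +
    M * expR (- k * c) * (1 - expR (- b * c)).
  have -> : Y1 c - Y2 c = S (c / eps) (y1 - y2) + eps^-1 *: (I1 - J1).
    have A (X Z z : V) : X + z - (Z + z) = X - Z.
      by rewrite opprD addrACA subrr addr0.
    by rewrite e1 e2 I12 !A linearB scalerBr opprD addrACA.
  apply: le_trans (ler_normD _ _) _; apply: lerD.
    by apply: Sexp; rewrite divr_ge0// ltW.
  rewrite normrZ gtr0_norm ?invr_gt0// ler_pdivrMl//; apply: le_trans dI _.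
  rewrite le_eqVlt; apply/orP; left; apply/eqP.
  by rewrite /b; field; rewrite !gt_eqF.
have : M <= expR (- b * c) * `|y1 - y2| + M * (1 - expR (- b * c)).
  rewrite {1}/M /f -ler_pdivlMl ?expR_gt0// -expRN; apply: le_trans dc _.
  rewrite le_eqVlt; apply/orP; left; apply/eqP.
  have -> : expR (- lB * (c / eps)) = expR (- (k * c)) * expR (- b * c).
    by rewrite -expRD; congr expR; rewrite /b; field; rewrite gt_eqF.
  by rewrite (mulNr k c); ring.
rewrite -subr_ge0 (_ : _ - M = expR (- b * c) * (`|y1 - y2| - M)); last by ring.
by rewrite pmulr_rge0 ?expR_gt0// subr_ge0.
Qed.

(** Where |Y| takes its maximum M, the mild form gives M <= (C1 (|x| + M) + C2) / lB + Nb, and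
    [C1 < lB] allows solving for M. That time is unknown, so [Nb] must bound the noise on the whole
    interval. *)
Lemma mild_growth w Y t Nb : mild_solution D B S g eps x w 0 Y -> 0 <= t ->
  (forall r I2, 0 <= r <= t ->
    is_bochner `[0, r]%classic (fun s => S ((r - s) / eps) (w (s / eps))) I2 -> D I2 ->
    `|w (r / eps) + eps^-1 *: B I2| <= Nb) ->
  `|Y t| <= (C1 * `|x| + C2 + lB * Nb) / (lB - C1).
Proof.
move=> [cY sY] t0 hN.
have cf : {within `[0, t], continuous (fun r => `|Y r|)}.
  by move=> r; apply: cvg_norm; exact: (within_itv cY).
have [c] := EVT_max t0 cf; rewrite in_itv/= => /andP[cge0 ct] fmax.
have := fmax t; rewrite in_itv/= lexx t0 => /(_ isT) ftc.
apply: le_trans ftc _; set M := `|Y c|.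
have [I1 [I2 [h1 h2 DI2 e1]]] := sY c cge0.
have N1 : `|w (c / eps) + eps^-1 *: B I2| <= Nb by apply: hN => //; rewrite cge0.
pose b := lB / eps; have b0 : 0 < b by rewrite divr_gt0.
pose a := C1 * (`|x| + M) + C2.
have a0 : 0 <= a.
  rewrite /a hC2; apply: addr_ge0; last exact: normr_ge0.
  by apply: mulr_ge0; [exact: ltW|rewrite addr_ge0 ?normr_ge0].
have dI : `|I1 - 0| <= a * b^-1.
  apply: (bochner_dist_le hip (itv0_measurable c) (m := fun r =>
    a * expR (- b * (c - r))) h1 (is_bochner0 _)).
    move=> r; rewrite /= in_itv/= => /andP[r0 rc]; rewrite subr0.
    have cr : 0 <= (c - r) / eps by rewrite divr_ge0 ?subr_ge0// ltW.
    apply: le_trans (Sexp _ cr) _; rewrite mulrC.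
    rewrite (_ : - lB * ((c - r) / eps) = - b * (c - r)); last first.
      by rewrite /b; field; rewrite gt_eqF.
    apply: ler_wpM2r; first exact: expR_ge0.
    rewrite -[X in `|X|](subrK (g 0 0)) /a hC2.
    apply: le_trans (ler_normD _ _) _; rewrite lerD2r.
    apply: le_trans (hg _ _ _ _) _; rewrite !subr0 ler_pM2l// lerD2l.
    by apply: fmax; rewrite in_itv/= r0 (le_trans rc ct).
  under eq_integral do rewrite EFinM.
  rewrite ge0_integralZl_EFin//.
  - rewrite (integral_expR_itvcc (lt0r_neq0 b0) cge0) -EFinM lee_fin.
    by apply: ler_wpM2l => //; rewrite -[leRHS]mul1r ler_pM2r ?invr_gt0// gerBl expR_ge0.
  - apply/measurable_EFinP; apply: measurable_funS (_ : measurable_fun setT _) => //.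
    by apply: measurableT_comp => //; apply: measurable_funM => //; exact: measurable_sub.
have MM : M <= a / lB + Nb.
  rewrite /M e1 linear0 add0r -addrA; apply: le_trans (ler_normD _ _) _.
  apply: lerD => //; rewrite normrZ gtr0_norm ?invr_gt0// ler_pdivrMl//.
  rewrite -[I1]subr0; apply: le_trans dI _; rewrite le_eqVlt; apply/orP; left.
  by apply/eqP; rewrite /b; field; rewrite !gt_eqF.
rewrite ler_pdivlMr ?subr_gt0//.
move: MM; rewrite -(ler_pM2r lB0) mulrDl divfK ?gt_eqF// /a -subr_ge0 => MM.
by rewrite -subr_ge0; move: MM; congr (0 <= _); ring.
Qed.

(** Linear growth of the centre along the shift costs half of the rate k in the exponential weight;
    the factor 2 / k is the integral of the other half. *)
Lemma radius_bound G w C : 0 < G -> 0 <= C ->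
  (forall r, `|Zst B S eps (vtheta eps r w)| <= G * (1 + C * (1 + `|r / eps|))) ->
  (Defs.radius B S eps x lB C1 C2 w <=
    (2 * (eps^-1 * (C1 * (G + `|x|) + C2)) * (1 + 2 / (lB - C1)) *
      (2 / k) * (1 + C))%:E)%E.
Proof.
move=> G0 C0 hZ; have C20 : 0 <= C2 by rewrite hC2.
set a := eps^-1 * _; set be := 1 + 2 / _.
have k0 := rate_gt0; have lC : 0 < lB - C1 by rewrite subr_gt0.
have a0 : 0 <= a.
  by rewrite mulr_ge0 ?invr_ge0 ?(ltW eps0)// addr_ge0// mulr_ge0 ?addr_ge0// ltW.
have be0 : 0 <= be by rewrite addr_ge0// divr_ge0// ltW.
rewrite /Defs.radius.
have -> : 2 * a * be * (2 / k) * (1 + C) = 2 * (a * (1 + C) * be * (2 / k)) by ring.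
rewrite EFinM; apply: lee_wpmul2l => //.
have e2 : 0 < k / 2 by rewrite divr_gt0.
have c1 : 1 <= 1 + C by rewrite lerDl.
apply: (@le_trans _ _ (\int[mu]_(r in `]-oo, 0%R])
   ((a * (1 + C) * be)%:E * (expR (- (k / 2) * (0 - r)))%:E))%E).
  apply: ge0_le_integral_nomeas => r rle.
    rewrite lee_fin mulr_ge0 ?expR_ge0// mulr_ge0 ?invr_ge0 ?(ltW eps0)//.
    by rewrite addr_ge0// mulr_ge0 ?addr_ge0// ltW.
  rewrite -EFinM lee_fin sub0r.
  have r1 : 1 <= 1 + `|r / eps| by rewrite lerDl.
  have cr : 1 <= (1 + C) * (1 + `|r / eps|) by rewrite mulr_ege1.
  have i1 : eps^-1 * (C1 * (`|Zst B S eps (vtheta eps r w)| + `|x|) + C2) <=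
      a * ((1 + C) * (1 + `|r / eps|)).
    rewrite /a -[leRHS]mulrA ler_pM2l ?invr_gt0// mulrDl; apply: lerD; last by rewrite ler_peMr.
    rewrite -[leRHS]mulrA ler_pM2l// mulrDl; apply: lerD; last by rewrite ler_peMr.
    apply: le_trans (hZ r) _; rewrite ler_pM2l// mulrDl mul1r.
    by rewrite lerD2r.
  have r0 : 0 <= - r by rewrite oppr_ge0; move: rle; rewrite /= in_itv.
  have i2 : 1 + `|r / eps| <= be * expR (k / 2 * - r).
    rewrite normrM normfV (gtr0_norm eps0) -normrN (ger0_norm r0).
    apply: (@le_trans _ _ (be * (1 + k / 2 * - r))); last first.
      by apply: ler_wpM2l => //; exact: expR_ge1Dx.
    rewrite -subr_ge0 (_ : _ - _ = 2 / (lB - C1) + k / 2 * - r); last first.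
      by rewrite /be; field; rewrite !gt_eqF.
    by apply: addr_ge0; [rewrite divr_ge0// ltW|rewrite mulr_ge0// ltW].
  apply: le_trans (ler_wpM2l (expR_ge0 _) i1) _.
  apply: le_trans (ler_wpM2l (expR_ge0 _) (ler_wpM2l a0 (ler_wpM2l (le_trans ler01 c1) i2))) _.
  have E : expR (- (k / 2) * - r) = expR ((lB - C1) * r / eps) * expR (k / 2 * - r).
    by rewrite -expRD; congr expR; field; rewrite gt_eqF.
  by rewrite E le_eqVlt; apply/orP; left; apply/eqP; ring.
have mE : measurable_fun setT (fun s : R => (expR (- (k / 2) * s))%:E).
  by apply/measurable_EFinP; apply: measurableT_comp => //; exact: measurable_funM.
rewrite ge0_integralZl_EFin//; last 2 first.
- apply: measurable_funS (_ : measurable_fun setT _) => //.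
  by apply: (measurableT_comp mE); exact: measurable_sub.
- by apply: mulr_ge0 => //; apply: mulr_ge0 => //; exact: le_trans c1.
rewrite (@ge0_integral_reflect _ 0 (fun s => (expR (- (k / 2) * s))%:E) mE); last first.
  by move=> s; rewrite lee_fin expR_ge0.
by rewrite integral_expR_itvcy// -EFinM lee_fin invf_div.
Qed.

End Solutions.

(** * The pullback attractor *)

Section Sequences.
Context {R : realType}.

Lemma geometric_cvg (V : completeNormedModType R) (u : nat -> V) a rho :
  0 <= rho < 1 -> (forall n, `|u n.+1 - u n| <= a * rho ^+ n) ->
  exists2 y, u n @[n --> \oo] --> y & forall n, `|y - u n| <= a / (1 - rho) * rho ^+ n.
Proof.
move=> /andP[r0 r1] hu; have r1' : 0 < 1 - rho by rewrite subr_gt0.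
have a0 : 0 <= a by have := hu 0%N; rewrite expr0 mulr1; exact: le_trans.
have c0 : 0 <= a / (1 - rho) by rewrite divr_ge0// ltW.
have dist n m : `|u (n + m)%N - u n| <= a / (1 - rho) * (rho ^+ n - rho ^+ (n + m)).
  elim: m => [|m IH]; first by rewrite addn0 !subrr normr0 mulr0.
  rewrite -(subrK (u (n + m)%N) (u _)) -addrA.
  apply: le_trans (ler_normD _ _) _; rewrite addnS.
  apply: le_trans (lerD (hu _) IH) _.
  rewrite le_eqVlt; apply/orP; left; apply/eqP; rewrite exprS.
  by field; rewrite gt_eqF.
have dist' n m : `|u (n + m)%N - u n| <= a / (1 - rho) * rho ^+ n.
  apply: le_trans (dist n m) _; rewrite ler_wpM2l// lerBlDr lerDl.
  exact: exprn_ge0.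
have rc : a / (1 - rho) * rho ^+ n @[n --> \oo] --> 0.
  rewrite -(mulr0 (a / (1 - rho))); apply: cvgM; first exact: cvg_cst.
  by apply: cvg_expr; rewrite ger0_norm.
have uc : cvg (u n @[n --> \oo]).
  apply/cauchy_cvgP/cauchy_exP => eps eps0.
  have [N _ hN] := cvgr_lt 0 rc eps eps0.
  exists (u N); exists N => // m /= Nm; rewrite -ball_normE /= distrC.
  rewrite -(subnKC Nm); apply: le_lt_trans (dist' _ _) _; exact: hN (leqnn N).
case/cvg_ex: uc => y uy; exists y => // n.
have h : `|u (n + m)%N - u n| @[m --> \oo] --> `|y - u n|.
  apply: cvg_norm; apply: cvgB; last exact: cvg_cst.
  have -> : (fun m => u (n + m)%N) = (fun m => u (m + n)%N).
    by apply/funext => m; rewrite addnC.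
  by rewrite (cvg_shiftn n u).
exact: (cvg_le_cst h).
Qed.

Lemma linear_expR_bound (k t : R) : 0 < k -> 0 <= t ->
  (1 + t) <= (1 + 2 / k) * expR (k / 2 * t).
Proof.
move=> k0 t0; apply: (@le_trans _ _ ((1 + 2 / k) * (1 + k / 2 * t))); last first.
  by rewrite ler_wpM2l ?expR_ge1Dx// addr_ge0// divr_ge0// ltW.
rewrite -subr_ge0 (_ : _ - _ = 2 / k + k / 2 * t); last by field; rewrite gt_eqF.
by apply: addr_ge0; [rewrite divr_ge0// ltW|rewrite mulr_ge0// divr_ge0// ltW].
Qed.

Lemma expR_linear_le (k t : R) : 0 < k -> 0 <= t ->
  expR (- k * t) * (1 + t) <= (1 + 2 / k) * expR (- (k / 2) * t).
Proof.
move=> k0 t0; apply: le_trans (ler_wpM2l (expR_ge0 _) (linear_expR_bound k0 t0)) _.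
have -> : expR (- (k / 2) * t) = expR (- k * t) * expR (k / 2 * t).
  by rewrite -expRD; congr expR; field.
by rewrite mulrCA.
Qed.

Lemma expR_linear_cvg0 (k c : R) (f : R -> R) : 0 < k ->
  (\forall t \near +oo, 0 <= f t <= c * (expR (- k * t) * (1 + t))) ->
  f t @[t --> +oo] --> 0.
Proof.
move=> k0 hf.
have h1 : `|c| * ((1 + 2 / k) * expR (- (k / 2) * t)) @[t --> +oo] --> 0.
  rewrite -[X in _ --> X](mulr0 `|c|); apply: cvgM; first exact: cvg_cst.
  rewrite -[X in _ --> X](mulr0 (1 + 2 / k)); apply: cvgM; first exact: cvg_cst.
  have -> : (fun t => expR (- (k / 2) * t)) = (fun r => expR (- r)) \o (fun t => k / 2 * t).
    by apply/funext => r /=; rewrite mulNr.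
  apply: (cvg_comp (fun t => k / 2 * t) (fun r => expR (- r))); last exact: cvgr_expR.
  by apply: gt0_cvgMry; [rewrite divr_gt0|exact: cvg_id].
apply: (@squeeze_cvgr _ _ _ _ (cst 0) _ _ _ _ _ h1); last exact: cvg_cst.
near=> t; have t0 : 0 <= t by near: t; exact: nbhs_pinfty_ge.
have /andP[-> h] : 0 <= f t <= c * (expR (- k * t) * (1 + t)) by near: t.
rewrite /=; apply: le_trans h _; apply: (@le_trans _ _ (`|c| * (expR (- k * t) * (1 + t)))).
  by rewrite ler_wpM2r ?ler_norm// mulr_ge0 ?expR_ge0// addr_ge0.
by rewrite ler_wpM2l// expR_linear_le.
Unshelve. all: by end_near. Qed.

(** From ln z = 2 ln (sqrt z) <= 2 sqrt z, linear growth of z gives a logarithm of order at most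
    sqrt |t|. *)
Lemma log_plus_sublinear (a : R) (t : R -> R) (z : R -> R) (F : set_system R)
    {FF : Filter F} : 0 < a ->
  (forall M, \forall r \near F, M <= `|t r|) ->
  (forall r, 0 <= z r <= a * (1 + `|t r|)) ->
  (log_plus (z r) / `|t r|) @[r --> F] --> 0.
Proof.
move=> a0 tinf hz; apply/cvgrPdist_le => eps eps0.
(* Beyond [M] one has 4 z <= 8 a T <= (eps T)^2, the first inequality because 1 <= T. *)
pose M := 1 + 8 * (1 + a) / eps ^+ 2.
have e2 : 0 < eps ^+ 2 by rewrite exprn_gt0.
have M1 : 1 <= M by rewrite lerDl divr_ge0 ?(ltW e2)// mulr_ge0// addr_ge0// ltW.
apply: filterS (tinf M) => r Mr; rewrite sub0r normrN.
set T := `|t r| in Mr *; have T1 : 1 <= T := le_trans M1 Mr.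
have T0 : 0 < T := lt_le_trans ltr01 T1.
have lp0 : 0 <= log_plus (z r) by rewrite /log_plus le_max lexx.
rewrite ger0_norm ?divr_ge0 ?(ltW T0)// ler_pdivrMr//.
rewrite /log_plus ge_max mulr_ge0 ?(ltW eps0) ?(ltW T0)//=.
have /andP[z0 zle] := hz r.
move: z0; rewrite le_eqVlt => /predU1P[<-|z0].
  by rewrite ln0// mulr_ge0 ?(ltW eps0) ?(ltW T0).
have s0 : 0 < Num.sqrt (z r) by rewrite sqrtr_gt0.
have -> : ln (z r) = 2 * ln (Num.sqrt (z r)).
  by rewrite -{1}(sqr_sqrtr (ltW z0)) expr2 lnM ?posrE// -mulr2n mulr_natl.
have lns : ln (Num.sqrt (z r)) <= Num.sqrt (z r) by apply: ltW; exact: ln_sublinear.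
apply: (@le_trans _ _ (2 * Num.sqrt (z r))); first by rewrite ler_pM2l.
rewrite -(@ler_pXn2r _ 2) ?nnegrE ?mulr_ge0 ?sqrtr_ge0 ?(ltW eps0) ?(ltW T0)//.
rewrite exprMn sqr_sqrtr ?(ltW z0)//.
have zT : z r <= 2 * a * T.
  apply: le_trans zle _; rewrite (_ : 2 * a * T = a * (T + T)); last by ring.
  by rewrite ler_pM2l// lerD2r.
apply: (@le_trans _ _ (8 * (1 + a) * T)).
  apply: (@le_trans _ _ (2 ^+ 2 * (2 * a * T))); first by rewrite ler_pM2l// exprn_gt0.
  rewrite -subr_ge0 (_ : _ - _ = 8 * T); last by ring.
  by rewrite mulr_ge0// ltW.
rewrite exprMn [T ^+ 2]expr2 mulrA ler_pM2r//.
rewrite [leRHS]mulrC -ler_pdivrMr//; apply: le_trans Mr; rewrite /M lerDr//.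
Qed.
End Sequences.

Section Shift.
Context {R : realType} {V : normedModType R} {gam : R}.
Implicit Types w : hpath V gam.

Lemma hpath_eq w1 w2 : (forall t, w1 t = w2 t) -> w1 = w2.
Proof.
case: w1 => f1 a1 b1; case: w2 => f2 a2 b2 /= /funext h; subst f2.
by congr Path; exact: Prop_irrelevance.
Qed.

Lemma theta0 w : theta 0 w = w.
Proof. by apply: hpath_eq => r /=; rewrite addr0 path_fun0 subr0. Qed.

Lemma thetaD s t w : theta s (theta t w) = theta (s + t) w.
Proof.
by apply: hpath_eq => r /=; rewrite opprB addrA subrK addrA.
Qed.

Lemma vthetaD (eps s t : R) w : vtheta eps s (vtheta eps t w) = vtheta eps (s + t) w.
Proof. by rewrite /vtheta thetaD mulrDl. Qed.

Lemma vtheta0 eps w : vtheta eps 0 w = w.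
Proof. by rewrite /vtheta mul0r theta0. Qed.
End Shift.

Section FullInvariant.
Context {R : realType} {V : completeNormedModType R} {gam : R}.
Variable P : probability (hpath V gam) R.

Lemma full_invariantI (A A' : set (hpath V gam)) :
  full_invariant P A -> full_invariant P A' -> full_invariant P (A `&` A').
Proof.
move=> [mA PA iA] [mA' PA' iA']; split.
- exact: measurableI.
- have mI : measurable (A `&` A') by exact: measurableI.
  have h0 : P (~` (A `&` A')) = 0%E.
    apply/eqP; rewrite eq_le measure_ge0 andbT setCI.
    apply: (@le_trans _ _ (P (~` A) + P (~` A'))%E).
      by apply: measureU2; exact: measurableC.
    by rewrite !probability_setC// PA PA' subee// adde0.
  rewrite -(setCK (A `&` A')) probability_setC; last exact: measurableC.
  by rewrite h0 sube0.
- by move=> t; rewrite preimage_setI iA iA'.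
Qed.

Lemma full_invariant_theta A t w : full_invariant P A -> A w -> A (theta t w).
Proof. by move=> [_ _ iA] Aw; have : (theta t @^-1` A) w by rewrite iA. Qed.
End FullInvariant.

(** * Borel measurability in a separable space *)

Section BorelMeasurability.
Context {R : realType} {V : completeNormedModType R}.

Lemma separable_seq : separable V ->
  exists d : nat -> V, forall v (e : R), 0 < e -> exists n, `|v - d n| < e.
Proof.
move=> [A /countable_injP[f injf] dA].
(* The dense set is listed through an injection into nat; an index that is not attained gets the
   value 0. *)
exists (fun n => xget 0 [set v | A v /\ f v = n]) => v e e0.
have [u [/= vu Au]] : ball v e `&` A !=set0.
  by apply: dA; [exists v; exact: ballxx|exact: ball_open].
exists (f u).
have := @xgetPex V 0 [set v | A v /\ f v = f u].
case=> [|Ax fx]; first by exists u.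
have -> : xget 0 [set v0 | A v0 /\ f v0 = f u] = u.
  by apply: injf => //; rewrite inE.
by move: vu; rewrite -ball_normE.
Qed.

Lemma measurable_funV d (T : measurableType d) (X : T -> V) :
  (forall U : set V, open U -> measurable (X @^-1` U)) ->
  measurable_fun setT (X : T -> borel V).
Proof.
move=> h; apply: (@measurability _ _ T (borel V) setT X (@open V : set (set (borel V)))) => // _ [U oU <-].
by rewrite setTI; exact: h.
Qed.

Lemma measurable_preimage_open d (T : measurableType d) (X : T -> V) (U : set V) :
  measurable_fun setT (X : T -> borel V) -> open U -> measurable (X @^-1` U).
Proof.
move=> mX oU; rewrite -[X in measurable X]setTI; apply: mX => //.
exact: sub_sigma_algebra.
Qed.

Lemma open_norm_gt c : open [set v : V | c < `|v|].
Proof.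
have -> : [set v : V | c < `|v|] = Num.norm @^-1` [set x : R | c < x] by [].
apply: open_comp; last exact: open_gt.
by move=> v _; exact: norm_continuous.
Qed.

Lemma measurable_norm_le d (T : measurableType d) (X : T -> V) c :
  measurable_fun setT (X : T -> borel V) -> measurable [set t | `|X t| <= c].
Proof.
move=> mX; have -> : [set t | `|X t| <= c] = ~` (X @^-1` [set v | c < `|v|]).
  by apply/seteqP; split => t /=; rewrite leNgt => /negP.
by apply: measurableC; apply: measurable_preimage_open => //; exact: open_norm_gt.
Qed.

(** Separability makes the preimage of an open set a countable union of rectangles: pairs of balls
    of radius 1/(m+1), centred in a dense sequence, whose differences stay in [U]. *)
Lemma measurable_subV d (T : measurableType d) (X Y : T -> V) : separable V ->
  measurable_fun setT (X : T -> borel V) -> measurable_fun setT (Y : T -> borel V) ->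
  measurable_fun setT ((fun t => X t - Y t) : T -> borel V).
Proof.
move=> /separable_seq[s hs] mX mY; apply: measurable_funV => U oU.
pose good (i j m : nat) := forall p q : V, `|s i - p| < m.+1%:R^-1 ->
  `|s j - q| < m.+1%:R^-1 -> U (p - q).
pose F (k : nat * nat * nat) : set T := [set t | good k.1.1 k.1.2 k.2 /\
   ball (s k.1.1) k.2.+1%:R^-1 (X t) /\ ball (s k.1.2) k.2.+1%:R^-1 (Y t)].
have -> : (fun t => X t - Y t) @^-1` U = \bigcup_k F k.
  apply/seteqP; split => t /=; last first.
    by move=> [[[i j] m] _ [gd []]]; rewrite -!ball_normE; exact: gd.
  move=> Ut; have /nbhs_ballP[e /= e0 he] : nbhs (X t - Y t) U by exact: open_nbhs_nbhs.
  pose m := Num.truncn (4 / e).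
  have m0 : 0 < m.+1%:R^-1 :> R by rewrite invr_gt0.
  (* The two differences are separated by four distances below the radius. *)
  have me : m.+1%:R^-1 < e / 4.
    by rewrite invf_plt ?posrE// ?divr_gt0// invf_div truncnS_gt.
  have [i hi] := hs (X t) _ m0; have [j hj] := hs (Y t) _ m0.
  exists ((i, j), m) => //; split => /=; last by rewrite -!ball_normE /= distrC hi distrC hj.
  move=> p q hp hq; apply: he; rewrite -ball_normE /=.
  have -> : X t - Y t - (p - q) = (X t - s i) + (s i - p) - ((Y t - s j) + (s j - q)).
    have tele a b c : (a - b) + (b - c) = a - c :> V by rewrite addrA subrK.
    by rewrite !tele !opprD !opprK addrACA.
  apply: le_lt_trans (ler_normB _ _) _.
  apply: (@lt_le_trans _ _ ((e / 4 + e / 4) + (e / 4 + e / 4))).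
    by apply: ltrD; apply: le_lt_trans (ler_normD _ _) _; apply: ltrD; apply: lt_trans me.
  by rewrite le_eqVlt; apply/orP; left; apply/eqP; field.
apply: countable_bigcupT_measurable => [|[[i j] m]]; first exact: countableP.
have [gd|ngd] := pselect (good i j m); last first.
  by rewrite (_ : F _ = set0)//; apply/seteqP; split => t // -[].
rewrite (_ : F _ = X @^-1` ball (s i) m.+1%:R^-1 `&` Y @^-1` ball (s j) m.+1%:R^-1).
  by apply: measurableI; apply: measurable_preimage_open => //; exact: ball_open.
by apply/seteqP; split => t [].
Qed.

(** [C m] is the open neighbourhood of radius 1/(m+1) of the complement of [U]; the limit lies in
    [U] exactly when the sequence eventually avoids some [C m]. *)
Lemma measurable_cvgV d (T : measurableType d) (X : nat -> T -> V) (Y : T -> V) :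
  (forall n, measurable_fun setT (X n : T -> borel V)) ->
  (forall t, X n t @[n --> \oo] --> Y t) ->
  measurable_fun setT (Y : T -> borel V).
Proof.
move=> mX XY; apply: measurable_funV => U oU.
pose C m : set V := \bigcup_(u in ~` U) ball u m.+1%:R^-1.
have oC m : open (C m).
  by apply: bigcup_open => u _; exact: ball_open.
have -> : Y @^-1` U = \bigcup_m \bigcup_N \bigcap_(n in [set n | (N <= n)%N]) (X n @^-1` (~` C m)).
  apply/seteqP; split => t /=.
    move=> Ut; have /nbhs_ballP[e /= e0 he] : nbhs (Y t) U by exact: open_nbhs_nbhs.
    pose m := Num.truncn (2 / e).
    have me : m.+1%:R^-1 < e / 2.
      by rewrite invf_plt ?posrE// ?divr_gt0// invf_div truncnS_gt.
    have e2 : 0 < e / 2 by rewrite divr_gt0.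
    have /cvgrPdist_lt /(_ _ e2)[N _ hN] := XY t.
    exists m => //; exists N => // n Nn /= [u nUu]; rewrite -ball_normE /= => uX.
    apply: nUu; apply: he; rewrite -ball_normE /= -(subrK (X n t) (Y t)) -addrA.
    apply: le_lt_trans (ler_normD _ _) _; rewrite [e]splitr ltrD//.
      exact: hN.
    by rewrite distrC; apply: lt_trans me.
  move=> [m _ [N _ hN]]; apply: contrapT => nU.
  have m0 : 0 < m.+1%:R^-1 :> R by rewrite invr_gt0.
  have /cvgrPdist_lt /(_ _ m0)[N' _ hN'] := XY t.
  apply: (hN (maxn N N')); first by rewrite /= leq_maxl.
  exists (Y t) => //; rewrite -ball_normE /=; apply: hN'; exact: leq_maxr.
apply: bigcupT_measurable => m; apply: bigcupT_measurable => N.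
apply: bigcap_measurable; first by exists N => /=.
move=> n _; rewrite preimage_setC; apply: measurableC.
exact: (measurable_preimage_open (mX n) (oC m)).
Qed.

Lemma measurable_ifV d (T : measurableType d) (A : set T) (X : T -> V) :
  measurable A -> measurable_fun setT (X : T -> borel V) ->
  measurable_fun setT ((fun t => if t \in A then X t else 0) : T -> borel V).
Proof.
move=> mA mX; apply: measurable_funV => U oU.
have mXU := measurable_preimage_open mX oU.
have E : (fun t => if t \in A then X t else 0) @^-1` U =
   (A `&` X @^-1` U) `|` (~` A `&` [set t | U 0]).
  apply/seteqP; split => t /=; have [At|nAt] := pselect (A t);
    rewrite ?(mem_set At) ?(memNset nAt).
  - by left.
  - by right.
  - by case=> -[].
  - by case=> -[].
rewrite E; apply: measurableU; first exact: measurableI.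
have [U0|nU0] := pselect (U 0).
  by rewrite (_ : [set _ | _] = setT) ?setIT; [exact: measurableC|apply/seteqP; split].
by rewrite (_ : [set _ | _] = set0) ?setI0//; apply/seteqP; split.
Qed.
End BorelMeasurability.

Section PathMeasurability.
Context {R : realType} {V : completeNormedModType R} {gam : R}.
Hypothesis hsep : separable V.
Local Notation Omega := (hpath V gam).

Lemma measurable_eval (t : R) : measurable_fun setT ((fun w : Omega => w t) : Omega -> borel V).
Proof.
by apply: measurable_funV => U oU; apply: sub_sigma_algebra; exists t, U.
Qed.

Lemma measurable_increment (a b : R) :
  measurable_fun setT ((fun w : Omega => w a - w b) : Omega -> borel V).
Proof. by apply: measurable_subV => //; exact: measurable_eval. Qed.

Lemma measurable_theta (t : R) : measurable_fun setT (theta t : Omega -> Omega).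
Proof.
apply: (@measurability _ _ Omega Omega setT _ (@cylinders R V gam)) => //.
move=> _ [_ [s [U oU ->]] <-]; rewrite setTI.
exact: (measurable_preimage_open (measurable_increment (s + t) t) oU).
Qed.
End PathMeasurability.

(** * The pullback limit as an attracting random fixed point *)

Section Attractor.
Context {R : realType} {V : completeNormedModType R} {gam : R}.
Local Notation Omega := (hpath V gam).
Hypothesis hsep : separable V.
Implicit Types w : Omega.
Variables (P : probability Omega R) (eps k al Phi : R) (phi : R -> Omega -> V -> V).
Hypothesis (eps0 : 0 < eps) (k0 : 0 < k) (Phi0 : 0 < Phi).
Hypothesis hrds : is_rds eps phi.
Hypothesis contraction : forall w y1 y2 t, 0 <= t ->
  `|phi t w y1 - phi t w y2| <= expR (- k * t) * `|y1 - y2|.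
Hypothesis growth : forall (w : Omega) C t, 0 <= C -> holder_growth al C w ->
  0 <= t -> `|phi t w 0| <= Phi * (1 + C * (1 + t / eps) ^+ 3).

Definition tame_paths : set Omega := [set w | exists2 C, 0 <= C & holder_growth al C w].
Hypothesis tame_full : full_invariant P tame_paths.

Definition pullback n (w : Omega) : V := phi n%:R (vtheta eps (- n%:R) w) 0.

Lemma holder_growth_vtheta C (w : Omega) t : 0 <= C -> holder_growth al C w ->
  0 <= C * (1 + `|t| / eps) /\ holder_growth al (C * (1 + `|t| / eps)) (vtheta eps t w).
Proof.
move=> C0 hw; have -> : `|t| / eps = `|t / eps| by rewrite normrM normfV (gtr0_norm eps0).
by split; [rewrite mulr_ge0// addr_ge0|exact: holder_growth_theta].
Qed.

(** Collected from [pullback_step] at t = 1: one factor 1 + eps^-1 from the shift, three from the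
    growth bound, 2 from replacing n + 1 by 1 + n, and 1 + 2 / k from halving the rate to absorb 1 +
    n. *)
Definition pull_const := Phi * (1 + eps^-1) ^+ 4 * (1 + 2 / k) * 2.

Lemma pull_const_gt0 : 0 < pull_const.
Proof.
by rewrite !mulr_gt0 ?exprn_gt0 ?addr_gt0 ?divr_gt0 ?invr_gt0.
Qed.

(** This is the distance, after contracting for n units, between two orbits started at 0 and at the
    state reached from 0 in time t; going back n + 1 units enlarges the path constant only linearly.
    With t = 1 it makes the pullbacks Cauchy, with general t it gives their invariance. *)
Lemma pullback_step C w n t : 0 <= C -> holder_growth al C w -> 0 <= t ->
  expR (- k * n%:R) * `|phi t (vtheta eps (- n.+1%:R) w) 0| <=
  Phi * (1 + eps^-1) * (1 + t / eps) ^+ 3 * (1 + C) *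
     (expR (- k * n%:R) * (1 + n%:R)) * 2.
Proof.
move=> C0 hw t0; have [C'0 hw'] := holder_growth_vtheta (- n.+1%:R) C0 hw.
have te0 : 0 <= t / eps by rewrite divr_ge0// ltW.
have t1 : 1 <= (1 + t / eps) ^+ 3 by rewrite exprn_ege1// lerDl.
apply: le_trans (ler_wpM2l (expR_ge0 _) (growth C'0 hw' t0)) _.
rewrite normrN normr_nat.
rewrite [leRHS](_ : _ = expR (- k * n%:R) * (Phi * ((1 + C) *
  ((1 + eps^-1) * ((1 + n%:R) * 2)) * (1 + t / eps) ^+ 3))); last by ring.
apply: ler_wpM2l; first exact: expR_ge0.
rewrite ler_pM2l//.
have n1 : 1 + n.+1%:R / eps <= (1 + eps^-1) * ((1 + n%:R) * 2).
  rewrite -natr1 -subr_ge0.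
  rewrite (_ : _ - _ = 1 + 2 * n%:R + (1 + n%:R) * eps^-1); last by ring.
  by rewrite !addr_ge0// ?mulr_ge0 ?invr_ge0 ?addr_ge0// ltW.
set X := (1 + eps^-1) * _ in n1 *; set T := (1 + t / eps) ^+ 3 in t1 *.
have X1 : 1 <= X by apply: le_trans n1; rewrite lerDl divr_ge0// ltW.
have XT : 1 <= X * T by rewrite mulr_ege1.
rewrite (_ : (1 + C) * X * T = X * T + C * (X * T)); last by ring.
apply: lerD => //.
rewrite -mulrA ler_wpM2l// ler_wpM2r//; exact: le_trans t1.
Qed.

Lemma pullback_cvg C w : 0 <= C -> holder_growth al C w ->
  exists2 y, pullback n w @[n --> \oo] --> y &
    `|y| <= pull_const / (1 - expR (- (k / 2))) * (1 + C).
Proof.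
move=> C0 hw; have [_ phi0 coc] := hrds.
have r1 : expR (- (k / 2)) < 1 by rewrite -expR0 ltr_expR oppr_lt0 divr_gt0.
have rho : 0 <= expR (- (k / 2)) < 1 by rewrite expR_ge0.
have step n : `|pullback n.+1 w - pullback n w| <=
    pull_const * (1 + C) * expR (- (k / 2)) ^+ n.
  (* The first unit of time is split off: both pullbacks are then orbits of length n over the same
     path. *)
  have -> : pullback n.+1 w = phi n%:R (vtheta eps (- n%:R) w)
      (phi 1 (vtheta eps (- n.+1%:R) w) 0).
    have E : 1 - n.+1%:R = - n%:R :> R by rewrite -natr1; ring.
    rewrite /pullback (_ : phi n.+1%:R = phi (n%:R + 1)); last by rewrite natr1.
    by rewrite coc ?ler0n// vthetaD E.
  apply: le_trans (contraction _ _ _ (ler0n _ n)) _; rewrite subr0.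
  apply: le_trans (pullback_step n C0 hw ler01) _.
  apply: (@le_trans _ _ (Phi * (1 + eps^-1) * (1 + 1 / eps) ^+ 3 * (1 + C) *
     ((1 + 2 / k) * expR (- (k / 2) * n%:R)) * 2)).
    rewrite ler_pM2r// ler_wpM2l ?expR_linear_le//.
    by rewrite !mulr_ge0 ?exprn_ge0 ?addr_ge0 ?divr_ge0 ?invr_ge0 ?(ltW eps0) ?(ltW Phi0).
  rewrite mulr_natr expRM_natr div1r /pull_const.
  by rewrite le_eqVlt; apply/orP; left; apply/eqP; ring.
have [y cy hy] := geometric_cvg rho step; exists y => //.
(* The pullback of index 0 is the vector 0, so the distance to it is the norm. *)
have := hy 0%N; rewrite expr0 mulr1 /pullback phi0 subr0.
by rewrite mulrAC.
Qed.

(** Replacing the sequence by 0 off the tame paths makes it converge on every path, as the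
    measurability of a pointwise limit requires. *)
Definition fixed_point (w : Omega) : V := lim (
  (if w \in tame_paths then pullback n w else 0) @[n --> \oo]).

Lemma fixed_point_cvg C w : 0 <= C -> holder_growth al C w ->
  pullback n w @[n --> \oo] --> fixed_point w.
Proof.
move=> C0 hw; have [y cy _] := pullback_cvg C0 hw.
have Aw : w \in tame_paths by rewrite inE; exists C.
by rewrite /fixed_point Aw (cvg_lim _ cy).
Qed.

Lemma fixed_point_le C w : 0 <= C -> holder_growth al C w ->
  `|fixed_point w| <= pull_const / (1 - expR (- (k / 2))) * (1 + C).
Proof.
move=> C0 hw; have [y cy hy] := pullback_cvg C0 hw.
suff -> : fixed_point w = y by [].
by rewrite -(cvg_lim _ (fixed_point_cvg C0 hw))//; exact: cvg_lim.
Qed.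

Lemma measurable_pullback n : measurable_fun setT (pullback n : Omega -> borel V).
Proof.
have [mphi _ _] := hrds.
pose D := [set p : measurableTypeR R * Omega * borel V | 0 <= p.1.1].
have mD : measurable D.
  rewrite (_ : D = (fun p : measurableTypeR R * Omega * borel V => p.1.1) @^-1` `[0, +oo[).
    have mf : measurable_fun setT (fun p : measurableTypeR R * Omega * borel V => p.1.1).
      exact: (measurableT_comp measurable_fst measurable_fst).
    by rewrite -[X in measurable X]setTI; apply: mf => //; exact: measurable_itv.
  by apply/seteqP; split => p /=; rewrite in_itv/= andbT.
apply: (@measurable_comp _ _ _ _ _ _ D (fun p => phi p.1.1 p.1.2 p.2 : borel V) setT
  (fun w : Omega => (n%:R : measurableTypeR R, vtheta eps (- n%:R) w, 0 : borel V))) => //.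
  by move=> _ [w _ <-]; rewrite /D /= ler0n.
apply: measurable_fun_pair; last exact: measurable_cst.
apply: measurable_fun_pair; first exact: measurable_cst.
exact: measurable_theta.
Qed.

Lemma fixed_point_measurable : Defs.random_variable fixed_point.
Proof.
have [mA _ _] := tame_full.
apply: (@measurable_cvgV _ _ _ _ (fun n w => if w \in tame_paths then pullback n w else 0)).
  by move=> n; apply: measurable_ifV => //; exact: measurable_pullback.
move=> w; rewrite /fixed_point; have [Aw|nAw] := pselect (tame_paths w).
  rewrite (mem_set Aw); case: Aw => C C0 hw; have [y cy _] := pullback_cvg C0 hw.
  by rewrite (cvg_lim _ cy).
by rewrite (memNset nAw) lim_cst//; exact: cvg_cst.
Qed.

Lemma fixed_point_invariant w t : tame_paths w -> 0 <= t ->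
  phi t w (fixed_point w) = fixed_point (vtheta eps t w).
Proof.
move=> [C C0 hw] t0; have [_ phi0 coc] := hrds.
have [C'0 hw'] := holder_growth_vtheta t C0 hw.
have c1 := fixed_point_cvg C0 hw; have c2 := fixed_point_cvg C'0 hw'.
have d1 : phi t w (pullback n w) @[n --> \oo] --> phi t w (fixed_point w).
  apply/cvgrPdist_le => e e0; move/cvgrPdist_le : c1 => /(_ _ e0).
  apply: filterS => n; apply: le_trans; apply: le_trans (contraction _ _ _ t0) _.
  by rewrite ler_piMl// -expR0 ler_expR mulNr oppr_le0 mulr_ge0// ltW.
(* Both terms are orbits of the same length over the same path, ending at time t, one started at 0
   and the other at the state reached from 0 in time t. The index is shifted by one to match
   [pullback_step]. *)
have d2 : phi t w (pullback n w) - pullback n (vtheta eps t w) @[n --> \oo] --> (0 : V).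
  rewrite -cvg_shiftS; apply/norm_cvg0P.
  pose K := Phi * (1 + eps^-1) * (1 + t / eps) ^+ 3 * (1 + C) * (1 + 2 / k) * 2.
  have K0 : K * expR (- (k / 2)) ^+ n @[n --> \oo] --> 0.
    rewrite -[X in _ --> X](mulr0 K); apply: cvgM; first exact: cvg_cst.
    by apply: cvg_expr; rewrite ger0_norm ?expR_ge0// -expR0 ltr_expR oppr_lt0 divr_gt0.
  apply: (@squeeze_cvgr _ _ _ _ (cst 0) _ _ _ _ _ K0); last exact: cvg_cst.
  apply: nearW => n; rewrite /= normr_ge0/=.
  have -> : phi t w (pullback n.+1 w) =
      phi n.+1%:R (vtheta eps (- n.+1%:R) (vtheta eps t w))
        (phi t (vtheta eps (- n.+1%:R) w) 0).
    rewrite /pullback -{1}(vtheta0 eps w) -{1}(subrr n.+1%:R) -vthetaD -coc ?ler0n//.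
    by rewrite addrC coc ?ler0n// !vthetaD addrC.
  apply: le_trans (contraction _ _ _ (ler0n _ _)) _; rewrite subr0.
  apply: (@le_trans _ _ (expR (- k * n%:R) * `|phi t (vtheta eps (- n.+1%:R) w) 0|)).
    by rewrite ler_wpM2r// ler_expR !mulNr lerN2 ler_pM2l// ler_nat.
  apply: le_trans (pullback_step n C0 hw t0) _.
  apply: (@le_trans _ _ (Phi * (1 + eps^-1) * (1 + t / eps) ^+ 3 * (1 + C) *
     ((1 + 2 / k) * expR (- (k / 2) * n%:R)) * 2)).
    rewrite ler_pM2r// ler_wpM2l ?expR_linear_le//.
    by rewrite !mulr_ge0 ?exprn_ge0 ?addr_ge0 ?divr_ge0 ?invr_ge0 ?(ltW eps0) ?(ltW Phi0).
  rewrite mulr_natr expRM_natr /K.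
  by rewrite le_eqVlt; apply/orP; left; apply/eqP; ring.
apply/eqP; rewrite -subr_eq0; apply/eqP.
have d3 : phi t w (pullback n w) - pullback n (vtheta eps t w) @[n --> \oo] -->
  phi t w (fixed_point w) - fixed_point (vtheta eps t w) by apply: cvgB.
by rewrite -(cvg_lim _ d3)//; exact: cvg_lim.
Qed.

Lemma tame_vtheta w t : tame_paths w -> tame_paths (vtheta eps t w).
Proof. by move=> Tw; apply: (full_invariant_theta _ tame_full). Qed.

Definition fp_const := pull_const / (1 - expR (- (k / 2))).

Lemma fp_const_gt0 : 0 < fp_const.
Proof.
by rewrite divr_gt0 ?pull_const_gt0// subr_gt0 -expR0 ltr_expR oppr_lt0 divr_gt0.
Qed.

Lemma bound_vtheta (c C t : R) : 0 <= c -> 0 <= C ->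
  c * (1 + C * (1 + `|t| / eps)) <= c * (1 + C) * (1 + eps^-1) * (1 + `|t|).
Proof.
move=> c0 C0; rewrite -!mulrA ler_wpM2l//.
have X1 : 1 + `|t| / eps <= (1 + eps^-1) * (1 + `|t|).
  rewrite -subr_ge0 (_ : _ - _ = `|t| + eps^-1); last by ring.
  by rewrite addr_ge0// invr_ge0 ltW.
have X0 : 1 <= (1 + eps^-1) * (1 + `|t|).
  by apply: le_trans X1; rewrite lerDl divr_ge0// ltW.
rewrite mulrDl mul1r; apply: lerD => //; exact: ler_wpM2l.
Qed.

Lemma fixed_point_tempered : Defs.tempered P eps (fun w => `|fixed_point w|).
Proof.
exists tame_paths => // w [C C0 hw].
have le t : 0 <= `|fixed_point (vtheta eps t w)| <=
    (fp_const * (1 + C) * (1 + eps^-1)) * (1 + `|t|).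
  rewrite normr_ge0/=; have [C'0 hw'] := holder_growth_vtheta t C0 hw.
  apply: le_trans (fixed_point_le C'0 hw') _.
  exact: bound_vtheta (ltW fp_const_gt0) C0.
have c0 : 0 < fp_const * (1 + C) * (1 + eps^-1).
  apply: mulr_gt0; last by rewrite addr_gt0 ?invr_gt0.
  by apply: mulr_gt0; [exact: fp_const_gt0|rewrite ltr_pwDl].
split; apply: (log_plus_sublinear c0 _ le) => M.
- by near=> t; rewrite (le_trans _ (ler_norm t))//; near: t; exact: nbhs_pinfty_ge.
- near=> t; rewrite -normrN (le_trans _ (ler_norm _))// lerNr; near: t.
  by apply: nbhs_ninfty_le; exact: num_real.
Unshelve. all: by end_near. Qed.

Lemma fixed_point_random : random_fixed_point eps P phi fixed_point.
Proof.
split; first exact: fixed_point_measurable.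
by exists tame_paths => // w Aw t t0; exact: fixed_point_invariant.
Qed.

Variables (Cball : Omega -> set V) (Psi : R).
Hypothesis Psi0 : 0 < Psi.
Hypothesis ball_le : forall w C y, 0 <= C -> holder_growth al C w -> Cball w y ->
  `|y| <= Psi * (1 + C).

Lemma fixed_point_exp_attracting : exp_attracting eps P phi Cball fixed_point k.
Proof.
move=> y [_ [A fA hA]]; exists (tame_paths `&` A); first exact: full_invariantI.
move=> w [Tw Aw] kap kk; have [C C0 hw] := Tw.
have dk : 0 < k - kap by rewrite subr_gt0.
pose c := (Psi + fp_const) * (1 + C) * (1 + eps^-1).
(* One estimate serves both convergences: the starting path is the shift of w by s, with s = - t for
   the pullback and s = 0 forward. The initial distance grows at most linearly in t, so every kappa
   below k is allowed. *)
have main (w' : Omega) t s : 0 <= t -> tame_paths w' -> A w' ->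
    `|s| <= t -> w' = vtheta eps s w ->
  0 <= expR (kap * t) * `|phi t w' (y w') - fixed_point (vtheta eps t w')| <=
  c * (expR (- (k - kap) * t) * (1 + t)).
  move=> t0 Tw' Aw' st E; rewrite mulr_ge0 ?expR_ge0//=.
  rewrite -fixed_point_invariant//.
  apply: le_trans (ler_wpM2l (expR_ge0 _) (contraction _ _ _ t0)) _.
  rewrite [leLHS]mulrA -expRD [leRHS]mulrCA (_ : kap * t + - k * t = - (k - kap) * t); last by ring.
  apply: ler_wpM2l; first exact: expR_ge0.
  have [C'0 hw'] := holder_growth_vtheta s C0 hw.
  rewrite -E in hw'.
  apply: le_trans (ler_normB _ _) _.
  apply: le_trans (lerD (ball_le C'0 hw' (hA _ Aw')) (fixed_point_le C'0 hw')) _.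
  rewrite -mulrDl; apply: le_trans (bound_vtheta s _ C0) _.
    by rewrite addr_ge0 ?(ltW Psi0) ?(ltW fp_const_gt0).
  rewrite /c ler_wpM2l ?lerD2l// !mulr_ge0 ?addr_ge0 ?invr_ge0 ?(ltW eps0)//.
    exact: ltW.
  exact: ltW fp_const_gt0.
split; apply: (expR_linear_cvg0 (c := c) dk); near=> t;
  have t0 : 0 <= t by near: t; exact: nbhs_pinfty_ge.
- have := main (vtheta eps (- t) w) t (- t); rewrite vthetaD subrr vtheta0; apply => //.
  + exact: tame_vtheta.
  + exact: (full_invariant_theta _ fA).
  + by rewrite normrN ger0_norm.
- by apply: (main w t 0) => //; rewrite ?normr0 ?vtheta0.
Unshelve. all: by end_near. Qed.

Lemma fixed_point_attracting : attracting eps P phi Cball fixed_point.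
Proof.
move=> y hy; have [A fA h] := fixed_point_exp_attracting hy.
exists A => // w Aw; have [h1 h2] := h w Aw 0 k0.
split; [move: h1|move: h2];
  by under eq_fun do rewrite mul0r expR0 mul1r.
Qed.
End Attractor.

(** * Gaussian tails of the noise *)

Section DensityBound.
Context d {T : measurableType d} {R : realType}.
Variables (mu nu : {measure set T -> \bar R}) (g : T -> \bar R).
Hypothesis mg : measurable_fun setT g.
Hypothesis g0 : forall x, (0 <= g x)%E.
Hypothesis nug : forall A, measurable A -> (nu A <= \int[mu]_(x in A) g x)%E.
Import HBNNSimple.

(** The density bound applies level set by level set to simple functions, and the integral against
    [nu] is their supremum. *)
Lemma ge0_integral_density_le (f : T -> \bar R) (M : \bar R) :
  (forall x, (0 <= f x)%E) ->
  (\int[mu]_x (f x * g x) <= M)%E -> (\int[nu]_x f x <= M)%E.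
Proof.
move=> f0 fM; rewrite ge0_integralTE//; apply: ge_ereal_sup => _ [h hf <-].
apply: le_trans fM; rewrite sintegralE.
have hx x : (h x)%:E = (\sum_(y \in range h) (y * \1_(h @^-1` [set y]) x)%:E)%E.
  by rewrite fsumEFin// -fimfunE.
have term_ge0 (y : R) x : range h y -> (0 <= (y * \1_(h @^-1` [set y]) x)%:E)%E.
  by move=> [z _ <-]; rewrite lee_fin mulr_ge0.
apply: (@le_trans _ _ (\int[mu]_x ((h x)%:E * g x))%E); last first.
  apply: ge0_le_integral_nomeas => x _; first by rewrite mule_ge0// lee_fin.
  by apply: lee_wpmul2r => //; exact: hf.
have mterm (y : R) : measurable_fun setT (fun x => (y * \1_(h @^-1` [set y]) x)%:E).
  by apply/measurable_EFinP; apply: measurable_funM.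
rewrite (eq_integral (fun x => \sum_(y \in range h) (y * \1_(h @^-1` [set y]) x)%:E * g x)%E); last first.
  by move=> x _; rewrite hx ge0_mule_fsuml// => y; exact: nnfun_muleindic_ge0.
rewrite ge0_integral_fsum//; last 2 first.
- by move=> y; apply: emeasurable_funM.
- by move=> y x _; rewrite mule_ge0// nnfun_muleindic_ge0.
apply: lee_fsum => // y [z _ hz].
have y0 : 0 <= y by rewrite -hz.
pose B := h @^-1` [set y]; have mB : measurable B by exact: measurable_sfunP.
rewrite (eq_integral (fun x => y%:E * ((g \_ B) x))%E); last first.
  move=> x _; rewrite EFinM -muleA; congr (_ * _)%E.
  by rewrite patchE indicE; case: ifPn => _; rewrite ?mul1e ?mul0e.
rewrite ge0_integralZl_EFin//; last 2 first.
- by move=> x _; rewrite patchE; case: ifPn.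
- by apply/(measurable_restrictT _ _).1 => //; exact: measurable_funTS.
by rewrite -integral_mkcond; apply: lee_wpmul2l => //; exact: nug.
Qed.
End DensityBound.

Section Gaussian.
Context {R : realType}.
Local Notation mu := (@lebesgue_measure R).

(** As th <= 1 / (4 s^2), the exponential times the density of variance s^2 is at most sqrt 2 times
    the density of variance 2 s^2, which has mass 1. *)
Lemma normal_expR_sqr (s th : R) : 0 < s -> 0 <= th -> th * s ^+ 2 <= 4^-1 ->
  (\int[normal_prob 0 s]_x (expR (th * x ^+ 2))%:E <= (Num.sqrt 2)%:E)%E.
Proof.
move=> s0 th0 ths; have s20 : 0 < s ^+ 2 by rewrite exprn_gt0.
have q2 : 0 < Num.sqrt 2 :> R by rewrite sqrtr_gt0.
pose s' := Num.sqrt 2 * s; have s'0 : s' != 0 by rewrite mulf_neq0 ?gt_eqF.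
have s's : s' ^+ 2 = 2 * s ^+ 2 by rewrite exprMn sqr_sqrtr.
have pdfle x : expR (th * x ^+ 2) * normal_pdf 0 s x <= Num.sqrt 2 * normal_pdf 0 s' x.
  rewrite !normal_pdfE ?(gt_eqF s0)// mulrCA.
  have -> : normal_peak s' = normal_peak s / Num.sqrt 2.
    rewrite /normal_peak s's -mulrnAr -mulrA sqrtrM// invfM mulrC; congr (_ * _).
    by rewrite mulrnAr.
  rewrite [leRHS](_ : _ = normal_peak s * normal_fun 0 s' x); last first.
    by field; rewrite gt_eqF.
  rewrite ler_wpM2l ?normal_peak_ge0// /normal_fun -expRD ler_expR !subr0 s's.
  rewrite -subr_ge0 [X in 0 <= X](_ : _ = x ^+ 2 * (4^-1 - th * s ^+ 2) / s ^+ 2).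
    by rewrite divr_ge0 ?(ltW s20)// mulr_ge0 ?sqr_ge0// subr_ge0.
  by rewrite !mulr2n; field; rewrite !gt_eqF// addr_gt0// mulr_gt0.
apply: (@ge0_integral_density_le _ _ _ mu (normal_prob 0 s)
   (fun x => (normal_pdf 0 s x)%:E)) => //.
  by apply/measurable_EFinP; exact: measurable_normal_pdf.
  by move=> x; rewrite lee_fin normal_pdf_ge0.
apply: (@le_trans _ _ (\int[mu]_x ((Num.sqrt 2)%:E * (normal_pdf 0 s' x)%:E))%E).
  apply: ge0_le_integral_nomeas => x _.
    by rewrite -EFinM lee_fin mulr_ge0 ?expR_ge0 ?normal_pdf_ge0.
  by rewrite -!EFinM lee_fin.
rewrite ge0_integralZl_EFin// ?integral_normal_pdf ?mule1//.
- by move=> x _; rewrite lee_fin normal_pdf_ge0.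
- by apply/measurable_EFinP; exact: measurable_normal_pdf.
Qed.

(** The density is at most 1 / (s sqrt (2 pi)), the interval has length s, and 2 pi >= 4. The centre
    is free because it will be an expectation whose value is left uncomputed. *)
Lemma normal_small_ball (s m : R) : 0 < s ->
  (normal_prob 0 s `](m - s / 2)%R, (m + s / 2)%R[%classic <= (2^-1)%:E)%E.
Proof.
move=> s0; rewrite /normal_prob.
apply: (@le_trans _ _ (\int[mu]_(x in `](m - s / 2)%R, (m + s / 2)%R[) (normal_peak s)%:E)%E).
  apply: ge0_le_integral_nomeas => x _; rewrite lee_fin ?normal_pdf_ge0//.
  by rewrite normal_pdf_ub// gt_eqF.
rewrite integral_cst//= lebesgue_measure_itv/= lte_fin ltrD2l.
have -> : - (s / 2) < s / 2 by rewrite gtrN// divr_gt0.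
rewrite -EFinB -EFinM lee_fin.
have -> : m + s / 2 - (m - s / 2) = s by field.
rewrite /normal_peak mulrC ler_pdivrMr; last first.
  by rewrite sqrtr_gt0 mulrn_wgt0// mulr_gt0 ?exprn_gt0// pi_gt0.
rewrite mulrC ler_pdivlMr// mulrC.
have s2 : 0 <= 2 * s by rewrite mulr_ge0// ltW.
rewrite -[leLHS](ger0_norm s2) -sqrtr_sqr ler_wsqrtr//.
rewrite -subr_ge0 (_ : _ - _ = 2 * s ^+ 2 * (pi - 2)); last by rewrite mulr2n; ring.
by rewrite mulr_ge0 ?subr_ge0 ?pi_ge2// mulr_ge0// sqr_ge0.
Qed.
End Gaussian.

Section GaussianVariables.
Context {R : realType} {V : completeNormedModType R} {gam : R}.
Local Notation Omega := (hpath V gam).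
Variable P : probability Omega R.

(** The parameter s of the law has to be compared with the covariance v. With probability at least
    1/2 the variable is at distance at least s / 2 from its expectation, whatever that is, so v >=
    s^2 / 8: hence the factor 8, without computing a second moment. *)
Lemma gaussian_expR_sqr (X : Omega -> measurableTypeR R) (v th : R) :
  measurable_fun setT X -> centered_gaussian P X ->
  covariance P X X = v%:E -> 0 <= th -> th * (8 * v) <= 4^-1 ->
  (\int[P]_w (expR (th * X w ^+ 2))%:E <= (Num.sqrt 2)%:E)%E.
Proof.
move=> mX [s s0 law] cov th0 thv.
have mf : measurable_fun setT ((fun x => (expR (th * x ^+ 2))%:E) : measurableTypeR R -> \bar R).
  apply/measurable_EFinP; apply: measurableT_comp => //.
  by apply: measurable_funM => //; exact: measurable_funX.
have -> : (\int[P]_w (expR (th * X w ^+ 2))%:E)%E =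
    (\int[pushforward P X]_x (expR (th * x ^+ 2))%:E)%E.
  by rewrite ge0_integral_pushforward// => x _; rewrite lee_fin expR_ge0.
have sq1 : 1 <= Num.sqrt 2 :> R by rewrite -[leLHS]sqrtr1 ler_wsqrtr// ler1n.
move: s0; rewrite le_eqVlt => /predU1P[s00|s0].
  rewrite (@eq_measure_integral _ _ _ _ (\d_(0 : measurableTypeR R)))//; last first.
    by move=> A mA _; rewrite -s00 in law; have := law A mA; rewrite eqxx.
  by rewrite integral_dirac// diracT mul1e expr0n/= mulr0 expR0 lee_fin.
have law' A : measurable A -> P (X @^-1` A) = normal_prob 0 s A.
  by move=> mA; rewrite law// gt_eqF.
rewrite (@eq_measure_integral _ _ _ _ (normal_prob 0 s))//; last first.
  by move=> A mA _; exact: law'.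
apply: normal_expR_sqr => //; apply: le_trans thv; rewrite ler_wpM2l//.
move: cov; rewrite unlock; set m := fine _ => cov.
pose A : set (measurableTypeR R) := `](m - s / 2), (m + s / 2)[%classic.
have mA : measurable A by exact: measurable_itv.
have mXA : measurable (X @^-1` A).
  by rewrite -[X in measurable X]setTI; exact: mX.
have PA : (P (~` (X @^-1` A)) >= (2^-1)%:E)%E.
  rewrite probability_setC// law'//.
  rewrite (_ : (2^-1)%:E = (1 - (2^-1)%:E)%E :> \bar R); last first.
    by rewrite -EFinB; congr EFin; field.
  by apply: leeB => //; exact: normal_small_ball.
have : ((s ^+ 2 / 4)%:E * (2^-1)%:E <= v%:E)%E.
  apply: (@le_trans _ _ ((s ^+ 2 / 4)%:E * P (~` (X @^-1` A)))%E).
    by apply: lee_wpmul2l => //; rewrite lee_fin divr_ge0// sqr_ge0.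
  rewrite -cov -[X in (_ * P X)%E]setIT -integral_indic//; last exact: measurableC.
  rewrite -ge0_integralZl_EFin//.
  - rewrite unlock; apply: ge0_le_integral_nomeas => w _.
      by rewrite -EFinM lee_fin mulr_ge0// divr_ge0// sqr_ge0.
    rewrite -EFinM lee_fin indicE.
    have [/set_mem|_] := boolP (w \in ~` (X @^-1` A)); last by rewrite mulr0 sqr_ge0.
    rewrite /A /= in_itv/= mulr1 => /negP; rewrite negb_and -!leNgt => hx.
    rewrite -subr_ge0 [X in 0 <= X](_ : _ =
      (X w - m - s / 2) * (X w - m + s / 2)); last by rewrite !fctE/=; field.
    case/orP: hx => hx; first by rewrite mulr_le0// ?subr_le0 //; lra.
    by rewrite mulr_ge0//; lra.
  - by apply/measurable_EFinP; apply: measurable_indic; exact: measurableC.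
  - by rewrite divr_ge0// sqr_ge0.
rewrite -EFinM lee_fin; lra.
Qed.
End GaussianVariables.

(** * Tail of the norm of the noise *)

Section FbmTail.
Context {R : realType} {V : completeNormedModType R} (ip : {dot V for idfun}).
Hypothesis hip : hilbert_norm ip.
Context {gam : R}.
Local Notation Omega := (hpath V gam).
Variables (P : probability Omega R) (H : R) (Q : {linear V -> V}).
Hypothesis H0 : 0 < H.
Hypothesis hP : fbm_law P ip H Q.
Variable e : nat -> V.
Hypothesis eorth : forall n m, n != m -> ip (e n) (e m) = 0.
Hypothesis enorm : forall n, ip (e n) (e n) = 1 \/ e n = 0.
Hypothesis emax : forall v, (forall n, ip v (e n) = 0) -> v = 0.
Variable tau : R.
Local Notation q n := (ip (Q (e n)) (e n)).
Hypothesis q0 : forall n, 0 <= q n.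
Hypothesis qtau : forall N, \sum_(0 <= n < N) q n <= tau.

Lemma measurable_coord t u :
  measurable_fun setT ((fun w : Omega => ip (w t) u) : Omega -> measurableTypeR R).
Proof.
apply: (@measurability _ _ Omega (measurableTypeR R) setT _ (@RGenOInfty.G R)).
  exact: RGenOInfty.measurableE.
move=> _ [_ [y ->] <-]; rewrite setTI.
have -> : (fun w : Omega => ip (w t) u) @^-1` `]y, +oo[%classic =
    (fun w : Omega => w t) @^-1` [set v | y < ip v u].
  by apply/seteqP; split => w /=; rewrite in_itv/= andbT.
apply: (measurable_preimage_open (measurable_eval t)).
have -> : [set v | y < ip v u] = (fun v => ip v u) @^-1` [set x : R | y < x] by [].
apply: open_comp; last exact: open_gt.
by move=> v _; apply: cvg_ipl => //; exact: cvg_id.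
Qed.

Lemma coord_expR_sqr n h th : 0 < h -> 0 <= th ->
  th * (16 * h `^ (2 * H) * q n) <= 4^-1 ->
  (\int[P]_w (expR (th * ip (w h) (e n) ^+ 2))%:E <= (Num.sqrt 2)%:E)%E.
Proof.
move=> h0 th0 hth; have [gauss cov] := hP.
apply: (@gaussian_expR_sqr _ _ _ _ _ (2 * h `^ (2 * H) * q n)) => //.
- exact: measurable_coord.
- have := gauss 1%N (fun _ => h) (fun _ => e n); congr (centered_gaussian P _).
  by apply/funext => w; rewrite big_ord1.
- rewrite cov; congr EFin; rewrite gtr0_norm// subrr normr0 powR0 ?mulf_neq0 ?gt_eqF//.
  by rewrite subr0; ring.
- by rewrite (_ : 8 * _ = 16 * h `^ (2 * H) * q n)//; ring.
Qed.

(** Convexity reduces the sum to its marginals. With weights p n of sum 1, a sum of squares above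
    a^2 means that the average of X n^2 / (p n a^2) exceeds 1; by exp x >= 1 + x the indicator is
    then at most the average of exp (th (X n^2 / (p n a^2) - 1)). *)
Lemma coords_tail N h a : 0 < h -> 0 < a ->
  (P [set w : Omega | (a ^+ 2 < \sum_(0 <= n < N.+1) ip (w h) (e n) ^+ 2)%R] <=
   (Num.sqrt 2 * expR (- (a ^+ 2 / (64 * (tau + 1) * h `^ (2 * H)))))%:E)%E.
Proof.
move=> h0 a0; set th := a ^+ 2 / _.
have tau0 : 0 <= tau by have := qtau 0; rewrite big_geq.
have hH : 0 < h `^ (2 * H) by exact: powR_gt0.
have a20 : 0 < a ^+ 2 by rewrite exprn_gt0.
have den0 : 0 < 64 * (tau + 1) * h `^ (2 * H) by rewrite !mulr_gt0// ltr_wpDl.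
have th0 : 0 < th by rewrite divr_gt0.
have Np : 0 < N.+1%:R^-1 :> R by rewrite invr_gt0.
pose tN := \sum_(0 <= n < N.+1) q n + 1.
have tN0 : 0 < tN by rewrite ltr_wpDl// sumr_ge0.
have tNle : tN <= tau + 1 by rewrite lerD2r.
(* The weights follow the variances: q n <= p n (tau + 1), so [th] keeps every coordinate within the
   admissible 1/4. The summand 1/(N+1) keeps them positive where [q n] vanishes. *)
pose p n := (q n + N.+1%:R^-1) / tN.
have p0 n : 0 < p n by rewrite divr_gt0// ltr_wpDl.
have psum : \sum_(0 <= n < N.+1) p n = 1.
  rewrite /p -mulr_suml big_split/= sumr_const_nat subn0.
  by rewrite -[N.+1%:R^-1 *+ _]mulr_natl mulfV ?pnatr_eq0// mulfV// gt_eqF.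
pose X n (w : Omega) : R := ip (w h) (e n).
pose f n (w : Omega) := expR (- th) * p n * expR (th / (p n * a ^+ 2) * X n w ^+ 2).
have mX n : measurable_fun setT (X n : Omega -> measurableTypeR R) by exact: measurable_coord.
have mE n : measurable_fun setT (fun w => expR (th / (p n * a ^+ 2) * X n w ^+ 2)).
  apply: measurableT_comp => //; apply: measurable_funM => //.
  by apply: measurable_funX; exact: mX.
have mf n : measurable_fun setT (fun w => (f n w)%:E).
  by apply/measurable_EFinP; apply: measurable_funM.
have ep0 n : 0 <= expR (- th) * p n.
  by apply: mulr_ge0; [exact: expR_ge0|exact: ltW].
have f0 n w : (0 <= (f n w)%:E)%E.
  by rewrite lee_fin; apply: mulr_ge0; [exact: ep0|exact: expR_ge0].
have thp n : 0 <= th / (p n * a ^+ 2).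
  by rewrite divr_ge0 ?(ltW th0)//; apply: mulr_ge0; exact: ltW.
set E := [set w | _].
have mE' : measurable E.
  have mS : measurable_fun setT
      ((fun w => \sum_(0 <= n < N.+1) X n w ^+ 2) : Omega -> measurableTypeR R).
    by apply: measurable_sum => n; apply: measurable_funX; exact: mX.
  rewrite (_ : E = (fun w => \sum_(0 <= n < N.+1) X n w ^+ 2) @^-1` `]a ^+ 2, +oo[%classic).
    by rewrite -[X in measurable X]setTI; apply: mS => //; exact: measurable_itv.
  by apply/seteqP; split => w /=; rewrite in_itv/= andbT.
rewrite -[X in P X]setIT -integral_indic//.
apply: (@le_trans _ _ (\int[P]_w \sum_(0 <= n < N.+1) (f n w)%:E)%E).
  apply: ge0_le_integral_nomeas => w _; first by rewrite lee_fin.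
  rewrite sumEFin lee_fin indicE.
  have fs0 : 0 <= \sum_(0 <= n < N.+1) f n w.
    by apply: sumr_ge0 => n _; rewrite -lee_fin.
  have [/set_mem Ew|_] := boolP (w \in E); last exact: fs0.
  apply: (@le_trans _ _ (\sum_(0 <= n < N.+1) p n * (1 + th * (X n w ^+ 2 / (p n * a ^+ 2) - 1)))).
    rewrite [leRHS](_ : _ = \sum_(0 <= n < N.+1) p n * (1 - th) +
       \sum_(0 <= n < N.+1) th / a ^+ 2 * X n w ^+ 2); last first.
      rewrite -big_split/=; apply: eq_bigr => n _; field.
      by rewrite (gt_eqF (p0 n)) gt_eqF.
    rewrite -mulr_suml psum mul1r -mulr_sumr.
    rewrite -lerBlDl opprB addrCA subrr addr0.
    rewrite mulrAC ler_pdivlMr// ler_pM2l//; exact: ltW.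
  apply: ler_sum => n _; rewrite /f [expR _ * p n]mulrC -[leRHS]mulrA; apply: ler_wpM2l; first exact: ltW.
  rewrite -expRD; apply: le_trans (expR_ge1Dx _) _; rewrite ler_expR.
  by rewrite le_eqVlt; apply/orP; left; apply/eqP; field; rewrite (gt_eqF (p0 n)) gt_eqF.
rewrite ge0_integral_sum//.
apply: (@le_trans _ _ (\sum_(0 <= n < N.+1) (expR (- th) * p n)%:E * (Num.sqrt 2)%:E)%E).
  apply: lee_sum => n _; rewrite /f; under eq_integral do rewrite EFinM.
  rewrite ge0_integralZl_EFin//; last exact/measurable_EFinP.
  apply: lee_wpmul2l; first by rewrite lee_fin.
  apply: coord_expR_sqr => //.
  have qp : q n <= p n * (tau + 1).
    apply: (@le_trans _ _ (p n * tN)); last by rewrite ler_pM2l.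
    by rewrite /p divfK ?gt_eqF// lerDl ltW.
  apply: (@le_trans _ _ (th / (p n * a ^+ 2) * (16 * h `^ (2 * H) * (p n * (tau + 1))))).
    apply: ler_wpM2l => //.
    by apply: ler_wpM2l => //; rewrite mulr_ge0// ltW.
  rewrite le_eqVlt; apply/orP; left; apply/eqP; rewrite /th; field.
  by rewrite (gt_eqF (p0 n)) !gt_eqF// ltr_wpDl.
under eq_bigr do rewrite -EFinM.
rewrite sumEFin lee_fin -mulr_suml -mulr_sumr psum mulr1 mulrC.
exact: lexx.
Qed.

(** By Parseval the norm exceeds [a] exactly when some partial sum of squares exceeds a^2. These
    events increase, and their bound is uniform in N. *)
Lemma fbm_tail h a : 0 < h -> 0 < a ->
  (P [set w : Omega | (a < `|w h|)%R] <=
   (Num.sqrt 2 * expR (- (a ^+ 2 / (64 * (tau + 1) * h `^ (2 * H)))))%:E)%E.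
Proof.
move=> h0 a0.
pose F N := [set w : Omega | (a ^+ 2 < \sum_(0 <= n < N.+1) ip (w h) (e n) ^+ 2)%R].
have mF N : measurable (F N).
  have mS : measurable_fun setT
      ((fun w : Omega => \sum_(0 <= n < N.+1) ip (w h) (e n) ^+ 2) : Omega -> measurableTypeR R).
    by apply: measurable_sum => n; apply: measurable_funX; exact: measurable_coord.
  rewrite (_ : F N = (fun w : Omega => \sum_(0 <= n < N.+1) ip (w h) (e n) ^+ 2) @^-1`
      `]a ^+ 2, +oo[%classic).
    by rewrite -[X in measurable X]setTI; apply: mS => //; exact: measurable_itv.
  by apply/seteqP; split => w /=; rewrite in_itv/= andbT.
have -> : [set w : Omega | (a < `|w h|)%R] = \bigcup_N F N.
  apply/seteqP; split => w /=.
    move=> aw; apply: contrapT => nF; move: aw; apply/negP; rewrite -leNgt.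
    apply: (norm_le_coords hip eorth enorm emax (ltW a0)) => N.
    have [->|N0] := eqVneq N 0%N; first by rewrite big_geq// sqr_ge0.
    rewrite leNgt; apply/negP => FN; apply: nF; exists N.-1 => //.
    by rewrite /F /= prednK// lt0n.
  move=> [N _]; rewrite /F/= => aw; rewrite -(@ltr_pXn2r _ 2) ?nnegrE ?(ltW a0)//.
  exact: lt_le_trans aw (Bessel hip eorth enorm _ _).
have Fc : (P \o F) N @[N --> \oo] --> P (\bigcup_N F N).
  apply: nondecreasing_cvg_mu => //; first exact: bigcupT_measurable.
  apply/nondecreasing_seqP => N; apply/subsetPset => w; rewrite /F/= => aw.
  apply: lt_le_trans aw _; rewrite [leRHS]big_nat_recr//= lerDl; exact: sqr_ge0.
rewrite -(cvg_lim _ Fc)//; apply: lime_le; first by apply/cvg_ex; eexists; exact: Fc.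
by apply: nearW => N; exact: coords_tail.
Qed.
End FbmTail.

(** * Dyadic chaining *)

Section Chaining.
Context {R : realType} {V : completeNormedModType R}.
Implicit Types (s t u : R) (w : R -> V).

Definition mesh n : R := 2^-1 ^+ n.

Lemma mesh_gt0 n : 0 < mesh n. Proof. by rewrite exprn_gt0// invr_gt0. Qed.

Lemma mesh_le1 n : mesh n <= 1.
Proof. by rewrite exprn_ile1// invf_le1// ler1n. Qed.

Lemma meshS n : mesh n = 2 * mesh n.+1.
Proof. by rewrite /mesh exprS mulrA mulfV ?mul1r// pnatr_eq0. Qed.

Lemma mesh_lt u : 0 < u -> exists n, mesh n < u.
Proof.
move=> u0; pose n := Num.truncn u^-1; exists n.+1.
have h : (n.+1)%:R < 2 ^+ n.+1 :> R by rewrite -natrX ltr_nat ltn_expl.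
rewrite /mesh exprVn invf_plt ?posrE ?exprn_gt0//.
by apply: lt_trans h; exact: truncnS_gt.
Qed.

Lemma mesh_bracket u : 0 < u <= 1 -> exists n, mesh n.+1 < u <= mesh n.
Proof.
move=> /andP[u0 u1]; have ex : exists n, mesh n < u := mesh_lt u0.
case: (ex_minnP ex) => -[|n] hn nmin.
  by move: hn; rewrite /mesh expr0 ltNge u1.
exists n; rewrite hn leNgt /=; apply/negP => /nmin; by rewrite ltnn.
Qed.

Lemma int_consecutive (k l : int) : k < l + 1 -> l < k + 2 -> l = k \/ l = k + 1.
Proof. by lia. Qed.

Definition dyadic_holder al C w := forall n (l : int),
  `|w (l%:~R * mesh n + mesh n) - w (l%:~R * mesh n)| <=
  C * (1 + `|l%:~R * mesh n|) * mesh n `^ al.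

Lemma powR_mesh al n : mesh n `^ al = (2^-1 `^ al) ^+ n.
Proof.
have h2 : 0 <= 2^-1 :> R by rewrite invr_ge0.
by rewrite /mesh -powR_mulrn// powRAC powR_mulrn// powR_ge0.
Qed.

Definition grid s n : R := (Num.floor (s / mesh n))%:~R * mesh n.

Lemma grid_bounds s n : grid s n <= s < grid s n + mesh n.
Proof.
rewrite /grid -[X in _ < _ + X]mul1r -mulrDl -ler_pdivlMr ?mesh_gt0//.
by rewrite -ltr_pdivrMr ?mesh_gt0// floor_le -intrD1 floorD1_gt.
Qed.

Lemma grid_norm s n : `|grid s n| <= 1 + `|s|.
Proof.
have /andP[h1 h2] := grid_bounds s n; have := mesh_le1 n => h3.
rewrite ler_norml; apply/andP; split.
  have := ler_norm (- s); rewrite normrN => h; lra.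
by have := ler_norm s => h; lra.
Qed.

Lemma cvg_grid s n : grid s (n + m)%N @[m --> \oo] --> s.
Proof.
apply/cvgrPdist_lt => eps eps0; have [N hN] := mesh_lt eps0.
exists N => // m /= Nm.
have /andP[h1 h2] := grid_bounds s (n + m).
have hm : mesh (n + m) <= mesh N.
  rewrite /mesh ler_wiXn2l// ?invr_ge0// ?invf_le1 ?ler1n//.
  exact: leq_trans Nm (leq_addl _ _).
by rewrite ger0_norm ?subr_ge0//; lra.
Qed.

Section Fixed.
Variables (al C : R) (w : R -> V).
Hypothesis (al01 : 0 < al <= 1) (C0 : 0 <= C) (cw : continuous w).
Hypothesis hw : dyadic_holder al C w.
Local Notation rho := (2^-1 `^ al : R).

Lemma rho01 : 0 < rho < 1.
Proof.
have /andP[al0 _] := al01; rewrite powR_gt0 ?invr_gt0//=.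
have := @gt0_ltr_powR R al al0 2^-1 1; rewrite powR1; apply.
- by rewrite nnegrE invr_ge0.
- by rewrite nnegrE.
- by rewrite invf_lt1// ltr1n.
Qed.

(** Halving the mesh keeps the left grid point or moves it by one new step, as the new index is 2 L
    or 2 L + 1; at most one dyadic increment occurs. *)
Lemma grid_step s n : `|w (grid s n.+1) - w (grid s n)| <= C * (2 + `|s|) * rho ^+ n.+1.
Proof.
have m0 := mesh_gt0 n.+1.
pose L := Num.floor (s / mesh n); pose L' := Num.floor (s / mesh n.+1).
have E : grid s n = (2 * L)%:~R * mesh n.+1.
  by rewrite /grid -/L [mesh n]meshS intrM mulrA [_ * 2]mulrC.
have /andP[h1 h2] := grid_bounds s n; have /andP[h3 h4] := grid_bounds s n.+1.
have a1 : 2 * L < L' + 1.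
  rewrite -(@ltr_int R) -(ltr_pM2r m0) -E intrD mulrDl mul1r.
  by apply: le_lt_trans h1 _.
have a2 : L' < 2 * L + 2.
  rewrite -(@ltr_int R) -(ltr_pM2r m0) intrD mulrDl -E -meshS.
  by apply: le_lt_trans h3 _.
have [e|e] := int_consecutive a1 a2.
  have -> : grid s n.+1 = grid s n by rewrite E -e.
  by rewrite subrr normr0 mulr_ge0 ?exprn_ge0 ?powR_ge0// mulr_ge0// addr_ge0.
have -> : grid s n.+1 = (2 * L)%:~R * mesh n.+1 + mesh n.+1.
  by rewrite /grid -/L' e intrD mulrDl mul1r.
rewrite E; apply: le_trans (hw _ _) _; rewrite -E powR_mesh ler_wpM2r ?exprn_ge0 ?powR_ge0//.
rewrite ler_wpM2l// -[2]/(1 + 1) -addrA lerD2l; exact: grid_norm.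
Qed.

(** The steps from level n on form a geometric series, and continuity identifies the limit with
    [w s]. *)
Lemma grid_approx s n : `|w s - w (grid s n)| <= C * (2 + `|s|) / (1 - rho) * rho ^+ n.
Proof.
have /andP[r0 r1] := rho01.
have a0 : 0 <= C * (2 + `|s|) by rewrite mulr_ge0// addr_ge0.
have step m : `|w (grid s (n + m.+1)) - w (grid s (n + m))| <=
    C * (2 + `|s|) * rho ^+ n * rho ^+ m.
  rewrite addnS; apply: le_trans (grid_step s (n + m)) _.
  rewrite -[leRHS]mulrA -exprD; apply: ler_wpM2l => //.
  by rewrite exprSr ler_piMr ?exprn_ge0 ?powR_ge0// ltW.
have rr : 0 <= rho < 1 by rewrite (ltW r0).
have [y cy hy] := geometric_cvg (u := fun m => w (grid s (n + m))) rr step.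
have -> : w s = y.
  rewrite -(cvg_lim _ cy)//; apply/esym/cvg_lim => //.
  by apply: (cvg_comp (fun m => grid s (n + m)%N) w); [exact: cvg_grid|exact: cw].
have := hy 0%N; rewrite addn0 expr0 mulr1 mulrAC; exact.
Qed.

(** At the level with mesh n.+1 < t - s <= mesh n, the grid points of s and t are equal or adjacent.
    The division by rho pays for mesh n being larger than t - s. *)
Lemma holder_ordered s t : s <= t <= s + 1 ->
  `|w t - w s| <= C * (2 / (1 - rho) / rho) * (4 + `|s| + `|t|) * (t - s) `^ al.
Proof.
have /andP[r0 r1] := rho01; have /andP[al0 _] := al01.
have r1' : 0 < 1 - rho by rewrite subr_gt0.
rewrite le_eqVlt => /andP[/predU1P[<- _|st ts1]].
  rewrite subrr normr0 mulr_ge0 ?powR_ge0//.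
  by rewrite !mulr_ge0 ?addr_ge0 ?invr_ge0 ?(ltW r0)// ltW.
have u01 : 0 < t - s <= 1 by rewrite subr_gt0 st lerBlDl.
have [n /andP[nu un]] := mesh_bracket u01.
have m0 := mesh_gt0 n.
have rn : rho ^+ n <= (t - s) `^ al / rho.
  rewrite ler_pdivlMr// -exprSr -powR_mesh; apply: ge0_ler_powR.
  - exact: ltW.
  - by rewrite nnegrE ltW// mesh_gt0.
  - by rewrite nnegrE; case/andP: u01 => /ltW.
  - exact: ltW.
have mid : `|w (grid t n) - w (grid s n)| <= C * (2 + `|s|) * rho ^+ n.
  have /andP[h1 h2] := grid_bounds s n; have /andP[h3 h4] := grid_bounds t n.
  pose L := Num.floor (s / mesh n); pose L' := Num.floor (t / mesh n).
  have a1 : L < L' + 1.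
    rewrite -(@ltr_int R) -(ltr_pM2r m0) intrD mulrDl mul1r -/(grid s n) -/(grid t n).
    by apply: le_lt_trans h1 _; apply: lt_trans st _.
  have a2 : L' < L + 2.
    rewrite -(@ltr_int R) -(ltr_pM2r m0) intrD mulrDl -/(grid s n) -/(grid t n).
    by lra.
  have [e|e] := int_consecutive a1 a2.
    have -> : grid t n = grid s n by rewrite /grid -/L -/L' e.
    by rewrite subrr normr0 mulr_ge0 ?exprn_ge0 ?powR_ge0// mulr_ge0// addr_ge0.
  have -> : grid t n = L%:~R * mesh n + mesh n.
    by rewrite /grid -/L' e intrD mulrDl mul1r.
  apply: le_trans (hw _ _) _; rewrite powR_mesh ler_wpM2r ?exprn_ge0 ?powR_ge0//.
  rewrite ler_wpM2l// -[2]/(1 + 1) -addrA lerD2l; exact: grid_norm.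
have := grid_approx s n; have := grid_approx t n.
set X := rho ^+ n in rn mid *; move=> ht hs.
have X0 : 0 <= X by rewrite exprn_ge0// powR_ge0.
have tri : `|w t - w s| <= `|w t - w (grid t n)| + `|w (grid t n) - w (grid s n)|
    + `|w s - w (grid s n)|.
  rewrite [ `|w s - _|]distrC.
  have -> : w t - w s = (w t - w (grid t n)) + (w (grid t n) - w (grid s n)) + (w (grid s n) - w s).
    by rewrite !addrA !subrK.
  by apply: le_trans (ler_normD _ _) _; rewrite lerD2r ler_normD.
apply: le_trans tri _; apply: le_trans (lerD (lerD ht mid) hs) _.
apply: (@le_trans _ _ (C * (2 / (1 - rho)) * (4 + `|s| + `|t|) * X)).
  have i1 : 1 <= (1 - rho)^-1 by rewrite invf_ge1// gerBl ltW.
  move: i1 {ht mid hs}; set i := (1 - rho)^-1 => i1.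
  have CX0 : 0 <= C * X by rewrite mulr_ge0.
  have s0 : 0 <= `|s| by []. have t0 : 0 <= `|t| by [].
  rewrite -subr_ge0 [leRHS](_ : _ = C * X * ((2 + `|s|) * (i - 1) + (2 + `|t|) * i)).
    by apply: mulr_ge0 => //; apply: addr_ge0; apply: mulr_ge0; lra.
  by generalize `|s| `|t| i X => *; ring.
rewrite [leRHS](_ : _ = C * (2 / (1 - rho)) * (4 + `|s| + `|t|) * ((t - s) `^ al / rho)); last by ring.
apply: ler_wpM2l => //.
by rewrite !mulr_ge0 ?addr_ge0 ?invr_ge0 ?(ltW r1').
Qed.

(** The 4 comes from 4 + |s'| + |t'| <= 4 (1 + |s|) (1 + |u|) for points s', t' between s and s + u;
    the rest is the constant of [holder_ordered]. *)
Definition chain_const : R := 4 * (2 / (1 - rho) / rho).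

Lemma chain_const_ge0 : 0 <= chain_const.
Proof.
have /andP[r0 r1] := rho01.
by rewrite mulr_ge0// divr_ge0 ?(ltW r0)// divr_ge0// subr_ge0 ltW.
Qed.

Lemma holder_near s t : `|t - s| <= 1 ->
  `|w t - w s| <= C * (2 / (1 - rho) / rho) * (4 + `|s| + `|t|) * `|t - s| `^ al.
Proof.
have [st|ts] := leP s t.
  rewrite ger0_norm ?subr_ge0// => h; apply: holder_ordered.
  by rewrite st -lerBlDl.
rewrite (distrC t s) (distrC (w t)) [4 + `|s| + _]addrAC.
rewrite ger0_norm ?subr_ge0 ?(ltW ts)// => h; apply: holder_ordered.
by rewrite (ltW ts) -lerBlDl.
Qed.

(** An increment is cut into at most 1 + |u| pieces of length at most 1; their number gives one
    factor 1 + |u|, their position the other. *)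
Lemma holder_growth_of_dyadic : holder_growth al (chain_const * C) w.
Proof.
move=> s u; have /andP[al0 _] := al01.
pose N := (Num.truncn `|u|).+1; pose v := u / N%:R.
have N0 : 0 < N%:R :> R by rewrite ltr0n.
have uN : `|u| < N%:R by exact: truncnS_gt.
have Nu : N%:R <= 1 + `|u| by rewrite -natr1 addrC lerD2l truncn_le.
have v1 : `|v| <= 1 by rewrite normrM normfV [ `|N%:R|]gtr0_norm// ler_pdivrMr// mul1r ltW.
have vu : `|v| <= `|u|.
  by rewrite normrM normfV [ `|N%:R|]gtr0_norm// ler_piMr// invf_le1// ler1n.
have -> : w (s + u) - w s = \sum_(0 <= i < N) (w (s + i.+1%:R * v) - w (s + i%:R * v)).
  by rewrite telescope_sumr// mul0r addr0 /v mulrCA mulfV ?mulr1// gt_eqF.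
apply: le_trans (ler_norm_sum _ _ _) _.
apply: (@le_trans _ _ (\sum_(0 <= i < N) (chain_const * C * (1 + `|s|) * (1 + `|u|) * `|u| `^ al))).
  rewrite big_nat [leRHS]big_nat; apply: ler_sum => i /andP[_ iN].
  have bnd j : (j <= N)%N -> `|s + j%:R * v| <= `|s| + `|u|.
    move=> jN; apply: le_trans (ler_normD _ _) _; rewrite lerD2l.
    rewrite /v mulrCA normrM ler_piMr// normrM normfV !normr_nat ler_pdivrMr// mul1r.
    by rewrite ler_nat.
  have st : s + i.+1%:R * v - (s + i%:R * v) = v.
    by rewrite opprD addrACA subrr add0r -mulrBl -natr1 addrAC subrr add0r mul1r.
  have := @holder_near (s + i%:R * v) (s + i.+1%:R * v); rewrite st => /(_ v1) h.
  apply: le_trans h _.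
  have K0 : 0 <= C * (2 / (1 - rho) / rho).
    by rewrite mulr_ge0//; have := chain_const_ge0; rewrite pmulr_rge0.
  apply: ler_pM; rewrite ?powR_ge0//.
  - by rewrite mulr_ge0// !addr_ge0.
  - rewrite /chain_const.
    apply: (@le_trans _ _ (C * (2 / (1 - rho) / rho) * (4 * ((1 + `|s|) * (1 + `|u|))))).
      apply: ler_wpM2l => //.
      have b1 := bnd i (ltnW iN); have b2 := bnd _ iN.
      have su : 0 <= `|s| * `|u| by rewrite mulr_ge0.
      have s0 := normr_ge0 s; have u0 := normr_ge0 u.
      rewrite mulrDl mul1r !mulrDr !mulr1; nra.
    by rewrite le_eqVlt; apply/orP; left; apply/eqP; ring.
  - apply: ge0_ler_powR => //; exact: ltW.
rewrite sumr_const_nat subn0 -[leLHS]mulr_natl.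
apply: (@le_trans _ _ ((1 + `|u|) * (chain_const * C * (1 + `|s|) * (1 + `|u|) * `|u| `^ al))).
  apply: ler_wpM2r => //; apply: mulr_ge0; last exact: powR_ge0.
  apply: mulr_ge0; last by rewrite addr_ge0.
  apply: mulr_ge0; last by rewrite addr_ge0.
  by apply: mulr_ge0; first exact: chain_const_ge0.
rewrite le_eqVlt; apply/orP; left; apply/eqP.
by move: chain_const (`|u| `^ al) (1 + `|u|) (1 + `|s|) => k p x y; ring.
Qed.
End Fixed.

(** With the chaining bound, this makes the condition on all pairs of times equivalent, up to
    constants, to a countable one. The 4 bounds (1 + mesh n)^2. *)
Lemma dyadic_of_holder_growth al C w : 0 <= C ->
  holder_growth al C w -> dyadic_holder al (4 * C) w.
Proof.
move=> C0 hw n l; apply: le_trans (hw _ _) _.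
have m0 := mesh_gt0 n; rewrite [ `|mesh n|]gtr0_norm//.
apply: ler_wpM2r; first exact: powR_ge0.
rewrite [4 * C]mulrC -!mulrA; apply: ler_wpM2l => //.
rewrite mulrC; apply: ler_wpM2r; first by rewrite addr_ge0.
have -> : (4 : R) = 2 ^+ 2 by ring.
by have m1 := mesh_le1 n; rewrite ler_pXn2r ?nnegrE//; lra.
Qed.

Lemma hpath_continuous gam (w : hpath V gam) : 0 < gam -> continuous w.
Proof.
move=> gam0 t; have [C hC] := path_holder w (t - 1) (t + 1).
pose C' := `|C| + 1; have C'0 : 0 < C' by rewrite ltr_wpDl.
apply/cvgrPdist_lt => d d0.
have dC : 0 < (d / C') `^ gam^-1 by rewrite powR_gt0// divr_gt0.
near=> s.
have st1 : `|t - s| < 1 by near: s; exact: cvgr_dist_lt.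
have sd : `|t - s| < (d / C') `^ gam^-1 by near: s; exact: cvgr_dist_lt.
have ht : t \in `[(t - 1), (t + 1)] by rewrite in_itv/=; lra.
have hs : s \in `[(t - 1), (t + 1)].
  by rewrite in_itv/=; move: st1; rewrite ltr_norml => /andP[? ?]; lra.
apply: le_lt_trans (hC s t hs ht) _.
apply: (@le_lt_trans _ _ (C' * `|t - s| `^ gam)).
  by apply: ler_wpM2r; [exact: powR_ge0|rewrite /C'; apply: le_trans (ler_norm _) _; rewrite lerDl].
rewrite -ltr_pdivlMl// mulrC.
have := @gt0_ltr_powR R gam gam0 `|t - s| ((d / C') `^ gam^-1).
rewrite -powRrM mulVf ?gt_eqF// powRr1 ?divr_ge0 1?ltW//.
apply; [by rewrite nnegrE|by rewrite nnegrE ltW|exact: sd].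
Unshelve. all: by end_near.
Qed.
End Chaining.

(** * Almost every path is tame *)

Section Tame.
Context {R : realType} {V : completeNormedModType R} {gam : R}.
Local Notation Omega := (hpath V gam).
Hypothesis (hsep : separable V) (gam0 : 0 < gam).
Variables (P : probability Omega R) (H c : R).
Hypothesis (H01 : 0 < H < 1) (c0 : 0 < c) (hergodic : ergodic_shift P).
Hypothesis tail : forall h a, 0 < h -> 0 < a ->
  (P [set w : Omega | (a < `|w h|)%R] <=
   (Num.sqrt 2 * expR (- (a ^+ 2 / (c * h `^ (2 * H)))))%:E)%E.
Local Notation al := (H / 2).

Lemma expRN_le (m : nat) (y : R) : 0 < y -> expR (- y) <= (m%:R / y) ^+ m.
Proof.
case: m => [|m] y0; first by rewrite expr0 -expR0 ler_expR oppr_le0 ltW.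
have m0 : 0 < m.+1%:R :> R by rewrite ltr0n.
rewrite expRN -[_ / _]invf_div exprVn lef_pV2 ?posrE ?expR_gt0 ?exprn_gt0 ?divr_gt0//.
have -> : y = m.+1%:R * (y / m.+1%:R) by rewrite mulrCA mulfV ?mulr1// gt_eqF.
rewrite expRM_natl mulrCA mulfV ?mulr1 ?gt_eqF//.
apply: lerXn2r; rewrite ?nnegrE ?expR_ge0 ?divr_ge0 ?(ltW y0)//.
by apply: le_trans (expR_ge1Dx _); rewrite lerDr.
Qed.

Definition bad C n (l : int) : set Omega := [set w |
  C * (1 + `|l%:~R * @mesh R n|) * @mesh R n `^ al <
  `|w (l%:~R * @mesh R n + @mesh R n) - w (l%:~R * @mesh R n)|].

Lemma measurable_bad C n l : measurable (bad C n l).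
Proof.
have := measurable_norm_le (C * (1 + `|l%:~R * @mesh R n|) * @mesh R n `^ al)
  (measurable_increment hsep (l%:~R * @mesh R n + @mesh R n) (l%:~R * @mesh R n) (gam := gam)).
move/measurableC; congr measurable; apply/seteqP; split => w /=.
  by move=> /negP; rewrite -ltNge.
by rewrite /bad/= ltNge => /negP.
Qed.

Lemma bad_prob : exists2 K, 0 < K & forall C n l, 1 <= C ->
  (P (bad C n l) <= (K / C * @mesh R n * (1 + `|l%:~R|) ^- 2)%:E)%E.
Proof.
have /andP[H0 H1] := H01.
pose m := (Num.truncn (3 / H)).+1.
have mH : 3 <= m%:R * H by rewrite -ler_pdivrMr// ltW// truncnS_gt.
have m0 : 0 < m%:R :> R by rewrite ltr0n.
(* The Gaussian exponent is y = C^2 (1 + |l| h)^2 / (c h^H) with h = 2^-n, and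
   exp (- y) <= (m / y)^m; as m H >= 3, two of the powers of h pay for
   replacing (1 + |l| h)^-2 by (1 + |l|)^-2 and the third one is summable. *)
exists (Num.sqrt 2 * (m%:R * c) ^+ m).
  by rewrite mulr_gt0 ?sqrtr_gt0// exprn_gt0// mulr_gt0.
move=> C n l C1; set h := @mesh R n; set L := `|l%:~R| : R.
have h0 : 0 < h := @mesh_gt0 R n; have h1 : h <= 1 := @mesh_le1 R n.
have C0 : 0 < C by exact: lt_le_trans C1.
have L0 : 0 <= L by exact: normr_ge0.
have nlh : `|l%:~R * h| = L * h by rewrite normrM (gtr0_norm h0).
set a := C * (1 + L * h) * h `^ al.
have Lh0 : 0 < 1 + L * h by rewrite ltr_wpDr// mulr_ge0// ltW.
have a0 : 0 < a by rewrite !mulr_gt0 ?powR_gt0.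
have mE : measurable [set w : Omega | (a < `|w h|)%R].
  have := measurable_norm_le a (measurable_eval h (V := V) (gam := gam)).
  move/measurableC; congr measurable; apply/seteqP; split => w /=.
    by move=> /negP; rewrite -ltNge.
  by rewrite ltNge => /negP.
(* A bad increment at position l h is a large value at time h of the shifted path, so invariance of
   [P] leaves only the tail at h. *)
have -> : bad C n l = theta (l%:~R * h) @^-1` [set w : Omega | (a < `|w h|)%R].
  by apply/seteqP; split => w; rewrite /bad/= nlh -/h -/a [h + _]addrC.
rewrite hergodic.1//.
apply: le_trans (tail h0 a0) _; rewrite lee_fin.
have hp : 0 < h `^ H by rewrite powR_gt0.
have -> : a ^+ 2 / (c * h `^ (2 * H)) = (C * (1 + L * h)) ^+ 2 / (c * h `^ H).
  have e1 : (h `^ al) ^+ 2 = h `^ H.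
    by rewrite -powR_mulrn ?powR_ge0// -powRrM divfK// pnatr_eq0.
  have e2 : h `^ (2 * H) = h `^ H * h `^ H.
    by rewrite mulr_natl mulr2n powRD// (gt_eqF h0) implybT.
  rewrite /a exprMn e1 e2; move: (h `^ H) hp => p p0; field.
  by rewrite !gt_eqF.
set y := _ / _; have y0 : 0 < y by rewrite divr_gt0 ?mulr_gt0// exprn_gt0// mulr_gt0.
rewrite -!mulrA; apply: ler_wpM2l => //.
apply: le_trans (expRN_le m y0) _; rewrite !mulrA.
have -> : m%:R / y = (m%:R * c) * h `^ H * (C^-1 ^+ 2) * ((1 + L * h)^-1 ^+ 2).
  rewrite /y !exprVn; move: (h `^ H) hp => p p0; field.
  by rewrite !gt_eqF.
have expM4 (x z u v : R) k : (x * z * u * v) ^+ k = x ^+ k * (z ^+ k * (u ^+ k * v ^+ k)).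
  by rewrite !exprMn !mulrA.
rewrite expM4 -!mulrA; apply: ler_wpM2l; first by rewrite exprn_ge0// mulr_ge0// ltW.
have hm : (h `^ H) ^+ m <= h ^+ 3.
  rewrite -powR_mulrn ?powR_ge0// -powRrM -powR_mulrn ?(ltW h0)//.
  by apply: ger_powR; [rewrite h0|rewrite mulrC].
have Ci1 : 0 <= C^-1 <= 1 by rewrite invr_ge0 (ltW C0)/= invf_le1.
(* One power of C^-1 is kept: it sends the probability to 0 as C grows. *)
have Cm : (C^-1 ^+ 2) ^+ m <= C^-1.
  by rewrite -exprM -[leRHS]expr1; apply: ler_wiXn2l; rewrite ?muln_gt0; case/andP: Ci1.
have Lm : ((1 + L * h)^-1 ^+ 2) ^+ m <= h ^- 2 * (1 + L) ^- 2.
  have Li : 0 <= (1 + L * h)^-1 <= 1.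
    by rewrite invr_ge0 (ltW Lh0)/= invf_le1// lerDl mulr_ge0// ltW.
  apply: (@le_trans _ _ ((1 + L * h)^-1 ^+ 2)).
    rewrite -exprM; apply: ler_wiXn2l; first by case/andP: Li.
    - by case/andP: Li.
    - by rewrite /m mulnS leq_addr.
  have hL : 0 < h * (1 + L) by rewrite mulr_gt0// ltr_wpDr.
  rewrite -exprVn -[(1 + L) ^- 2]exprVn -exprMn -invfM; apply: lerXn2r.
  - by rewrite nnegrE invr_ge0 ltW.
  - by rewrite nnegrE invr_ge0 ltW.
  - by rewrite lef_pV2 ?posrE// mulrDr mulr1 mulrC lerD2r.
have p1 : 0 <= (C^-1 ^+ 2) ^+ m by do 2 apply: exprn_ge0; case/andP: Ci1.
have p2 : 0 <= ((1 + L * h)^-1 ^+ 2) ^+ m by do 2 apply: exprn_ge0; rewrite invr_ge0 ltW.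
apply: (@le_trans _ _ (h ^+ 3 * (C^-1 * (h ^- 2 * (1 + L) ^- 2)))).
  apply: ler_pM => //; [by rewrite exprn_ge0// ltW|exact: mulr_ge0|].
  exact: ler_pM.
rewrite le_eqVlt; apply/orP; left; apply/eqP; field.
by rewrite !gt_eqF// ltr_wpDr.
Qed.

Lemma nneseries_le (u : nat -> R) b : (forall n, 0 <= u n) ->
  (forall N, \sum_(0 <= n < N) u n <= b) -> (\sum_(0 <= n <oo) (u n)%:E <= b%:E)%E.
Proof.
move=> u0 ub; apply: lime_le; first by apply: is_cvg_nneseries => n _ _; rewrite lee_fin.
by apply: nearW => N; rewrite sumEFin lee_fin.
Qed.

Lemma sum_inv_sqr N : \sum_(0 <= n < N) (1 + n%:R) ^- 2 <= 2 :> R.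
Proof.
suff h n : \sum_(0 <= i < n.+1) (1 + i%:R) ^- 2 <= 2 - n.+1%:R^-1 :> R.
  case: N => [|n]; first by rewrite big_geq.
  by apply: le_trans (h n) _; rewrite gerBl invr_ge0.
elim: n => [|n IH]; first by rewrite big_nat1 addr0 expr1n invr1; lra.
rewrite big_nat_recr//=; apply: le_trans (lerD IH (lexx _)) _.
rewrite -!natr1; set x : R := n%:R; have x0 : 0 <= x by exact: ler0n.
rewrite -subr_ge0 [leRHS](_ : _ = (2 + x) ^- 2 * (1 + x)^-1).
  by apply: mulr_ge0; rewrite invr_ge0 ?exprn_ge0// addr_ge0.
by field; rewrite !gt_eqF//; lra.
Qed.

Lemma sum_mesh N : \sum_(0 <= n < N) mesh n = 2 - 2 * mesh N :> R.
Proof.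
elim: N => [|N IH]; first by rewrite big_geq// /mesh expr0; lra.
by rewrite big_nat_recr//= IH [mesh N]meshS; lra.
Qed.

(** Every integer is j or - j for a natural j, which turns the union over positions into series over
    nat; listing 0 twice is harmless. *)
Definition all_bad C : set Omega := \bigcup_n \bigcup_j (bad C n j%:Z `|` bad C n (- j%:Z)).

Lemma measurable_all_bad C : measurable (all_bad C).
Proof.
apply: bigcupT_measurable => n; apply: bigcupT_measurable => j.
by apply: measurableU; exact: measurable_bad.
Qed.

Lemma all_bad_prob : exists2 K, 0 < K & forall C, 1 <= C -> (P (all_bad C) <= (K / C)%:E)%E.
Proof.
(* 8 = 2 * 2 * 2: the two signs, the bound on the sum of (1 + j)^-2, and the sum of the meshes. *)
have [K K0 hK] := bad_prob; exists (8 * K); first by rewrite mulr_gt0.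
move=> C C1; have C0 : 0 < C by exact: lt_le_trans C1.
have c0' : 0 <= K / C by rewrite divr_ge0// ltW.
have step n : (P (\bigcup_j (bad C n j%:Z `|` bad C n (- j%:Z))) <=
    (4 * (K / C) * @mesh R n)%:E)%E.
  have h0 := @mesh_gt0 R n.
  have mB j : measurable (bad C n j%:Z `|` bad C n (- j%:Z)).
    by apply: measurableU; exact: measurable_bad.
  apply: le_trans (measure_sigma_subadditive P mB _ (@subset_refl _ _)) _.
    exact: bigcupT_measurable.
  apply: (@le_trans _ _ (\sum_(0 <= j <oo) (2 * (K / C) * @mesh R n * (1 + j%:R) ^- 2)%:E)%E).
    apply: lee_nneseries => // j _.
    apply: le_trans (measureU2 _ _ _) _; try exact: measurable_bad.
    apply: le_trans (leeD (hK _ n j%:Z C1) (hK _ n (- j%:Z) C1)) _.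
    rewrite -EFinD lee_fin rmorphN normrN/= normr_nat.
    by rewrite le_eqVlt; apply/orP; left; apply/eqP; ring.
  apply: nneseries_le => [j|N].
    by rewrite !mulr_ge0 ?invr_ge0 ?exprn_ge0 ?addr_ge0// ltW.
  rewrite -mulr_sumr.
  have k0 : 0 <= 2 * (K / C) * @mesh R n by rewrite !mulr_ge0 ?invr_ge0 ?(ltW K0)// ltW.
  apply: le_trans (ler_wpM2l k0 (sum_inv_sqr N)) _.
  by rewrite le_eqVlt; apply/orP; left; apply/eqP; ring.
have mU n : measurable (\bigcup_j (bad C n j%:Z `|` bad C n (- j%:Z))).
  by apply: bigcupT_measurable => j; apply: measurableU; exact: measurable_bad.
apply: le_trans (measure_sigma_subadditive P mU _ (@subset_refl _ _)) _.
  exact: measurable_all_bad.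
apply: (@le_trans _ _ (\sum_(0 <= n <oo) (4 * (K / C) * @mesh R n)%:E)%E).
  by apply: lee_nneseries => // n _; exact: step.
apply: nneseries_le => [n|N]; first by apply: mulr_ge0; [rewrite mulr_ge0|rewrite ltW// mesh_gt0].
rewrite -mulr_sumr sum_mesh; have := @mesh_gt0 R N => m0.
apply: (@le_trans _ _ (4 * (K / C) * 2)); last first.
  by rewrite le_eqVlt; apply/orP; left; apply/eqP; ring.
by apply: ler_wpM2l; [rewrite mulr_ge0|lra].
Qed.

Lemma not_all_bad C w : ~ all_bad C w <-> dyadic_holder al C w.
Proof.
split=> [nb n l|hw [n _ [j _ [|]]]]; rewrite /bad/=; try by rewrite ltNge hw.
rewrite leNgt; apply/negP => hb; apply: nb; exists n => //; exists `|l|%N => //.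
by case: (intP l) hb => [|m|m] hb; [left|left|right]; rewrite /bad/= ?absz_nat// abszN.
Qed.

Lemma dyadic_holderW C C' (w : R -> V) : C <= C' ->
  dyadic_holder al C w -> dyadic_holder al C' w.
Proof.
move=> CC' hw n l; apply: le_trans (hw n l) _.
by do 2 (apply: ler_wpM2r; first by rewrite ?powR_ge0 ?addr_ge0).
Qed.

(** Chaining and its converse replace the real constant by a natural one and the pairs of times by
    dyadic ones; the right-hand side is visibly measurable. *)
Lemma tame_pathsE : tame_paths al = \bigcup_N ~` all_bad N.+1%:R.
Proof.
have /andP[H0 H1] := H01; have al01 : 0 < al <= 1 by lra.
apply/seteqP; split => w.
  move=> [C C0 hw]; exists (Num.truncn (4 * C)) => //; apply/not_all_bad.
  apply: dyadic_holderW (dyadic_of_holder_growth C0 hw); exact/ltW/truncnS_gt.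
move=> [N _ /not_all_bad hw]; exists (chain_const al * N.+1%:R).
  by rewrite mulr_ge0// chain_const_ge0.
by apply: holder_growth_of_dyadic => //; exact: hpath_continuous.
Qed.

Lemma tame_full : full_invariant P (tame_paths al).
Proof.
have mT : measurable (tame_paths al : set Omega).
  rewrite tame_pathsE; apply: bigcupT_measurable => N.
  by apply: measurableC; exact: measurable_all_bad.
split=> //.
  have [K K0 hK] := all_bad_prob.
  suff : P (~` tame_paths al) = 0%E.
    move=> h; have -> : tame_paths al = ~` ~` tame_paths al :> set Omega by rewrite setCK.
    rewrite probability_setC; last exact: measurableC.
    by rewrite h sube0.
  apply/eqP; rewrite eq_le measure_ge0 andbT; apply/lee_addgt0Pr => d d0; rewrite add0e.
  pose N := Num.truncn (K / d).
  apply: (@le_trans _ _ (P (all_bad N.+1%:R))).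
    apply: le_measure; rewrite ?inE; [exact: measurableC|exact: measurable_all_bad|].
    by move=> w nw; apply: contrapT => nb; apply: nw; rewrite tame_pathsE; exists N.
  apply: le_trans (hK _ _) _; first by rewrite ler1n.
  rewrite lee_fin ler_pdivrMr ?ltr0n// mulrC -ler_pdivrMr//.
  exact/ltW/truncnS_gt.
move=> t; apply/seteqP; split => w [C C0 hw]; last first.
  by exists (C * (1 + `|t|)); [rewrite mulr_ge0// addr_ge0|exact: holder_growth_theta].
have -> : w = theta (- t) (theta t w) by rewrite thetaD addNr theta0.
by exists (C * (1 + `|- t|)); [rewrite mulr_ge0// addr_ge0|exact: holder_growth_theta].
Qed.
End Tame.

(** * The fixed point *)

Section SequenceBasis.
Context {R : realType} {V : completeNormedModType R} (ip : {dot V for idfun}).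
Hypothesis hip : hilbert_norm ip.
Variables (I : countType) (e : I -> V).
Hypothesis he : orthonormal_basis ip e.

(** [pickle_inv] is defined only on actual codes, so each basis vector is listed exactly once; the
    padding with 0 also covers a finite [I]. *)
Definition seq_basis n : V := oapp e 0 (pickle_inv n).

Lemma seq_basis_orth n m : n != m -> ip (seq_basis n) (seq_basis m) = 0.
Proof.
rewrite /seq_basis => nm; have := @pickle_invK I n; have := @pickle_invK I m.
case: pickle_inv => [j|] /=; last by move=> _ _; rewrite ip0r.
case: pickle_inv => [i|] /= jm; last by move=> _; rewrite ip0l.
move=> im; rewrite he.1; case: eqP => // ij.
by move: nm; rewrite -im -jm ij eqxx.
Qed.

Lemma seq_basis_norm n : ip (seq_basis n) (seq_basis n) = 1 \/ seq_basis n = 0.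
Proof.
rewrite /seq_basis; case: pickle_inv => [i|] /=; last by right.
by left; rewrite he.1 eqxx.
Qed.

Lemma seq_basis_max v : (forall n, ip v (seq_basis n) = 0) -> v = 0.
Proof.
by move=> h; apply: he.2 => i; have := h (pickle i); rewrite /seq_basis pickleK_inv.
Qed.

Lemma seq_basis_trace (Q : {linear V -> V}) N :
  (forall u, 0 <= ip (Q u) u) ->
  (\esum_(i in [set: I]) (ip (Q (e i)) (e i))%:E < +oo)%E ->
  \sum_(0 <= n < N) ip (Q (seq_basis n)) (seq_basis n) <=
  fine (\esum_(i in [set: I]) (ip (Q (e i)) (e i))%:E).
Proof.
move=> Q0 Qoo; rewrite -lee_fin fineK; last first.
  by rewrite ge0_fin_numE//; apply: esum_ge0 => i _; rewrite lee_fin.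
apply: esum_ge; exists [set` pmap (@pickle_inv I) (index_iota 0 N)].
  by split => //; exact: finite_seq.
have us : uniq (pmap (@pickle_inv I) (index_iota 0 N)).
  exact: (pmap_uniq (@pickle_invK I) (iota_uniq _ _)).
rewrite -(fsbig_seq _ _ us).
rewrite sumEFin big_pmap lee_fin; apply: ler_sum => n _; rewrite /seq_basis.
by case: pickle_inv => //=; rewrite ip0r.
Qed.
End SequenceBasis.

Theorem theorem4p5 (R : realType) (V : completeNormedModType R)
  (ip : {dot V for idfun}) (hip : hilbert_norm ip) (hsep : separable V)
  (H1 H2 gamma : R)
  (hH1 : 2^-1 < H1 < 1) (hH2 : 1 - H1 < H2 < 1) (hgamma : 0 < gamma < H2)
  (D : set V) (B : V -> V)
  (hBlin : linear_op D B)
  (hBclosed : closed_op D (fun u => - B u))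
  (hBpos : positive_op ip D (fun u => - B u))
  (hBsym : symmetric_op ip D (fun u => - B u))
  (hBinv : compact_inverse D (fun u => - B u))
  (S : R -> {linear V -> V})
  (hS : analytic_semigroup S) (hSgen : generator S D B)
  (lB : R) (hlB : 0 < lB)
  (hSexp : forall (t : R) (u : V), 0 <= t -> `|S t u| <= expR (- lB * t) * `|u|)
  (g : V -> V -> V) (C1 C2 : R) (hC1 : 0 < C1)
  (hg : forall x1 y1 x2 y2 : V,
     `|g x1 y1 - g x2 y2| <= C1 * (`|x1 - x2| + `|y1 - y2|))
  (hC2 : C2 = `|g 0 0|)
  (I : countType) (e : I -> V) (lam q : I -> R)
  (he : orthonormal_basis ip e)
  (hBe : forall i, D (e i) /\ - B (e i) = lam i *: e i)
  (Q : {linear V -> V}) (hQcont : continuous Q)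
  (hQpos : positive_op ip setT Q) (hQsym : symmetric_op ip setT Q)
  (hQtrace : (\esum_(i in [set: I]) (ip (Q (e i)) (e i))%:E < +oo)%E)
  (hQe : forall i, Q (e i) = q i *: e i)
  (P : probability (hpath V gamma) R)
  (hP : fbm_law P ip H2 Q) (hergodic : ergodic_shift P)
  (hlBC1 : C1 < lB)
  (x : V) (eps : R) (heps : 0 < eps)
  (phi : R -> hpath V gamma -> V -> V)
  (hphi : forall w y, mild_solution D B S g eps x w y (fun t => phi t w y))
  (hrds : is_rds eps phi) :
  exists Y : hpath V gamma -> V,
    [/\ random_fixed_point eps P phi Y,
        tempered P eps (fun w => `|Y w|),
        attracting eps P phi (attracting_ball B S eps x lB C1 C2) Y &
        exp_attracting eps P phi (attracting_ball B S eps x lB C1 C2) Y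
          ((lB - C1) / eps)].
Proof.
have H01 : 0 < H2 < 1 by move: hH1 hH2 => /andP[? ?] /andP[? ?]; lra.
have al01 : 0 < H2 / 2 < 1 by move: H01 => /andP[? ?]; lra.
have /andP[gam0 _] := hgamma.
have [S0 _] := hS.
(* On the padding the vector is 0 and any eigenvalue fits; [lB] preserves the spectral bound
   [lB <= lamn n]. *)
set en := seq_basis e; pose lamn n := oapp lam lB (pickle_inv n).
have eorth := seq_basis_orth he; have enorm := seq_basis_norm he.
have emax := seq_basis_max he.
have D0 : D 0 by case: hBlin.
have B0 : B 0 = 0 by exact: linear_op0 hBlin.
have lam0 i : 0 <= lam i.
  have [De Be] := hBe i; have := hBpos _ De.
  by rewrite /= Be ipZl he.1 eqxx mulr1.
have lamB n : lB <= lamn n.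
  rewrite /lamn; case: pickle_inv => [i|] //=; have [De Be] := hBe i.
  by apply: (eigenvalue_ge hip hlB S0 hSgen hSexp hBsym De Be) => //; rewrite he.1 eqxx.
have Be n : D (en n) /\ - B (en n) = lamn n *: en n.
  rewrite /en /seq_basis /lamn; case: pickle_inv => [i|] /=; first exact: hBe.
  by rewrite B0 oppr0 scaler0.
have Scoord n t u : 0 <= t -> ip (S t u) (en n) = expR (- lamn n * t) * ip u (en n).
  move=> t0; have [De Be'] := Be n.
  apply: (semigroup_coord hip hlB S0 hSgen hSexp hBsym De Be') => //.
  exact: le_trans (ltW hlB) (lamB n).
have Sle t u : 0 <= t -> `|S t u| <= `|u| by move=> t0; exact: (semigroup_le hlB hSexp).
pose k := (lB - C1) / eps; have k0 : 0 < k := rate_gt0 heps hlBC1.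
have lC : 0 < lB - C1 by rewrite subr_gt0.
have C20 : 0 <= C2 by rewrite hC2.
have [G G0 hG] := noise_bound hip eorth enorm emax hlB lamB Be Scoord hBsym Sle heps al01.
have [Z Z0 hZ] := Zst_bound hip eorth enorm emax hlB lamB Be hBinv Scoord heps al01 hBlin gamma.
have contraction w y1 y2 t : 0 <= t ->
    `|phi t w y1 - phi t w y2| <= expR (- k * t) * `|y1 - y2|.
  by move=> t0; exact: (mild_contraction hip hSexp heps hC1 hg (hphi w y1) (hphi w y2)).
pose b := C1 * `|x| + C2.
have b0 : 0 <= b by rewrite addr_ge0// mulr_ge0// ltW.
(* With X = (1 + t / eps)^3, [mild_growth] gives (b + lB G C X) / (lB - C1), and b + lB G C X <= (b
   + lB G) (1 + C X). *)
pose Phi := (b + lB * G) / (lB - C1).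
have Phi0 : 0 < Phi by rewrite divr_gt0// ltr_wpDl// mulr_gt0.
have growth (w : hpath V gamma) C t : 0 <= C -> holder_growth (H2 / 2) C w -> 0 <= t ->
    `|phi t w 0| <= Phi * (1 + C * (1 + t / eps) ^+ 3).
  move=> C0 hw t0; pose X := (1 + t / eps) ^+ 3.
  have X0 : 0 <= X by rewrite exprn_ge0// addr_ge0// divr_ge0// ltW.
  apply: le_trans (mild_growth (Nb := G * C * X) hip hlB hSexp heps hC1 hlBC1 hg hC2
    (hphi w 0) t0 _) _.
    move=> r I2 /andP[r0 rt] hI DI.
    apply: le_trans (hG _ C r I2 C0 (path_fun0 w) hw r0 hI DI) _.
    apply: ler_wpM2l; first by rewrite mulr_ge0// ltW.
    apply: lerXn2r; rewrite ?nnegrE ?addr_ge0 ?divr_ge0 ?(ltW heps)//.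
    by rewrite lerD2l ler_pM2r ?invr_gt0.
  rewrite /Phi [leRHS]mulrAC ler_pM2r ?invr_gt0// -/b -/X.
  have CX : 0 <= C * X by rewrite mulr_ge0.
  have bCX : 0 <= b * (C * X) by rewrite mulr_ge0.
  have lG : 0 <= lB * G by rewrite mulr_ge0 ?ltW.
  rewrite -subr_ge0 (_ : _ - _ = b * (C * X) + lB * G); first by rewrite addr_ge0.
  ring.
pose r0 := 2 * (eps^-1 * (C1 * (Z + `|x|) + C2)) * (1 + 2 / (lB - C1)) * (2 / k).
have r00 : 0 <= r0.
  rewrite /r0; apply: mulr_ge0; last by rewrite divr_ge0// ltW.
  apply: mulr_ge0; last by rewrite addr_ge0// divr_ge0// ltW.
  apply: mulr_ge0 => //; rewrite mulr_ge0 ?invr_ge0 ?(ltW heps)// addr_ge0//.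
  by rewrite mulr_ge0 ?addr_ge0 ?(ltW hC1) ?(ltW Z0).
have Psi0 : 0 < r0 + Z by rewrite ltr_wpDl.
have ball_le (w : hpath V gamma) C y : 0 <= C -> holder_growth (H2 / 2) C w ->
    attracting_ball B S eps x lB C1 C2 w y -> `|y| <= (r0 + Z) * (1 + C).
  move=> C0 hw; rewrite /attracting_ball/= => hy.
  have : (`|y - Zst B S eps w|%:E <= (r0 * (1 + C))%:E)%E.
    apply: le_trans hy _; apply: (radius_bound x heps hC1 hlBC1 hC2 Z0 C0) => r.
    have [C'0 hw'] := holder_growth_vtheta heps r C0 hw.
    by rewrite normrM normfV (gtr0_norm heps); exact: hZ.
  rewrite lee_fin => hy'; rewrite mulrDl -[y in `|y|](subrK (Zst B S eps w)).
  by apply: le_trans (ler_normD _ _) _; apply: lerD => //; exact: hZ.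
pose tau := fine (\esum_(i in [set: I]) (ip (Q (e i)) (e i))%:E).
have Q0 u : 0 <= ip (Q u) u by exact: hQpos.
have qtau N : \sum_(0 <= n < N) ip (Q (en n)) (en n) <= tau.
  exact: seq_basis_trace.
have tau0 : 0 <= tau by have := qtau 0%N; rewrite big_geq.
have c0 : 0 < 64 * (tau + 1) by rewrite mulr_gt0// ltr_wpDl.
have /andP[H0 _] := H01.
have tail := fbm_tail hip H0 hP eorth enorm emax (fun n => Q0 (en n)) qtau.
have full := tame_full hsep gam0 H01 c0 hergodic tail.
exists (fixed_point eps (H2 / 2) phi); split.
- exact: (fixed_point_random hsep heps k0 Phi0 hrds contraction growth full).
- exact: (fixed_point_tempered heps k0 Phi0 hrds contraction growth full).
- exact: (fixed_point_attracting heps k0 Phi0 hrds contraction growth full Psi0 ball_le).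
- exact: (fixed_point_exp_attracting heps k0 Phi0 hrds contraction growth full Psi0 ball_le).
Qed.
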